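(* Let $A$ be a complex affine Poisson algebra and $P$ a Poisson prime ideal of $A$. The following are equivalent: (1) $P$ is Poisson rational; (2) $P$ is Poisson primitive; (3) the set of Poisson prime ideals $Q\supseteq P$ with $\mathrm{ht}(Q)=\mathrm{ht}(P)+1$ is finite.
   Context: A Poisson algebra over a field $k$ is a commutative $k$-algebra $A$ with a $k$-bilinear Lie bracket $\{-,-\}$ such that $\{-,x\}$ is a derivation for each $x\in A$. Complex affine means finitely generated over $\mathbb C$ and an integral domain. A Poisson ideal is an ideal $I$ with $\{I,A\}\subseteq I$; a Poisson prime is a prime Poisson ideal. $P$ is Poisson primitive if it is the largest Poisson ideal contained in some maximal ideal of $A$. $P$ is Poisson rational if the Poisson centre $\{z:\{z,-\}\equiv0\}$ of $\operatorname{Frac}(A/P)$ (with induced bracket) is algebraic over $\mathbb C$. $\mathrm{ht}$ denotes height of a prime ideal. *)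

(* Defs.v *)
From HB Require Import structures.
From mathcomp Require Import all_boot all_order all_algebra.
From mathcomp Require Import boolp classical_sets cardinality.
From mathcomp Require Import Rstruct.
From mathcomp Require Import complex.

Set Implicit Arguments.
Unset Strict Implicit.
Unset Printing Implicit Defensive.
Import GRing.Theory.
Local Open Scope ring_scope.
Local Open Scope classical_set_scope.

Definition CC : fieldType := complex Rdefinitions.R.

Section Poisson.
Variable A : comAlgType CC.

Definition poisson_bracket (br : A -> A -> A) : Prop :=
  [/\ (forall (c : CC) x y z, br (c *: x + y) z = c *: br x z + br y z),
      (forall (c : CC) x y z, br z (c *: x + y) = c *: br z x + br z y),
      (forall x, br x x = 0),
      (forall x y z, br x (br y z) + br y (br z x) + br z (br x y) = 0)
    & (forall x y z, br (x * y) z = x * br y z + br x z * y)].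

Definition generates_alg (s : seq A) : Prop :=
  forall S : set A,
    (forall c : CC, S (c%:A)) -> (forall x, x \in s -> S x) ->
    (forall x y, S x -> S y -> S (x + y)) ->
    (forall x y, S x -> S y -> S (x * y)) ->
    forall a, S a.

Definition integral_domain : Prop :=
  (1 : A) != 0 /\ forall x y : A, x * y = 0 -> x = 0 \/ y = 0.

Definition complex_affine : Prop :=
  (exists s : seq A, generates_alg s) /\ integral_domain.

Definition ideal (I : set A) : Prop :=
  [/\ I 0, (forall x y, I x -> I y -> I (x + y)) & (forall a x, I x -> I (a * x))].

Definition prime_ideal (I : set A) : Prop :=
  [/\ ideal I, ~ I 1 & forall x y, I (x * y) -> I x \/ I y].

Definition maximal_ideal (M : set A) : Prop :=
  [/\ ideal M, ~ M 1 & forall J, ideal J -> M `<=` J -> J = M \/ J 1].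

Definition poisson_ideal (br : A -> A -> A) (I : set A) : Prop :=
  ideal I /\ forall x a, I x -> I (br x a).

Definition poisson_prime (br : A -> A -> A) (I : set A) : Prop :=
  prime_ideal I /\ poisson_ideal br I.

Definition poisson_primitive (br : A -> A -> A) (P : set A) : Prop :=
  exists M, [/\ maximal_ideal M, poisson_ideal br P, P `<=` M &
    forall I, poisson_ideal br I -> I `<=` M -> I `<=` P].

Definition prime_chain (c : nat -> set A) (n : nat) : Prop :=
  (forall i, (i <= n)%N -> prime_ideal (c i)) /\
  (forall i, (i < n)%N -> c i `<` c i.+1).

Definition height (Q : set A) (n : nat) : Prop :=
  (exists c, prime_chain c n /\ c n = Q) /\
  (forall c m, prime_chain c m -> c m = Q -> (m <= n)%N).

Definition is_frac_of_quotient (P : set A) (F : fieldType)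
  (iota : {rmorphism A -> F}) : Prop :=
  (forall a, iota a = 0 <-> P a) /\
  (forall z : F, exists a b, iota b != 0 /\ z = iota a / iota b).

(* brF is the Poisson bracket on F induced by br (the unique Lie bracket on F
   that is a biderivation-compatible extension of the bracket of A/P). *)
Definition induced_bracket (br : A -> A -> A) (F : fieldType)
  (iota : {rmorphism A -> F}) (brF : F -> F -> F) : Prop :=
  [/\ (forall x y z, brF (x + y) z = brF x z + brF y z),
      (forall x, brF x x = 0),
      (forall x y z, brF x (brF y z) + brF y (brF z x) + brF z (brF x y) = 0),
      (forall x y z, brF (x * y) z = x * brF y z + brF x z * y)
    & (forall a b, brF (iota a) (iota b) = iota (br a b))].

Definition algebraic_over_C (F : fieldType) (iota : {rmorphism A -> F}) (z : F)
  : Prop :=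
  exists p : {poly CC}, p != 0 /\ root (map_poly (fun c => iota (c%:A)) p) z.

Definition poisson_rational (br : A -> A -> A) (P : set A) : Prop :=
  forall (F : fieldType) (iota : {rmorphism A -> F}) (brF : F -> F -> F),
    is_frac_of_quotient P iota -> induced_bracket br iota brF ->
    forall z : F, (forall w, brF z w = 0) -> algebraic_over_C iota z.

Definition next_height_finite (br : A -> A -> A) (P : set A) : Prop :=
  exists n, height P n /\
    finite_set [set Q | poisson_prime br Q /\ P `<=` Q /\ height Q n.+1].

End Poisson.

(* Main.v *)
(* Let R = Frac (A / P) and call its Poisson-central elements Casimirs.
   If P is rational, a point of the variety of P chosen off countably many
   hypersurfaces, the zero sets of Wronskian-like minors in the iterated
   brackets of basis elements, has a maximal ideal containing no Poisson ideal
   larger than P.  Conversely, if P is primitive through M and z is a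
   transcendental Casimir, some z - lambda yields a Poisson ideal between P and
   M.  A transcendental Casimir a / b also yields infinitely many Poisson primes
   of next height, minimal over the ideals (a - lambda b).

   Finiteness for rational P: by Noether normalization A / P is, generically,
   R[y] / p with R a polynomial ring.  To every Poisson prime Q of next height,
   up to finitely many lying over prime divisors of a discriminant, one attaches
   a 1-form that has a simple pole along Q, no other pole away from the
   discriminant, and bounded order at infinity; it comes from Lagrange
   interpolation over the roots of p along a general line.  Hamiltonian
   derivations preserve Q, so the Lie derivatives of these forms along them have
   no pole along Q and lie in a fixed finite-dimensional space.  With more
   primes than that dimension some C-combination of the forms is annihilated by
   all the Lie derivatives; were there unboundedly many primes, there would be
   more such combinations than the rank of the module of 1-forms, hence a linear
   relation whose coefficients, by minimality of support, are Casimirs, that is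
   complex constants.  Such a relation contradicts the simple poles. *)
Require Import Defs.
From HB Require Import structures.
From mathcomp Require Import all_boot all_order all_algebra all_field.
From mathcomp Require Import boolp classical_sets cardinality.
From mathcomp Require Import ring zify.
From mathcomp Require Import mpoly.
From mathcomp Require Import complex Rstruct.
From Stdlib Require Import Runcountable.
Set Implicit Arguments.
Unset Strict Implicit.
Unset Printing Implicit Defensive.
Import GRing.Theory.
Local Open Scope ring_scope.
Local Open Scope classical_set_scope.

(** * Unique factorization *)

(** A prime [Q] just above [P] has in general no equation in A/P, so the logarithmic derivative that
    would detect it is not at hand. The substitute comes from the polynomial ring R: by minimality
    [Q] meets R in (g) with g prime, and where the fixed element [D0], a multiple of p'(y), is
    invertible, g is a uniformizer at [Q]. Modulo g, and up to a factor prime to g, p splits as q h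
    with q the part belonging to [Q]; then dg h(y) q'(y) / (g p'(y)) agrees with dg / g at [Q] up to
    regular terms, while at the other primes over g the factor h(y) cancels g. The numerator matters
    only modulo g, and h, q have no bounded degree; interpolation selects a representative of degree
    at most deg g plus a constant. The degrees then balance: the Lie derivative has denominator g^2
    and a numerator of degree at most 2 deg g + c with c independent of [Q], and once it is regular,
    division by g^2 leaves degree at most c. Hence one finite-dimensional space serves all [Q]. *)

Definition dvdr (R : comNzRingType) (g x : R) := exists c, x = c * g.

Definition prime_elt (R : idomainType) (g : R) :=
  [/\ g != 0, g \isn't a GRing.unit
    & forall a b, dvdr g (a * b) -> dvdr g a \/ dvdr g b].

(** The factors are prime elements, not merely irreducible ones, so uniqueness up to units and order
    is automatic. *)
Definition ufd (R : idomainType) := forall r : R, r != 0 ->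
  exists (u : R) (s : seq R), [/\ u \is a GRing.unit,
    (forall g, g \in s -> prime_elt g) & r = u * \prod_(g <- s) g].

Section Dvd.
Variable R : comNzRingType.
Implicit Types g x y : R.

Lemma dvdr0 g : dvdr g 0. Proof. by exists 0; rewrite mul0r. Qed.
Lemma dvdr_refl g : dvdr g g. Proof. by exists 1; rewrite mul1r. Qed.
Lemma dvdrD g x y : dvdr g x -> dvdr g y -> dvdr g (x + y).
Proof. by case=> a -> [b ->]; exists (a + b); rewrite mulrDl. Qed.
Lemma dvdrN g x : dvdr g x -> dvdr g (- x).
Proof. by case=> a ->; exists (- a); rewrite mulNr. Qed.
Lemma dvdrB g x y : dvdr g x -> dvdr g y -> dvdr g (x - y).
Proof. by move=> gx gy; apply: dvdrD => //; apply: dvdrN. Qed.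
Lemma dvdr_mull g x y : dvdr g y -> dvdr g (x * y).
Proof. by case=> a ->; exists (x * a); rewrite mulrA. Qed.
Lemma dvdr_mulr g x y : dvdr g x -> dvdr g (x * y).
Proof. by rewrite mulrC; apply: dvdr_mull. Qed.
Lemma dvdr_sum g (I : Type) (r : seq I) (P : pred I) (F : I -> R) :
  (forall i, P i -> dvdr g (F i)) -> dvdr g (\sum_(i <- r | P i) F i).
Proof. by move=> h; elim/big_ind: _ => //; [exact: dvdr0|exact: dvdrD]. Qed.
Lemma dvdr_trans g x y : dvdr g x -> dvdr x y -> dvdr g y.
Proof. by case=> a -> [b ->]; exists (b * a); rewrite mulrA. Qed.

Lemma dvdr_polyC g (p : {poly R}) : dvdr g%:P p <-> forall i, dvdr g p`_i.
Proof.
split=> [[q ->] i|h].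
  by rewrite coefMC; exists q`_i.
have [f hf] := choice h; exists (\poly_(i < size p) f i).
apply/polyP=> i; rewrite coefMC coef_poly.
case: ltnP => hi; first by rewrite -hf.
by rewrite nth_default // mul0r.
Qed.

End Dvd.

Section PrimeElt.
Variable R : idomainType.
Implicit Types g x y : R.

Lemma prime_elt_neq0 g : prime_elt g -> g != 0. Proof. by case. Qed.

Lemma prime_dvdM g x y : prime_elt g -> dvdr g (x * y) -> dvdr g x \/ dvdr g y.
Proof. by case=> _ _; apply. Qed.

Lemma prime_dvdX g x n : prime_elt g -> dvdr g (x ^+ n) -> dvdr g x.
Proof.
move=> pg; elim: n => [|n IH]; last by rewrite exprS => /(prime_dvdM pg)[].
rewrite expr0 => -[c h]; case: pg => _ /negP[].
by apply/unitrP; exists c; rewrite -h mulrC -h.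
Qed.

Lemma prime_dvd_prod g (s : seq R) : prime_elt g ->
  dvdr g (\prod_(x <- s) x) -> exists2 x, x \in s & dvdr g x.
Proof.
move=> pg; elim: s => [|x s IH].
  rewrite big_nil => -[c h]; case: pg => _ /negP[].
  by apply/unitrP; exists c; rewrite -h mulrC -h.
rewrite big_cons => /(prime_dvdM pg)[h|/IH[y ys h]].
  by exists x => //; rewrite mem_head.
by exists y => //; rewrite in_cons ys orbT.
Qed.

Lemma dvdr_unit g u : u \is a GRing.unit -> dvdr g u -> g \is a GRing.unit.
Proof.
by move=> uu [c h]; move: uu; rewrite h unitrM => /andP[].
Qed.

Lemma prime_ndvd1 g : prime_elt g -> ~ dvdr g 1.
Proof. by move=> [_ /negP ng _] h; apply: ng; apply: dvdr_unit h; rewrite unitr1. Qed.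

Lemma prime_assoc g x : prime_elt g -> prime_elt x -> dvdr g x ->
  exists2 u, u \is a GRing.unit & x = u * g.
Proof.
move=> pg px [c hc]; exists c => //.
have: dvdr x (c * g) by exists 1; rewrite mul1r hc.
case/(prime_dvdM px) => -[d hd].
  case: pg => _ /negP[]; apply/unitrP; exists d.
  have h : x * (d * g) = x * 1 by rewrite mulr1 [RHS]hc hd; ring.
  by have := mulfI (prime_elt_neq0 px) h => e; rewrite [g * d]mulrC.
apply/unitrP; exists d.
have h : g * (d * c) = g * 1 by rewrite mulr1 [RHS]hd hc; ring.
by have := mulfI (prime_elt_neq0 pg) h => e; rewrite [c * d]mulrC.
Qed.

Lemma ufd_ind (P : R -> Prop) : ufd R ->
  (forall u, u \is a GRing.unit -> P u) ->
  (forall g r, prime_elt g -> r != 0 -> P r -> P (g * r)) ->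
  forall r, r != 0 -> P r.
Proof.
move=> hR hu hg r /hR[u [s [uu ps ->]]].
elim: s ps => [|g s IH] ps; first by rewrite big_nil mulr1; apply: hu.
rewrite big_cons mulrCA; apply: hg.
- by apply: ps; rewrite mem_head.
- rewrite mulf_neq0 //; first by apply: contraTneq uu => ->; rewrite unitr0.
  rewrite prodf_seq_neq0; apply/allP => x xs.
  by apply: prime_elt_neq0; apply: ps; rewrite in_cons xs orbT.
by apply: IH => x xs; apply: ps; rewrite in_cons xs orbT.
Qed.

(** Gauss's lemma. The product of the leading coefficients is divisible by [g], so one of the
    factors can be stripped of its leading term, and the sum of the sizes drops. *)
Lemma prime_polyC g : prime_elt g -> prime_elt (g%:P).
Proof.
move=> pg; have [g0 gu gM] := pg; split.
- by rewrite polyC_eq0.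
- by rewrite poly_unitE coefC eqxx negb_and gu orbT.
move=> a b; have [n] := ubnP (size a + size b)%N.
elim: n a b => // n IH a b; rewrite ltnS => hn hab.
have [a0|a0] := eqVneq a 0; first by left; rewrite a0; exact: dvdr0.
have [b0|b0] := eqVneq b 0; first by right; rewrite b0; exact: dvdr0.
have key (x : {poly R}) : x != 0 -> dvdr g (lead_coef x) -> 
  exists2 x' : {poly R}, (size x' < size x)%N & exists2 t, dvdr g%:P t & x = x' + t.
  move=> x0 [c hc]; exists (\poly_(i < (size x).-1) x`_i).
    by rewrite (leq_ltn_trans (size_poly _ _)) // prednK // size_poly_gt0.
  exists (lead_coef x *: 'X^((size x).-1)).
    by rewrite hc; exists (c *: 'X^((size x).-1)); rewrite -!mul_polyC polyCM; ring.
  apply/polyP=> i; rewrite coefD coef_poly coefZ coefXn.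
  case: ltngtP => hi; rewrite ?mulr0 ?addr0 ?mulr1 ?add0r //.
    by rewrite nth_default //; move: hi; case: (size x).
  by rewrite hi.
have hl : dvdr g (lead_coef a * lead_coef b).
  by rewrite -lead_coefM; move/dvdr_polyC: hab; apply.
case/(prime_dvdM pg): hl => hl.
  have [a' sa' [t ht ea]] := key a a0 hl.
  have: dvdr g%:P (a' * b).
    have -> : a' * b = a * b - t * b by rewrite ea; ring.
    by apply: dvdrB => //; apply: dvdr_mulr.
  case/IH; [by lia| |by right].
  by move=> h; left; rewrite ea; apply: dvdrD.
have [b' sb' [t ht eb]] := key b b0 hl.
have: dvdr g%:P (a * b').
  have -> : a * b' = a * b - a * t by rewrite eb; ring.
  by apply: dvdrB => //; apply: dvdr_mull.
case/IH; [by lia|by left|].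
by move=> h; right; rewrite eb; apply: dvdrD.
Qed.

End PrimeElt.

(* A scalar multiple of [H] that factors comes from a factorization of [H]:
   the primes of the scalar are cancelled one at a time. *)
Lemma ufd_cancel (R : idomainType) : ufd R -> forall r, r != 0 -> forall a b H : {poly R},
  a * b = r *: H -> exists (a0 b0 : {poly R}) (c c' : R),
    [/\ c != 0, c' != 0, a = c *: a0, b = c' *: b0 & a0 * b0 = H].
Proof.
move=> hR; apply: (ufd_ind hR) => [u uu|g r pg r0 IH] a b H hab.
  exists (u^-1 *: a), b, u, 1.
  have u0 : u != 0 by apply: contraTneq uu => ->; rewrite unitr0.
  split=> //; rewrite ?oner_eq0 ?scale1r //.
    by rewrite scalerA divrr // scale1r.
  by rewrite -scalerAl hab scalerA mulVr // scale1r.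
have g0 := prime_elt_neq0 pg.
have : dvdr g%:P (a * b).
  by exists (r *: H); rewrite hab -scalerA -mul_polyC mulrC.
have cancel (x y : {poly R}) : g *: x = g *: y -> x = y.
  by rewrite -!mul_polyC => /mulfI; apply; rewrite polyC_eq0.
case/(prime_dvdM (prime_polyC pg)) => -[d]; rewrite mulrC mul_polyC => hd.
  have /IH : d * b = r *: H.
    by apply: cancel; rewrite scalerAl -hd hab scalerA.
  case=> a0 [b0 [c [c' [c0 c0' ea eb hH]]]].
  exists a0, b0, (g * c), c'; split=> //; first by rewrite mulf_neq0.
  by rewrite hd ea scalerA.
have /IH : a * d = r *: H.
  by apply: cancel; rewrite scalerAr -hd hab scalerA.
case=> a0 [b0 [c [c' [c0 c0' ea eb hH]]]].
exists a0, b0, c, (g * c'); split=> //; first by rewrite mulf_neq0.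
by rewrite hd eb scalerA.
Qed.


Section Gauss.
Variable R : idomainType.
Hypothesis hR : ufd R.
Local Notation E := {fraction R}.
Local Notation tf := (@FracField.tofrac R).

Lemma frac_clear_denom (z : E) : exists a b : R, b != 0 /\ tf b * z = tf a.
Proof.
elim/quotP: z => x _; exists (frac x).1, (frac x).2.
have hx := denom_ratioP x; split=> //.
unlock tofrac; rewrite -[LHS]FracField.pi_mul; apply/eqmodP => /=.
rewrite FracField.equivfE /FracField.mulf !numden_Ratio ?oner_neq0 ?mul1r ?mulr1 //.
Qed.

Lemma frac_poly_clear_denom (p : {poly E}) :
  exists r (q : {poly R}), r != 0 /\ map_poly tf q = tf r *: p.
Proof.
elim/poly_ind: p => [|p c [r [q [r0 hq]]]].
  by exists 1, 0; rewrite oner_neq0 !rmorph0 scaler0.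
have [a [b [b0 hb]]] := frac_clear_denom c.
exists (b * r), (b *: q * 'X + (r * a)%:P); split; first by rewrite mulf_neq0.
rewrite rmorphD rmorphM /= map_polyZ hq map_polyX map_polyC /= !tofracM -hb.
rewrite scalerDr scalerAl scalerA -!mul_polyC -!polyCM.
by rewrite [tf b * tf r * c]mulrAC [tf b * c * _]mulrC.
Qed.

Lemma map_tofrac_inj : injective (map_poly tf).
Proof. by apply: map_inj_poly; [move=> x y /eqP; rewrite tofrac_eq => /eqP|rewrite tofrac0]. Qed.

(** After clearing denominators, [ufd_cancel] turns the factorization over the fraction field into
    one over [R]; its leading coefficients multiply to 1, hence are units that can be normalized
    away. *)
Lemma gauss_monic_factor (H : {poly R}) (a b : {poly E}) :
  H \is monic -> a \is monic -> map_poly tf H = a * b ->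
  exists2 a0, a0 \is monic & map_poly tf a0 = a.
Proof.
move=> mH ma hab.
have [r [a1 [r0 ha]]] := frac_poly_clear_denom a.
have [r' [b1 [r0' hb]]] := frac_poly_clear_denom b.
have h : a1 * b1 = (r * r') *: H.
  apply: map_tofrac_inj; rewrite rmorphM /= ha hb map_polyZ hab /= tofracM.
  by rewrite -scalerAl -scalerAr scalerA.
have rr : r * r' != 0 by rewrite mulf_neq0.
have [a0 [b0 [c [c' [c0 c0' ea eb e]]]]] := ufd_cancel hR rr h.
have lu : lead_coef a0 \is a GRing.unit.
  have := monicP mH; rewrite -e lead_coefM => e1.
  by apply/unitrP; exists (lead_coef b0); rewrite mulrC.
exists ((lead_coef a0)^-1 *: a0).
  by apply/monicP; rewrite lead_coefZ mulVr.
have l0 : tf (lead_coef a0) != 0.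
  by rewrite tofrac_eq0; apply: contraTneq lu => ->; rewrite unitr0.
have hk : map_poly tf a0 = tf (lead_coef a0) *: a.
  have e2 : tf c *: map_poly tf a0 = tf r *: a by rewrite -ha ea map_polyZ.
  have := congr1 lead_coef e2; rewrite !lead_coefZ (monicP ma) mulr1.
  rewrite lead_coef_map_inj ?tofrac0 //; last first.
    by move=> x y /eqP; rewrite tofrac_eq => /eqP.
  move=> e3; rewrite -e3 -scalerA in e2.
  have c00 : tf c != 0 by rewrite tofrac_eq0.
  by move: e2; rewrite -!mul_polyC => /mulfI; apply; rewrite polyC_eq0.
by rewrite map_polyZ /= hk scalerA rmorphV // mulVf // scale1r.
Qed.

(** The linear factor X - z of a monic polynomial over [R] has its coefficients in [R]. *)
Lemma ufd_int_closed (z : E) : integralOver tf z -> exists a, z = tf a.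
Proof.
case=> p mp rp.
have : ('X - z%:P) %| map_poly tf p by rewrite dvdp_XsubCl.
case/dvdpP => q hq.
have [|a0 ma ha] := gauss_monic_factor mp (monicXsubC z) (b := q).
  by rewrite hq mulrC.
exists (- a0`_0); have := congr1 (fun p : {poly E} => p`_0) ha.
rewrite coef_map coefB coefX coefC eqxx /= sub0r => /eqP.
by rewrite -eqr_oppLR tofracN eq_sym => /eqP.
Qed.

End Gauss.

Section UfdPoly.
Variable R : idomainType.
Hypothesis hR : ufd R.
Local Notation tf := (@FracField.tofrac R).

Definition primitive_poly (f : {poly R}) :=
  forall g, prime_elt g -> ~ dvdr g%:P f.

(** A prime dividing [f] divides its leading coefficient, so the extraction of primes stops after at
    most as many steps as that coefficient has prime factors. *)
Lemma ufd_primitive_part (f : {poly R}) : f != 0 ->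
  exists (c : R) (f0 : {poly R}), [/\ c != 0, f = c *: f0 & primitive_poly f0].
Proof.
move=> f0.
have : lead_coef f != 0 by rewrite lead_coef_eq0.
case/hR => u [s [uu ps hs]].
have [n] := ubnP (size s).
elim: n f f0 u uu s ps hs => // n IH f f0 u uu s ps hs hn.
have [[g [pg [f1 hg]]]|H] := EM (exists g, prime_elt g /\ dvdr g%:P f); last first.
  by exists 1, f; rewrite oner_neq0 scale1r; split=> // g pg hg; apply: H; exists g.
have hl : lead_coef f = lead_coef f1 * g by rewrite hg lead_coefM lead_coefC.
have : dvdr g (\prod_(x <- s) x).
  exists (u^-1 * lead_coef f1); rewrite -mulrA -hl hs mulrA mulVr //.
  by rewrite mul1r.
case/(prime_dvd_prod pg) => x xs.
case/(prime_assoc pg (ps _ xs)) => w uw hx.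
have g0 := prime_elt_neq0 pg.
have [|||||c [f2 [c0 h1 h2]]] := IH f1 _ (u * w) _ (rem x s).
- by apply: contraNneq f0 => e; rewrite hg e mul0r.
- by rewrite unitrM uu.
- by move=> y ys; apply: ps; apply: (mem_rem ys).
- apply: (mulIf g0); rewrite -hl hs (big_rem _ xs) /= hx; ring.
- rewrite size_rem //; move: hn xs; case: (s) => //=.
exists (c * g), f2; split=> //; first by rewrite mulf_neq0.
by rewrite hg h1 -scalerA mulrC mul_polyC scalerA mulrC scalerA.
Qed.

Lemma primitive_dvd_scale (f a : {poly R}) r : primitive_poly f -> r != 0 ->
  dvdr f (r *: a) -> dvdr f a.
Proof.
move=> hf r0; move: r r0 a; apply: (ufd_ind hR) => [u uu|g r pg r0 IH] a [q hq].
  exists (u^-1 *: q); rewrite -scalerAl -hq scalerA mulVr // scale1r //.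
have : dvdr g%:P (q * f) by exists (r *: a); rewrite -hq -mul_polyC -mul_polyC polyCM; ring.
case/(prime_dvdM (prime_polyC pg)) => [[d hd]|/(hf _ pg)//].
apply: IH; exists d; have g0 := prime_elt_neq0 pg.
have : g%:P * (r *: a) = g%:P * (d * f).
  by rewrite mul_polyC scalerA hq hd; ring.
by move/mulfI; apply; rewrite polyC_eq0.
Qed.

(** Irreducibility is assumed up to scalars, that is, over the fraction field; there [f] is prime,
    and by primitivity divisibility by [f] descends to [R]. *)
Lemma primitive_irreducible_prime (f : {poly R}) : (1 < size f)%N ->
  primitive_poly f ->
  (forall (a b : {poly R}) c, c != 0 -> c *: f = a * b ->
     (size a <= 1)%N \/ (size b <= 1)%N) -> prime_elt f.
Proof.
move=> sf pf hf.
have f0 : f != 0 by rewrite -size_poly_gt0; apply: ltn_trans sf.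
have sm (p : {poly R}) : size (map_poly tf p) = size p.
  rewrite size_map_inj_poly ?tofrac0 //.
  by move=> x y /eqP; rewrite tofrac_eq => /eqP.
have irr : irreducible_poly (map_poly tf f).
  split; first by rewrite sm.
  move=> q sq /dvdpP[q' hq].
  have [r [a [r0 ha]]] := frac_poly_clear_denom q.
  have [r' [b [r0' hb]]] := frac_poly_clear_denom q'.
  have e : (r' * r) *: f = b * a.
    apply: map_tofrac_inj; rewrite map_polyZ [RHS]rmorphM /= ha hb hq.
    by rewrite -scalerAl -scalerAr scalerA tofracM.
  have qn : q != 0.
    by apply/eqP=> e0; move: sf; rewrite -sm hq e0 mulr0 size_poly0.
  have qn' : q' != 0.
    by apply/eqP=> e0; move: sf; rewrite -sm hq e0 mul0r size_poly0.
  have sa : size a = size q by rewrite -sm ha size_scale // tofrac_eq0.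
  have sb : size b = size q' by rewrite -sm hb size_scale // tofrac_eq0.
  rewrite /eqp hq dvdp_mulIr /=.
  have [|h|h] := hf b a (r' * r) _ e; first by rewrite mulf_neq0.
    rewrite sb in h; have /size_poly1P[c c0 ->] : size q' == 1%N.
      by rewrite eqn_leq h size_poly_gt0.
    by rewrite mul_polyC dvdpZl.
  case/negP: sq; rewrite eqn_leq -{1}sa h size_poly_gt0 //.
split=> //.
  by apply/negP; rewrite poly_unitE => /andP[/eqP e]; rewrite e in sf.
move=> a b [q hq].
have : map_poly tf f %| map_poly tf a * map_poly tf b.
  by rewrite -rmorphM hq rmorphM dvdp_mulIr.
have key (x : {poly R}) : map_poly tf f %| map_poly tf x -> dvdr f x.
  case/dvdpP => y hy; have [r [z [r0 hz]]] := frac_poly_clear_denom y.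
  apply: (primitive_dvd_scale pf r0); exists z; apply: map_tofrac_inj.
  by rewrite map_polyZ [RHS]rmorphM /= hz hy scalerAl.
have [h|h] := boolP (map_poly tf f %| map_poly tf a); first by left; apply: key.
have cp : coprimep (map_poly tf f) (map_poly tf a).
  by rewrite irreducible_poly_coprime.
by rewrite Gauss_dvdpr // => /key; right.
Qed.

(** Induction on the degree: either the primitive part is prime, or a scalar multiple of it splits
    into two factors of positive degree, and [ufd_cancel] removes the scalar. *)
Lemma ufd_poly : ufd {poly R}.
Proof.
move=> f; have [n] := ubnP (size f); elim: n f => // n IH f hn f0.
have cat (a b : {poly R}) : f = a * b ->
   (exists (u : {poly R}) s, [/\ u \is a GRing.unit,
    (forall g, g \in s -> prime_elt g) & a = u * \prod_(g <- s) g]) ->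
   (exists (u : {poly R}) s, [/\ u \is a GRing.unit,
    (forall g, g \in s -> prime_elt g) & b = u * \prod_(g <- s) g]) ->
   (exists (u : {poly R}) s, [/\ u \is a GRing.unit,
    (forall g, g \in s -> prime_elt g) & f = u * \prod_(g <- s) g]).
  move=> -> [u [s [uu ps ->]]] [u' [s' [uu' ps' ->]]].
  exists (u * u'), (s ++ s'); split; first by rewrite unitrM uu.
    by move=> g; rewrite mem_cat => /orP[]; [apply: ps|apply: ps'].
  by rewrite big_cat /=; ring.
have const (c : R) : c != 0 -> exists (u : {poly R}) s, [/\ u \is a GRing.unit,
    (forall g, g \in s -> prime_elt g) & c%:P = u * \prod_(g <- s) g].
  case/hR => u [s [uu ps ->]]; exists u%:P, (map polyC s); split.
  - by rewrite poly_unitE coefC eqxx uu size_polyC; have -> : u != 0 by apply: contraTneq uu => ->; rewrite unitr0.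
  - by move=> g /mapP[x xs ->]; apply: prime_polyC; apply: ps.
  by rewrite polyCM big_map -(rmorph_prod (@polyC R)).
have [sf|sf] := leqP (size f) 1.
  by rewrite [f]size1_polyC //; apply: const; apply: contraNneq f0 => e; rewrite [f]size1_polyC // e.
have [c [f1 [c0 ef pf]]] := ufd_primitive_part f0.
have sf1 : size f1 = size f by rewrite ef size_scale.
have [H|H] := EM (exists (a b : {poly R}) c, [/\ c != 0, c *: f1 = a * b,
   (1 < size a)%N & (1 < size b)%N]); last first.
  apply: (cat c%:P f1); [by rewrite mul_polyC|exact: const|].
  exists 1, [:: f1]; split; rewrite ?unitr1 ?big_seq1 ?mul1r //.
  move=> g; rewrite inE => /eqP ->; apply: primitive_irreducible_prime => //.
    by rewrite sf1.
  move=> a b d d0 e; case: (leqP (size a) 1) => sa; first by left.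
  case: (leqP (size b) 1) => sb; first by right.
  by case: H; exists a, b, d.
case: H => a [b [d [d0 e sa sb]]].
have [a0 [b0 [k [k' [k0 k0' ea eb e1]]]]] := ufd_cancel hR d0 (esym e).
rewrite ea eb !size_scale // in sa sb.
have an : a0 != 0 by rewrite -size_poly_gt0; apply: leq_trans sa.
have bn : b0 != 0 by rewrite -size_poly_gt0; apply: leq_trans sb.
have ss : (size a0 + size b0)%N = (size f).+1.
  by rewrite -sf1 -e1 size_mul //; lia.
apply: (cat (c *: a0) b0); first by rewrite ef -e1 scalerAl.
  by apply: IH; rewrite -?size_poly_gt0 size_scale //; lia.
by apply: IH => //; lia.
Qed.

End UfdPoly.

Section UfdTransport.
Variables (R S : idomainType) (f : {rmorphism R -> S}) (g : {rmorphism S -> R}).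
Hypotheses (fK : cancel f g) (gK : cancel g f).

Lemma prime_transport x : prime_elt x -> prime_elt (g x).
Proof.
case=> x0 ux hx; split.
- by apply: contraNneq x0 => e; rewrite -[x]gK e rmorph0.
- by apply: contra ux => ux; rewrite -[x]gK rmorph_unit.
move=> a b [c e]; have : dvdr x (f a * f b).
  by exists (f c); rewrite -rmorphM e rmorphM gK.
by case/hx => -[d ed]; [left|right]; exists (g d); rewrite -rmorphM -ed fK.
Qed.

Lemma ufd_transport : ufd S -> ufd R.
Proof.
move=> hS r r0; have : f r != 0.
  by apply: contraNneq r0 => e; rewrite -[r]fK e rmorph0.
case/hS => u [s [uu ps e]]; exists (g u), (map g s); split.
- by rewrite rmorph_unit.
- by move=> x /mapP[y ys ->]; apply: prime_transport; apply: ps.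
by rewrite big_map -(rmorph_prod g) -rmorphM -e fK.
Qed.
End UfdTransport.

(** * Noether normalization *)

Section PolyHom.

Lemma mpoly_hom_ext n (C : comNzRingType) (S : comNzRingType)
    (f g : {rmorphism {mpoly C[n]} -> S}) :
  (forall c, f c%:MP = g c%:MP) -> (forall i, f 'X_i = g 'X_i) -> f =1 g.
Proof.
move=> hc hX p; rewrite [p]mpolyE !rmorph_sum; apply: eq_bigr => m _ /=.
rewrite -mul_mpolyC !rmorphM /= hc; congr (_ * _).
rewrite mpolyXE_id !rmorph_prod; apply: eq_bigr => i _ /=.
by rewrite !rmorphXn /= hX.
Qed.

Lemma poly_hom_ext (R S : nzRingType) (f g : {rmorphism {poly R} -> S}) :
  (forall c, f c%:P = g c%:P) -> f 'X = g 'X -> f =1 g.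
Proof.
move=> hc hX p; elim/poly_ind: p => [|p c IH]; first by rewrite !rmorph0.
by rewrite !rmorphD !rmorphM /= IH hX hc.
Qed.

Lemma coef_top_mul (R : nzRingType) (a b : {poly R}) s t :
  (size a <= s.+1)%N -> (size b <= t.+1)%N -> (a * b)`_(s + t) = a`_s * b`_t.
Proof.
move=> sa sb; rewrite coefM.
have hs : (s < (s + t).+1)%N by lia.
rewrite (bigD1 (Ordinal hs)) //= addKn big1 ?addr0 // => i /negP hi.
have [h|h] := ltnP i s.
  by rewrite [b`__]nth_default ?mulr0 //; apply: leq_trans sb _; lia.
rewrite nth_default ?mul0r //; apply: leq_trans sa _.
by rewrite ltn_neqAle h andbT; apply/eqP=> e; apply: hi; apply/eqP/val_inj.
Qed.

Lemma size_mul_le (R : nzRingType) (a b : {poly R}) s t :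
  (size a <= s.+1)%N -> (size b <= t.+1)%N -> (size (a * b)%R <= (s + t).+1)%N.
Proof. by move=> sa sb; apply: leq_trans (size_polyMleq _ _) _; lia. Qed.

End PolyHom.

(** * Making a polynomial monic by a linear change of coordinates *)

Section LinearChange.
Variables (n : nat) (C : fieldType) (v : 'I_n -> C).

Definition lchange_im (i : 'I_n.+1) : {poly {mpoly C[n]}} :=
  if unlift ord_max i is Some j then ('X_j)%:P + ((v j)%:MP)%:P * 'X else 'X.

(* The substitution that turns the last coordinate axis into the line spanned
   by [(v, 1)]. *)
Definition lchange : {mpoly C[n.+1]} -> {poly {mpoly C[n]}} :=
  mmap (polyC \o @mpolyC n C) lchange_im.
HB.instance Definition _ := GRing.RMorphism.on lchange.

Definition lback0 : {mpoly C[n]} -> {mpoly C[n.+1]} :=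
  mmap (@mpolyC n.+1 C) (fun j => 'X_(lift ord_max j) - (v j)%:MP * 'X_ord_max).
HB.instance Definition _ := GRing.RMorphism.on lback0.

Definition lback : {poly {mpoly C[n]}} -> {mpoly C[n.+1]} :=
  horner_morph (fun x => mulrC ('X_ord_max) (lback0 x)).
HB.instance Definition _ := GRing.RMorphism.on lback.

Lemma lchangeC c : lchange c%:MP = (c%:MP)%:P.
Proof. exact: mmapC. Qed.

Lemma lchangeX i : lchange 'X_i = lchange_im i.
Proof. by rewrite /lchange mmapX mmap1U. Qed.

Lemma lchange_im_lift j :
  lchange_im (lift ord_max j) = ('X_j)%:P + ((v j)%:MP)%:P * 'X.
Proof. by rewrite /lchange_im liftK. Qed.

Lemma lchange_im_max : lchange_im ord_max = 'X.
Proof. by rewrite /lchange_im unlift_none. Qed.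

Lemma lback0C c : lback0 c%:MP = c%:MP.
Proof. exact: mmapC. Qed.

Lemma lback0X j : lback0 'X_j = 'X_(lift ord_max j) - (v j)%:MP * 'X_ord_max.
Proof. by rewrite /lback0 mmapX mmap1U. Qed.

Lemma lbackC c : lback c%:P = lback0 c.
Proof. exact: horner_morphC. Qed.

Lemma lbackX : lback 'X = 'X_ord_max.
Proof. exact: horner_morphX. Qed.

Lemma lchangeK : cancel lchange lback.
Proof.
move=> p; apply: (mpoly_hom_ext (f := lback \o lchange) (g := idfun)) => [c|i] /=.
  by rewrite lchangeC lbackC lback0C.
rewrite lchangeX; case: (unliftP ord_max i) => [j|] ->.
  rewrite lchange_im_lift rmorphD rmorphM /= !lbackC lbackX lback0C lback0X.
  by rewrite subrK.
by rewrite lchange_im_max lbackX.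
Qed.

Lemma lbackK : cancel lback lchange.
Proof.
move=> p; apply: (poly_hom_ext (f := lchange \o lback) (g := idfun)) => [c|] /=.
  rewrite lbackC.
  apply: (mpoly_hom_ext (f := lchange \o lback0) (g := @polyC _)) => [a|i] /=.
    by rewrite lback0C lchangeC.
  rewrite lback0X rmorphB rmorphM /= lchangeC !lchangeX lchange_im_lift.
  by rewrite lchange_im_max addrK.
by rewrite lbackX lchangeX lchange_im_max.
Qed.

Definition vext (i : 'I_n.+1) : C := if unlift ord_max i is Some j then v j else 1.

Lemma lchange_im_top i : (size (lchange_im i) <= 2)%N /\
  (lchange_im i)`_1 = (vext i)%:MP.
Proof.
rewrite /vext; case: (unliftP ord_max i) => [j|] ->; last first.
  by rewrite lchange_im_max size_polyX coefX.
rewrite lchange_im_lift; split.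
  rewrite (leq_trans (size_polyD _ _)) // geq_max (leq_trans (size_polyC_leq1 _)) //=.
  apply: leq_trans (size_polyMleq _ _) _; rewrite size_polyX addn2 /=.
  by rewrite ltnS size_polyC_leq1.
by rewrite coefD coefC /= add0r coefCM coefX mulr1.
Qed.

Lemma lchangeXm_top (m : 'X_{1..n.+1}) :
  (size (lchange 'X_[m]) <= (mdeg m).+1)%N /\
  (lchange 'X_[m])`_(mdeg m) = (\prod_i vext i ^+ m i)%:MP.
Proof.
have hX (a : {poly {mpoly C[n]}}) (c : C) k : (size a <= 2)%N -> a`_1 = c%:MP ->
    (size (a ^+ k) <= k.+1)%N /\ (a ^+ k)`_k = (c ^+ k)%:MP.
  move=> sa ha; elim: k => [|k [IH1 IH2]].
    by rewrite !expr0 size_poly1 coef1.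
  split; first by rewrite exprS; exact: (size_mul_le sa IH1).
  by rewrite exprS (coef_top_mul sa IH1 : (a * a ^+ k)`_k.+1 = _) ha IH2 -mpolyCM exprS.
rewrite mpolyXE_id rmorph_prod mdegE.
elim/big_rec3: _ => [|i s c a _ [h1 h2]].
  by rewrite size_poly1 coef1.
have [hs ht] := lchange_im_top i.
have [] := hX _ _ (m i) hs ht; rewrite rmorphXn /= lchangeX => h3 h4.
by split; [exact: size_mul_le h3 h1|rewrite (coef_top_mul h3 h1) h4 h2 mpolyCM].
Qed.

Definition topform (p : {mpoly C[n.+1]}) := pihomog mdeg (msize p).-1 p.

Lemma lchange_size (p : {mpoly C[n.+1]}) N : (msize p <= N)%N ->
  (size (lchange p) <= N)%N.
Proof.
move=> hp; rewrite [p]mpolyE rmorph_sum /=.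
apply: (leq_trans (size_sum _ _ _)); apply/bigmax_leqP_seq => m hm _.
rewrite -mul_mpolyC rmorphM /= lchangeC mul_polyC.
apply: leq_trans (size_scale_leq _ _) _.
apply: leq_trans (lchangeXm_top m).1 _; apply: leq_trans hp.
exact: msize_mdeg_lt.
Qed.

(** When this value of the leading form is nonzero, the restriction of [p] to lines in the direction
    (v, 1) has a constant leading coefficient, so [p] becomes monic up to a scalar. *)
Lemma lchange_top (p : {mpoly C[n.+1]}) :
  (lchange p)`_(msize p).-1 = ((topform p).@[vext])%:MP.
Proof.
rewrite {1}[p]mpolyE rmorph_sum coef_sum /topform pihomogE.
rewrite [X in X%:MP]raddf_sum /=.
rewrite [RHS]raddf_sum /=.
rewrite [RHS]big_mkcond /=; apply: eq_big_seq => m hm.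
rewrite mevalZ mevalX mpolyCM -mul_mpolyC rmorphM /= lchangeC coefCM.
case: eqP => e; first by rewrite -e (lchangeXm_top m).2.
rewrite [X in _ * X]nth_default ?mulr0 //; apply: leq_trans (lchangeXm_top m).1 _.
rewrite ltn_neqAle; apply/andP; split; first exact/eqP.
by have := msize_mdeg_lt hm; case: (mmeasure _ p).
Qed.

End LinearChange.

Lemma ufd_mpoly (C : fieldType) n : ufd {mpoly C[n]}.
Proof.
elim: n => [|n IH]; last first.
  have h := ufd_poly IH.
  pose f : {rmorphism {mpoly C[n.+1]} -> {poly {mpoly C[n]}}} := lchange (fun _ => 0).
  pose g : {rmorphism {poly {mpoly C[n]}} -> {mpoly C[n.+1]}} := lback (fun _ => 0).
  have fK : cancel f g := @lchangeK _ _ _.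
  have gK : cancel g f := @lbackK _ _ _.
  have := @ufd_transport _ _ f g fK gK.
  by apply.
move=> r r0; exists r, [::]; split=> //; last by rewrite big_nil mulr1.
have e (p : {mpoly C[0]}) : p = (p@_0%MM)%:MP.
  by apply: msize1_polyC; rewrite msizeE; apply/bigmax_leqP_seq => m _ _; rewrite mdegE big_ord0.
set c := r@_0%MM; have h : c != 0.
  by apply: contraNneq r0 => h; rewrite [r]e -/c h mpolyC0.
rewrite [r]e -/c; apply/unitrP; exists (c^-1)%:MP.
by rewrite -!mpolyCM mulVf // mulfV // mpolyC1.
Qed.

(** * Choosing values off countably many zero sets *)

Section CountableAvoidance.

Lemma real_avoid (u : nat -> Rdefinitions.R) : exists x, forall n, u n <> x.
Proof.
apply: contrapT => /forallNP H.
have hs x : exists n, u n = x.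
  by have /existsNP[n /contrapT hn] := H x; exists n.
have cnt : countable [set: Rdefinitions.R].
  have [g hg] := choice hs.
  by apply/countable_injP; exists g => x y _ _ e; rewrite -(hg x) -(hg y) e.
have inf : infinite_set [set: Rdefinitions.R].
  have inj : injective (fun n : nat => n%:R : Rdefinitions.R).
    by move=> a b /eqP; rewrite Num.Theory.eqr_nat => /eqP.
  apply: (@sub_infinite_set _ [set n%:R | n in [set: nat]]) => //.
  move=> hf; apply: infinite_nat.
  by rewrite -(eq_finite_set (inj_card_eq (in2W inj))).
have /card_set_bijP[f [_ fi fs]] := eq_card_nat cnt inf.
have hg n : exists x, f x = n by have [x _ <-] := fs n I; exists x.
have [g gK] := choice hg.
apply: (@R_uncountable g); exists f; split=> // x.
by apply: fi; rewrite ?inE // gK.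
Qed.

Lemma poly_avoid (q : nat -> {poly CC}) :
  (forall i, q i != 0) -> exists c : CC, forall i, (q i).[c] != 0.
Proof.
move=> q0.
have hr i := @closed_field_poly_normal (complex Rdefinitions.R) (q i).
(* [u] enumerates the real parts of all roots of all the [q i], with 0 as filler; a real number off
   this list is a root of none of them. *)
pose u k := if @unpickle (nat * nat)%type k is Some (i, j) then
   complex.Re (nth 0 (projT1 (hr i)) j) else 0.
have [x hx] := real_avoid u; exists (real_complex _ x) => i.
apply/eqP => h.
have : root (q i) (real_complex _ x) by apply/rootP.
have [rs hrs] : exists rs, projT1 (hr i) = rs by eexists.
have := projT2 (hr i); rewrite hrs => e.
rewrite e rootZ ?lead_coef_eq0 // root_prod_XsubC => hin.
apply: (hx (pickle (i, index (real_complex _ x) rs))).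
by rewrite /u pickleK hrs nth_index.
Qed.

(** Induction on the number of variables: the first coordinates are chosen off the zero sets of the
    leading coefficients in the last variable, which keeps the specialized polynomials nonzero. *)
Lemma mpoly_avoid n (p : nat -> {mpoly CC[n]}) :
  (forall i, p i != 0) -> exists c : 'I_n -> CC, forall i, (p i).@[c] != 0.
Proof.
elim: n p => [|n IH] p p0.
  exists (fun _ => 0) => i; have := p0 i; rewrite [p i]nvar0_mpolyC mevalC.
  by apply: contraNneq => ->; rewrite mpolyC0.
pose l i := lead_coef (lchange (fun _ => 0) (p i)).
have l0 i : l i != 0.
  rewrite lead_coef_eq0; apply: contraNneq (p0 i) => e.
  by rewrite -[p i](lchangeK (fun _ => 0)) e rmorph0.
have [c hc] := IH l l0.
pose q i := map_poly (meval c) (lchange (fun _ => 0) (p i)).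
have q0 i : q i != 0.
  apply: contraNneq (hc i) => e.
  by rewrite /l lead_coefE -[_.@[c]](coef_map (meval c)) -/(q i) e coef0.
have [t ht] := poly_avoid q0.
pose w (i : 'I_n.+1) := if unlift ord_max i is Some j then c j else t.
exists w => i; have := ht i; rewrite /q.
have -> : (map_poly (meval c) (lchange (fun _ => 0) (p i))).[t] = (p i).@[w] => //.
pose f := horner_eval t \o map_poly (meval c) \o lchange (fun _ => 0).
apply: (mpoly_hom_ext (f := f) (g := meval w)) => [a|j] /=.
  by rewrite lchangeC map_polyC /= mevalC /horner_eval hornerC mevalC.
rewrite lchangeX mevalXU /w; case: (unliftP ord_max j) => [k|] ->.
  rewrite lchange_im_lift rmorphD rmorphM /= !map_polyC map_polyX /horner_eval.
  rewrite hornerD hornerM !hornerC hornerX.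
  set a := (X in X + _); set b := (X in _ + X * _).
  have -> : a = c k by exact: mevalXU.
  have -> : b = 0 by exact: mevalC.
  by rewrite mul0r addr0.
by rewrite lchange_im_max map_polyX /horner_eval hornerX.
Qed.

Lemma mpoly_nonroot n (p : {mpoly CC[n]}) : p != 0 -> exists c, p.@[c] != 0.
Proof. by move=> p0; have [c hc] := mpoly_avoid (fun _ : nat => p0); exists c; apply: (hc 0%N). Qed.

End CountableAvoidance.

Lemma meval_homog_scale n (C : comNzRingType) (p : {mpoly C[n]}) d t v :
  p \is d.-homog -> p.@[fun i => t * v i] = t ^+ d * p.@[v].
Proof.
move=> hp; rewrite !mevalE mulr_sumr; apply: eq_big_seq => m hm.
rewrite mulrCA; congr (_ * _).
have hd : mdeg m = d by have /dhomogP := hp; apply.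
rewrite -hd mdegE expr_sum -big_split /=.
by apply: eq_bigr => i _; rewrite exprMn.
Qed.

Lemma topform_neq0 n (C : fieldType) (p : {mpoly C[n.+1]}) : p != 0 -> topform p != 0.
Proof.
move=> p0; apply/eqP => e.
have h := mlead_supp p0; have hd := mlead_deg p0.
have : (topform p)@_(mlead p) = 0 by rewrite e mcoeff0.
rewrite /topform pihomogE -hd /= linear_sum /=.
rewrite big_mkcond (bigD1_seq (mlead p)) ?msupp_uniq //= eqxx.
rewrite mcoeffZ mcoeffX eqxx mulr1 big1 ?addr0 => [/eqP|m hm].
  by rewrite mleadc_eq0 (negPf p0).
by case: ifP => // _; rewrite mcoeffZ mcoeffX (negPf hm) mulr0.
Qed.

(** Multiplying the leading form by the last variable forces a nonzero last coordinate, which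
    homogeneity then scales to 1. *)
Lemma topform_direction n (p : {mpoly CC[n.+1]}) : p != 0 ->
  exists v : 'I_n -> CC, (topform p).@[vext v] != 0.
Proof.
move=> p0; have : topform p * 'X_ord_max != 0.
  rewrite mulf_neq0 ?topform_neq0 //; apply/eqP => e.
  by have := msizeX CC (U_(ord_max : 'I_n.+1))%MM; rewrite e msize0.
case/mpoly_nonroot => c; rewrite mevalM mevalXU mulf_eq0 negb_or => /andP[h1 h2].
exists (fun j => c (lift ord_max j) / c ord_max); apply: contraNneq h1 => e.
have hh := pihomogP mdeg (msize p).-1 p.
have := meval_homog_scale (c ord_max) (vext (fun j => c (lift ord_max j) / c ord_max)) hh.
rewrite -/(topform p) e mulr0 => <-; apply/eqP/meval_eq => i.
rewrite /vext; case: (unliftP ord_max i) => [k|] -> ; first by rewrite mulrCA mulfV ?mulr1.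
by rewrite mulr1.
Qed.

Lemma prime_msize_gt1 n (g : {mpoly CC[n]}) : prime_elt g -> (1 < msize g)%N.
Proof.
case=> g0 /negP ng _; rewrite ltnNge; apply/negP => /msize1_polyC eg; apply: ng.
have gg : g@_0%MM != 0 by apply: contraNneq g0 => z; rewrite eg z mpolyC0.
by apply/unitrP; exists (g@_0%MM)^-1%:MP; rewrite {2 3}eg -!mpolyCM mulVf // mulfV.
Qed.

Section Evaluation.
Variables (F : comNzRingType) (c : {rmorphism CC -> F}).

Definition ev n (x : 'I_n -> F) : {mpoly CC[n]} -> F := mmap c x.
HB.instance Definition _ n (x : 'I_n -> F) := GRing.RMorphism.on (ev x).

Lemma evC n (x : 'I_n -> F) a : ev x a%:MP = c a.
Proof. exact: mmapC. Qed.
Lemma evX n (x : 'I_n -> F) i : ev x 'X_i = x i.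
Proof. by rewrite /ev mmapX mmap1U. Qed.

Definition alg_indep n (x : 'I_n -> F) := forall p, ev x p = 0 -> p = 0.

Lemma alg_indep_inj n (x : 'I_n -> F) : alg_indep x -> injective (ev x).
Proof.
by move=> hx p q e; apply/eqP; rewrite -subr_eq0; apply/eqP/hx; rewrite rmorphB /= e subrr.
Qed.

Lemma ev_lchange n (z : 'I_n.+1 -> F) (v : 'I_n -> CC) p :
  ev z p = (map_poly (ev (fun j => z (lift ord_max j) - c (v j) * z ord_max))
    (lchange v p)).[z ord_max].
Proof.
set w := fun j => _.
pose f := horner_eval (z ord_max) \o map_poly (ev w) \o lchange v.
apply: (mpoly_hom_ext (f := ev z) (g := f)) => [a|j] /=.
  by rewrite lchangeC map_polyC /= evC /horner_eval hornerC evC.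
rewrite lchangeX evX; case: (unliftP ord_max j) => [k|] ->; last first.
  by rewrite lchange_im_max map_polyX /horner_eval hornerX.
rewrite lchange_im_lift rmorphD rmorphM /= !map_polyC map_polyX /horner_eval.
rewrite hornerD hornerM !hornerC hornerX.
set a := (X in _ = X + _); set b := (X in _ = _ + X * _).
have -> : a = w k by exact: evX.
have -> : b = c (v k) by exact: evC.
by rewrite subrK.
Qed.

End Evaluation.

Section Noether.
Variables (F : fieldType) (c : {rmorphism CC -> F}).

Lemma integral_ev m n (w : 'I_m -> F) (x : 'I_n -> F) :
  (forall i, integralOver (ev c x) (w i)) -> forall p, integralOver (ev c x) (ev c w p).
Proof.
move=> hw p; rewrite [p]mpolyE rmorph_sum.
apply: (big_ind (integralOver (ev c x))) => [||m1 _].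
- exact: integral0.
- by move=> a b; apply: integral_add.
rewrite -mul_mpolyC rmorphM /= evC; apply: integral_mul.
  by rewrite -(evC c x); apply: integral_id.
rewrite mpolyXE_id rmorph_prod; apply: (big_ind (integralOver (ev c x))) => [||i _].
- exact: integral1.
- by move=> a b; apply: integral_mul.
rewrite rmorphXn /= evX; elim: (m1 i) => [|k IH]; first by rewrite expr0; apply: integral1.
by rewrite exprS; apply: integral_mul.
Qed.

(** After a generic linear change, a relation among the [z i] makes the last one integral over the
    others, and the recursion continues with one generator less. The new variables stay polynomials
    in the [z i], so that they lift to [A]. *)
Lemma noether_normalization n (z : 'I_n -> F) : exists d (x : 'I_d -> F),
  [/\ alg_indep c x, forall i, integralOver (ev c x) (z i)
    & forall i, exists p, x i = ev c z p].
Proof.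
elim: n z => [|n IH] z.
  exists 0%N, z; split; [|by case|by case].
  by move=> p; rewrite [p]nvar0_mpolyC evC => /eqP; rewrite fmorph_eq0 => /eqP ->; rewrite mpolyC0.
have [hz|/existsNP[p /not_implyP[hp /eqP p0]]] := EM (alg_indep c z).
  exists n.+1, z; split=> // i; last by exists 'X_i; rewrite evX.
  by rewrite -(evX c z); apply: integral_id.
have [v hv] := topform_direction p0.
pose w j := z (lift ord_max j) - c (v j) * z ord_max.
have [d [x [ix hw hx]]] := IH w.
have iw := integral_ev hw.
have iz : integralOver (ev c x) (z ord_max).
  have e : (map_poly (ev c w) (lchange v p)).[z ord_max] = 0 by rewrite -ev_lchange.
  have ht := lchange_top v p.
  have hs : size (lchange v p) = msize p.
    apply/eqP; rewrite eqn_leq lchange_size //.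
    have hm : (0 < msize p)%N by rewrite lt0n msize_poly_eq0.
    rewrite leqNgt; apply/negP => hlt; move: hv; rewrite -(mpolyC_eq0 n) -ht nth_default ?eqxx //.
    by move: hlt; rewrite -{1}(prednK hm) ltnS.
  set a := (topform p).@[_] in hv ht.
  apply: (integral_root_monic (p := map_poly (ev c w) (a^-1%:MP *: lchange v p))).
  - apply: monic_map; apply/monicP; rewrite lead_coefZ lead_coefE hs ht.
    by rewrite -mpolyCM mulVf.
  - by rewrite map_polyZ /root hornerZ e mulr0.
  by apply/integral_poly => i; rewrite coef_map /=; apply: iw.
exists d, x; split=> // i.
  case: (unliftP ord_max i) => [j|] -> //.
  have -> : z (lift ord_max j) = w j + c (v j) * z ord_max by rewrite subrK.
  apply: integral_add; first exact: hw.
  by apply: integral_mul => //; rewrite -(evC c x); apply: integral_id.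
have [q ->] := hx i.
pose r (j : 'I_n) := 'X_(lift ord_max j) - (v j)%:MP * 'X_ord_max : {mpoly CC[n.+1]}.
exists (mmap (@mpolyC n.+1 CC) r q).
apply: (mpoly_hom_ext (f := ev c w) (g := ev c z \o mmap (@mpolyC n.+1 CC) r)) => [b|j] /=.
  by rewrite mmapC !evC.
by rewrite mmapX mmap1U evX /r rmorphB rmorphM /= !evX evC.
Qed.

End Noether.

(** * Fraction fields and prime ideals disjoint from a multiplicative set *)

Section FracLift.
Variables (R : idomainType) (F : fieldType) (f : {rmorphism R -> F}).
Hypothesis f_inj : injective f.
Local Notation tf := (@FracField.tofrac R).

Lemma frac_lift : exists g : {rmorphism {fraction R} -> F}, forall a, g (tf a) = f a.
Proof.
have fn0 b : b != 0 -> f b != 0.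
  by apply: contraNneq => e; apply/eqP/f_inj; rewrite e rmorph0.
have hz (z : {fraction R}) : exists y, exists a b, [/\ b != 0, tf b * z = tf a & y * f b = f a].
  have [a [b [b0 e]]] := frac_clear_denom z; exists (f a / f b), a, b; split=> //.
  by rewrite divfK // fn0.
have [g hg] := choice hz.
have gE z a b : b != 0 -> tf b * z = tf a -> g z * f b = f a.
  move=> b0 e; have [a' [b' [b0' e' h]]] := hg z.
  apply: (mulIf (fn0 _ b0')); rewrite mulrAC h -!rmorphM; congr (f _).
  apply/eqP; rewrite -tofrac_eq !tofracM -e -e'; apply/eqP; ring.
have g1 : g 1 = 1.
  by have := @gE 1 1 1 (oner_neq0 _); rewrite tofrac1 mulr1 rmorph1 mulr1; apply.
have gB : zmod_morphism g.
  move=> x y; have [a [b [b0 e h]]] := hg x; have [a' [b' [b0' e' h']]] := hg y.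
  have bb : b * b' != 0 by rewrite mulf_neq0.
  apply: (mulIf (fn0 _ bb)); rewrite (gE _ (a * b' - a' * b)) //.
    by rewrite rmorphB !rmorphM mulrBl -h -h'; ring.
  by rewrite tofracB !tofracM -e -e'; ring.
have gM : monoid_morphism g.
  split=> // x y; have [a [b [b0 e h]]] := hg x; have [a' [b' [b0' e' h']]] := hg y.
  have bb : b * b' != 0 by rewrite mulf_neq0.
  apply: (mulIf (fn0 _ bb)); rewrite (gE _ (a * a')) //.
    by rewrite !rmorphM -h -h'; ring.
  by rewrite !tofracM -e -e'; ring.
pose ga := GRing.isZmodMorphism.Build _ _ g gB.
pose gm := GRing.isMonoidMorphism.Build _ _ g gM.
pose G : {rmorphism {fraction R} -> F} := HB.pack g ga gm.
exists G => a; have := @gE (tf a) a 1 (oner_neq0 _).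
by rewrite tofrac1 mul1r rmorph1 mulr1; apply.
Qed.

End FracLift.

Section DomainOf.
Variables (Q : comNzRingType) (h : forall x y : Q, x * y = 0 -> (x == 0) || (y == 0)).

(** The proof is recorded in the type so that the integral domain structure can be inferred from it.
    Units and inverses are chosen classically. *)
Definition domain_of (_ : forall x y : Q, x * y = 0 -> (x == 0) || (y == 0)) : Type := Q.
HB.instance Definition _ := GRing.ComNzRing.on (domain_of h).

Definition domain_unit : pred (domain_of h) := fun x => `[< exists y, y * x = 1 >].
Definition domain_inv (x : domain_of h) : domain_of h :=
  if pselect (exists y, y * x = 1) is left e then projT1 (cid e) else x.

Lemma domain_mulVx : {in domain_unit, left_inverse 1 domain_inv *%R}.
Proof.
move=> x; rewrite unfold_in => /asboolP hx; rewrite /domain_inv.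
by case: pselect => // e; case: (cid e).
Qed.
Lemma domain_unitPl (x y : domain_of h) : y * x = 1 -> domain_unit x.
Proof. by move=> e; apply/asboolP; exists y. Qed.
Lemma domain_invr_out : {in [predC domain_unit], domain_inv =1 id}.
Proof.
move=> x; rewrite inE unfold_in => /asboolP hx; rewrite /domain_inv.
by case: pselect.
Qed.
HB.instance Definition _ := GRing.ComNzRing_hasMulInverse.Build (domain_of h)
  domain_mulVx domain_unitPl domain_invr_out.
HB.instance Definition _ := GRing.ComUnitRing_isIntegral.Build (domain_of h) h.
End DomainOf.

Section PrimeQuotient.
Variables (A : comAlgType CC) (P : set A) (hP : prime_ideal P).

Definition prime_mem (_ : prime_ideal P) : A -> bool := fun x => `[< P x >].

Lemma prime_mem_closed : idealr_closed (prime_mem hP).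
Proof.
have := hP; case=> -[h0 hD hM] h1 _; split; rewrite ?inE ?unfold_in.
- exact: h0.
- by apply/asboolPn.
move=> a x y; rewrite !unfold_in => /asboolP hx /asboolP hy; apply/asboolP.
by apply: hD => //; apply: hM.
Qed.
HB.instance Definition _ := isIdealr.Build A (prime_mem hP) prime_mem_closed.

Lemma prime_mem_prime : prime_idealr_closed (prime_mem hP).
Proof.
have := hP; case=> _ _ hM u v; rewrite !unfold_in => /asboolP/hM[] h; apply/orP.
  by left; apply/asboolP.
by right; apply/asboolP.
Qed.
HB.instance Definition _ := isPrimeIdealrClosed.Build A (prime_mem hP) prime_mem_prime.

Let Q : comNzRingType := Quotient.quot (prime_mem hP : prime_idealr A).
Let Qdom (x y : Q) : x * y = 0 -> (x == 0) || (y == 0).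
Proof. exact: Quotient.rquot_IdomainAxiom. Qed.

Lemma frac_of_quotient_exists :
  exists (F : fieldType) (iota : {rmorphism A -> F}), is_frac_of_quotient P iota.
Proof.
pose D : idomainType := domain_of Qdom.
pose tf := @FracField.tofrac D.
pose pi : A -> D := fun x => \pi_Q%qT x.
have piB : zmod_morphism pi by move=> x y; rewrite /pi rmorphB.
have piM : monoid_morphism pi by split; [exact: rmorph1|move=> x y; rewrite /pi rmorphM].
pose ga := GRing.isZmodMorphism.Build _ _ pi piB.
pose gm := GRing.isMonoidMorphism.Build _ _ pi piM.
pose PI : {rmorphism A -> D} := HB.pack pi ga gm.
have pi0 a : (pi a == 0) = `[< P a >].
  have := Quotient.idealrBE (prime_mem hP : prime_idealr A) a 0.
  rewrite subr0 unfold_in /prime_mem => ->; congr (_ == _); exact: (esym (rmorph0 PI)).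
exists {fraction D}, (tf \o PI); split=> [a|z] /=.
  split; first by move/eqP; rewrite tofrac_eq0 pi0 => /asboolP.
  by move=> /asboolP; rewrite -pi0 => /eqP ->; rewrite tofrac0.
have [a [b [b0 e]]] := frac_clear_denom z.
have pi_surj (x : D) : exists y, pi y = x by exists (repr (x : Q)); exact: reprK.
have [a' ha] := pi_surj a; have [b' hb] := pi_surj b.
exists a', b'; rewrite ha hb; split; first by rewrite tofrac_eq0.
by apply: (mulIf (x := tf b)); rewrite ?tofrac_eq0 // divfK ?tofrac_eq0 // mulrC.
Qed.

End PrimeQuotient.

(** Zorn's lemma: an ideal maximal among those that contain [I] and avoid the multiplicative set [T]
    is prime. *)
Lemma krull_prime (A : comAlgType CC) (I T : set A) : ideal I -> T 1 ->
  (forall x y, T x -> T y -> T (x * y)) -> (forall x, I x -> ~ T x) ->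
  exists Q, [/\ prime_ideal Q, I `<=` Q & forall x, Q x -> ~ T x].
Proof.
move=> iI T1 TM IT.
pose good J := [/\ ideal J, I `<=` J & forall x, J x -> ~ T x].
pose p J := J = set0 \/ good J.
have : forall F : set (set A), F `<=` p -> total_on F subset -> p (\bigcup_(X in F) X).
  move=> F Fp Ft.
  have [[J0 FJ0 [x0 Jx0]]|H] := EM (exists2 J, F J & J !=set0); last first.
    left; rewrite -subset0 => x [J FJ Jx]; apply: H; exists J => //.
    by exists x.
  have g J : F J -> J !=set0 -> good J.
    by move=> /Fp[->|//] [x].
  have [i0 s0 d0] : good J0 by apply: g => //; exists x0.
  right; split.
  - split.
    + by exists J0 => //; case: i0.
    + move=> x y [J FJ Jx] [K FK Ky].
      have [s|s] := Ft _ _ FJ FK.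
        exists K => //; have [[_ hD _] _ _] : good K by apply: g => //; exists y.
        by apply: hD => //; apply: s.
      exists J => //; have [[_ hD _] _ _] : good J by apply: g => //; exists x.
      by apply: hD => //; apply: s.
    + move=> a x [J FJ Jx]; exists J => //.
      have [[_ _ hM] _ _] : good J by apply: g => //; exists x.
      exact: hM.
  - by move=> x Ix; exists J0 => //; apply: s0.
  - move=> x [J FJ Jx]; have [_ _ d] : good J by apply: g => //; exists x.
    exact: d.
case/Zorn_bigcup => Q [[Q0|[iQ sQ dQ]] mQ].
  case: (mQ I); last by right; split.
  rewrite Q0; split=> // /(_ 0); case: iI => I0 _ _ /(_ I0) //.
have [Q0 QD QM] := iQ.
exists Q; split=> //; split=> // [h|x y Qxy]; first exact: (dQ _ h).
pose J z w := exists q a, Q q /\ w = q + a * z.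
have iJ z : ideal (J z).
  split.
  - by exists 0, 0; rewrite mul0r addr0.
  - move=> u v [q [a [hq ->]]] [q' [a' [hq' ->]]]; exists (q + q'), (a + a').
    by split; [exact: QD|ring].
  - move=> b u [q [a [hq ->]]]; exists (b * q), (b * a).
    by split; [exact: QM|ring].
have sJ z : Q `<=` J z by move=> q hq; exists q, 0; rewrite mul0r addr0.
have key z : ~ Q z -> exists q a, Q q /\ T (q + a * z).
  move=> nQz; apply: contrapT => H; apply: (mQ (J z)).
    split=> // /(_ z) h; apply/nQz/h; exists 0, 1; rewrite mul1r add0r; split=> //.
  right; split=> //; first by move=> u /sQ /sJ.
  by move=> u [q [a [hq ->]]] hT; apply: H; exists q, a.
have [|nQx] := EM (Q x); first by left.
have [|nQy] := EM (Q y); first by right.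
have [q [a [hq Tx]]] := key _ nQx; have [q' [a' [hq' Ty]]] := key _ nQy.
case: (dQ _ _ (TM _ _ Tx Ty)).
have -> : (q + a * x) * (q' + a' * y) = (q' + a' * y) * q + (a * x * q' + a * a' * (x * y)) by ring.
exact: (QD _ _ (QM _ _ hq) (QD _ _ (QM _ _ hq') (QM _ _ Qxy))).
Qed.

(** * Transcendence degree *)

Lemma linear_dependence (C : fieldType) (I J : finType) (W : I -> J -> C) :
  (#|J| < #|I|)%N ->
  exists l : I -> C, (exists i, l i != 0) /\ forall j, \sum_i l i * W i j = 0.
Proof.
move=> h; pose M := \matrix_(i < #|I|, j < #|J|) W (enum_val i) (enum_val j).
have : kermx M != 0.
  rewrite -mxrank_eq0 mxrank_ker subn_eq0 -ltnNge.
  exact: leq_ltn_trans (rank_leq_col _) h.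
case/rowV0Pn => v /sub_kermxP vM v0.
exists (fun i => v 0 (enum_rank i)); split.
  have /rV0Pn[j hj] : v != 0 by [].
  by exists (enum_val j); rewrite enum_valK.
move=> j; have := congr1 (fun B : 'rV_ _ => B 0 (enum_rank j)) vM.
rewrite !mxE => h0; rewrite -[RHS]h0.
rewrite [RHS](reindex (@enum_rank I)) /=; last first.
  by exists enum_val => i _; rewrite ?enum_rankK ?enum_valK.
by apply: eq_bigr => i _; rewrite mxE !enum_rankK.
Qed.

Section Exchange.
Variables (F : fieldType) (c : {rmorphism CC -> F}) (d : nat) (x : 'I_d -> F).
Variables (m : nat) (u : 'I_m -> F).
Hypothesis u_int : forall i, integralOver (ev c x) (u i).
Hypothesis u_indep : alg_indep c u.

Lemma uniform_relations : exists (N D : nat) (H : 'I_m -> nat -> {mpoly CC[d]}),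
  [/\ (0 < N)%N, forall i j, (msize (H i j) <= D.+1)%N
    & forall i, u i ^+ N = \sum_(j < N) ev c x (H i j) * u i ^+ j].
Proof.
have [G hG] := choice (fun i => let: ex_intro2 p h1 h2 := u_int i in
  ex_intro (fun p => p \is monic /\ root (map_poly (ev c x) p) (u i)) p (conj h1 h2)).
pose N := (\max_i size (G i))%N.+1.
(* A power of ['X] brings all the relations to the common degree [N]. *)
pose G' i := G i * 'X^(N - (size (G i)).-1).
have hs i : ((size (G i)).-1 <= N)%N.
  rewrite /N; apply: leq_trans (leq_pred _) _.
  by apply: leqW; exact: (@leq_bigmax_cond _ xpredT (fun i => size (G i)) i).
have mG i : G' i \is monic by rewrite monicMr ?monicXn // (hG i).1.
have sG i : size (G' i) = N.+1.
  have Gn0 : G i != 0 by apply: monic_neq0; rewrite (hG i).1.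
  rewrite size_monicM ?(hG i).1 // ?size_polyXn; last by rewrite -size_poly_eq0 size_polyXn.
  by rewrite addnS /= -[in LHS](prednK (n := size (G i))) ?size_poly_gt0 // addSn subnKC.
pose D := (\max_i \max_(j < N) msize (G' i)`_j)%N.
exists N, D, (fun i j => if (j < N)%N then - (G' i)`_j else 0); split=> // i => [j|].
  case: ifP => hj; last by rewrite msize0.
  rewrite msizeN; apply: leqW.
  apply: leq_trans (@leq_bigmax_cond _ xpredT (fun i => \max_(j < N) msize (G' i)`_j)%N i isT).
  exact: (@leq_bigmax_cond _ xpredT (fun j : 'I_N => msize (G' i)`_j) (Ordinal hj)).
have : root (map_poly (ev c x) (G' i)) (u i).
  by rewrite rmorphM /= rootM (hG i).2.
move/rootP; rewrite horner_coef size_map_poly_id0; last first.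
  by rewrite (monicP (mG i)) rmorph1 oner_neq0.
rewrite sG big_ord_recr /= coef_map /=.
have -> : (G' i)`_N = 1 by have := monicP (mG i); rewrite lead_coefE sG.
rewrite rmorph1 mul1r => /eqP; rewrite addr_eq0 => /eqP e.
rewrite -[LHS]opprK -e -sumrN; apply: eq_bigr => j _ /=.
by rewrite ltn_ord rmorphN coef_map /= mulNr.
Qed.

(** A dimension count. By the integral relations the K^m monomials with exponents below [K] lie in a
    space whose dimension grows only like K^d; for m > d they become linearly dependent, against the
    independence of the [u i]. *)
Lemma alg_indep_card : (m <= d)%N.
Proof.
have [N [D [H [N0 HD HH]]]] := uniform_relations.
case: N N0 HH => // N _ HH.
pose B := {ffun 'I_m -> 'I_N.+1}.
pose mon (b : B) := \prod_i u i ^+ b i.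
pose M k y := exists q : B -> {mpoly CC[d]},
  (forall b, (msize (q b) <= k.+1)%N) /\ y = \sum_b ev c x (q b) * mon b.
have MD k y y' : M k y -> M k y' -> M k (y + y').
  move=> [q [hq ->]] [q' [hq' ->]]; exists (fun b => q b + q' b); split=> [b|].
    by apply: leq_trans (msizeD_le _ _) _; rewrite geq_max hq hq'.
  by rewrite -big_split; apply: eq_bigr => b _; rewrite rmorphD mulrDl.
have M0 k : M k 0.
  by exists (fun=> 0); split=> [b|]; rewrite ?msize0 // big1 // => b _; rewrite rmorph0 mul0r.
have Msum k (I : finType) (f : I -> F) : (forall i, M k (f i)) -> M k (\sum_i f i).
  by move=> h; apply: (big_ind (M k)) => //; exact: MD.
have M1 k r b : (msize r <= k.+1)%N -> M k (ev c x r * mon b).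
  move=> hr; exists (fun b' => if b' == b then r else 0); split=> [b'|].
    by case: ifP; rewrite ?msize0.
  rewrite (bigD1 b) //= eqxx big1 ?addr0 // => b' /negPf ->.
  by rewrite rmorph0 mul0r.
have Mmono k k' y : (k <= k')%N -> M k y -> M k' y.
  by move=> h [q [hq ->]]; exists q; split=> // b; apply: leq_trans (hq b) _.
have monE (b : B) i (j : 'I_N.+1) :
    mon [ffun i' => if i' == i then j else b i'] = u i ^+ j * \prod_(i' | i' != i) u i' ^+ b i'.
  rewrite /mon (bigD1 i) //= ffunE eqxx; congr (_ * _).
  by apply: eq_bigr => i' /negPf h; rewrite ffunE h.
have Mstep k i y : M k y -> M (k + D)%N (u i * y).
  move=> [q [hq ->]]; rewrite mulr_sumr; apply: (@Msum _ _) => b.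
  rewrite mulrCA /mon (bigD1 i) //= [u i * (_ * _)]mulrA -exprS.
  have [hb|hb] := ltnP (b i) N.
    have hb' : ((b i).+1 < N.+1)%N by [].
    rewrite -(monE b i (Ordinal hb')); apply: (@Mmono k); first exact: leq_addr.
    exact: (@M1).
  have -> : (b i).+1 = N.+1 by congr _.+1; apply/eqP; rewrite eqn_leq hb -ltnS ltn_ord.
  rewrite HH [X in _ * X]mulr_suml mulr_sumr; apply: (@Msum _ _) => j.
  rewrite -mulrA -(monE b i j) mulrA -rmorphM; apply: (@M1).
  have [-> |h1] := eqVneq (q b) 0; first by rewrite mul0r msize0.
  have [-> |h2] := eqVneq (H i j) 0; first by rewrite mulr0 msize0.
  rewrite msizeM //; have := hq b; have := HD i j.
  by case: (msize _) => [|a]; case: (msize _) => [|a'] //=; rewrite ?addn0 ?addnS /=; lia.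
have M11 : M 0%N 1.
  have := @M1 0%N 1 [ffun=> ord0]; rewrite msize1 rmorph1 mul1r => /(_ isT).
  by rewrite /mon big1 // => i _; rewrite ffunE expr0.
have Mmon (a : 'I_m -> nat) : M (D * \sum_i a i)%N (\prod_i u i ^+ a i).
  elim/big_rec2: _ => [|i s y _ IH]; first by rewrite muln0.
  elim: (a i) => [|k IHk]; first by rewrite expr0 mul1r.
  rewrite exprS -mulrA addSn mulnS addnC; exact: (@Mstep).
rewrite leqNgt; apply/negP => hdm.
(* [K] is one more than the constant factor of K^d in the bound for the cardinal of [J], obtained
   from k + 1 <= (m D + 1) K. *)
pose K := ((N.+1 ^ m) * (m * D).+1 ^ d).+1.
pose k := (D * (m * K))%N.
pose I : finType := {ffun 'I_m -> 'I_K}.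
pose J : finType := (B * {ffun 'I_d -> 'I_k.+1})%type.
have Ma (a : I) : M k (\prod_i u i ^+ a i).
  apply: (@Mmono _ _ _ _ (Mmon _)); rewrite leq_mul2l; apply/orP; right.
  rewrite -[X in (X * _)%N]card_ord -sum_nat_const; apply: leq_sum => i _.
  exact: ltnW.
have [q hq] := choice Ma.
pose W (a : I) (j : J) := (q a j.1)@_[multinom (j.2 i : nat) | i < d].
have hcard : (#|J| < #|I|)%N.
  rewrite card_prod !card_ffun !card_ord.
  apply: (@leq_ltn_trans ((N.+1 ^ m) * (m * D).+1 ^ d * K ^ d)%N).
    rewrite -mulnA -expnMn leq_mul2l; apply/orP; right.
    have hk : (k.+1 <= (m * D).+1 * K)%N.
      by rewrite /k mulSn mulnA [(D * m)%N]mulnC /K; lia.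
    by case: (d) => [|d']; rewrite ?expn0 // leq_exp2r.
  apply: (@leq_trans (K ^ d.+1)%N); last by rewrite leq_pexp2l.
  by rewrite expnS ltn_mul2r expn_gt0 /= /K ltnS leqnn.
have [l [[a0 la0] hl]] := linear_dependence W hcard.
have hz b : \sum_a l a *: q a b = 0.
  apply/mpolyP => mm; rewrite mcoeff0 linear_sum /=.
  have [hm|hm] := ltnP (mdeg mm) k.+1.
    have hi i : (mm i < k.+1)%N.
      apply: leq_ltn_trans hm; rewrite mdegE (bigD1 i) //=; exact: leq_addr.
    have := hl (b, [ffun i => Ordinal (hi i)]); rewrite /W /=.
    have -> : [multinom ([ffun i0 => Ordinal (hi i0)] i : nat) | i < d] = mm.
      by apply/mnmP => i; rewrite mnmE ffunE.
    by move=> e; rewrite -[RHS]e; apply: eq_bigr => a _; rewrite mcoeffZ.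
  rewrite big1 // => a _; rewrite mcoeffZ memN_msupp_eq0 ?mulr0 //.
  by apply: msize_mdeg_ge; apply: leq_trans (proj1 (hq a) b) hm.
pose p := \sum_(a : I) l a *: 'X_[[multinom (a i : nat) | i < m]] : {mpoly CC[m]}.
have : ev c u p = 0.
  rewrite rmorph_sum /=.
  have -> : \sum_(a : I) ev c u (l a *: 'X_[[multinom (a i : nat) | i < m]]) =
     \sum_b ev c x (\sum_a l a *: q a b) * mon b.
    under [RHS]eq_bigr => b _ do rewrite rmorph_sum mulr_suml.
    rewrite exchange_big; apply: eq_bigr => a _ /=.
    rewrite -mul_mpolyC rmorphM /= evC mpolyXE_id rmorph_prod /=.
    under eq_bigr => i _ do rewrite rmorphXn /= evX mnmE.
    rewrite (proj2 (hq a)) mulr_sumr; apply: eq_bigr => b _.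
    by rewrite -mul_mpolyC rmorphM /= evC mulrA.
  by rewrite big1 // => b _; rewrite hz rmorph0 mul0r.
move/u_indep => /(congr1 (mcoeff [multinom (a0 i : nat) | i < m])).
rewrite mcoeff0 linear_sum /= (bigD1 a0) //= mcoeffZ mcoeffX eqxx mulr1 big1 ?addr0.
  by move/eqP; apply/negP.
move=> a ha; rewrite mcoeffZ mcoeffX; case: eqP => [e|_]; last by rewrite mulr0.
case/negP: ha; apply/eqP/ffunP => i; apply/val_inj.
by have := congr1 (fun mm : 'X_{1..m} => mm i) e; rewrite !mnmE.
Qed.

End Exchange.

(** * Heights of primes in affine algebras *)

Section MinimalPolynomial.
Variables (R : idomainType) (F : fieldType) (f : {rmorphism R -> F}).
Hypotheses (hR : ufd R) (f_inj : injective f).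

(** The minimal polynomial over the fraction field divides the monic [H], so Gauss's lemma puts its
    coefficients in [R]; being monic, it also divides in R[X]. *)
Lemma integral_minimal_poly (h : F) : integralOver f h ->
  exists q : {poly R}, [/\ q \is monic, root (map_poly f q) h
    & forall p, root (map_poly f p) h -> dvdr q p].
Proof.
case=> H mH rH; have [g hg] := frac_lift f_inj.
pose tf := @FracField.tofrac R.
have gE (p : {poly R}) : map_poly g (map_poly tf p) = map_poly f p.
  by apply/polyP => i; rewrite !coef_map /= hg.
pose good n := `[< exists p : {poly {fraction R}},
  [/\ p != 0, root (map_poly g p) h & size p = n] >].
have tfI : injective tf by move=> x y /eqP; rewrite tofrac_eq => /eqP.
have tf0 (p : {poly R}) : map_poly tf p = 0 -> p = 0.
  by move=> e; apply: map_tofrac_inj; rewrite e rmorph0.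
have ex : exists n, good n.
  exists (size (map_poly tf H)); apply/asboolP; exists (map_poly tf H); split=> //.
    by apply/eqP => /tf0 e; move: (monic_neq0 mH); rewrite e eqxx.
  by rewrite gE.
case: (ex_minnP ex) => n /asboolP[p [p0 rp sp]] hmin.
have minp (q : {poly {fraction R}}) : root (map_poly g q) h -> (size q < n)%N -> q = 0.
  move=> rq sq; apply/eqP; apply: contraTT sq => q0; rewrite -leqNgt; apply: hmin.
  by apply/asboolP; exists q.
have l0 : lead_coef p != 0 by rewrite lead_coef_eq0.
pose p1 := (lead_coef p)^-1 *: p.
have mp1 : p1 \is monic by rewrite monicE lead_coefZ mulVf.
have sp1 : size p1 = n by rewrite size_scale // invr_neq0.
have rp1 : root (map_poly g p1) h.
  by rewrite map_polyZ /root hornerZ (rootP rp) mulr0.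
have dvdH : p1 %| map_poly tf H.
  apply/eqP/minp; last by rewrite -sp1 ltn_modp monic_neq0.
  have := divp_eq (map_poly tf H) p1.
  move/(congr1 (fun q => (map_poly g q).[h])).
  rewrite gE (rootP rH) rmorphD rmorphM /= hornerD hornerM (rootP rp1) mulr0 add0r.
  by move=> e; apply/rootP.
case/dvdpP: dvdH => q' hq'.
have [|q mq hq] := gauss_monic_factor hR mH mp1 (b := q'); first by rewrite hq' mulrC.
have sq : size q = n.
  by rewrite -sp1 -hq size_map_inj_poly ?tofrac0.
have rq : root (map_poly f q) h by rewrite -gE hq.
exists q; split=> // a ra.
exists (Pdiv.Ring.rdivp a q).
have := Pdiv.RingMonic.rdivp_eq mq a => e.
suff z : Pdiv.Ring.rmodp a q = 0 by rewrite [LHS]e z addr0.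
apply/tf0/minp.
  rewrite gE; apply/rootP; move: (rootP ra); rewrite {1}e rmorphD rmorphM /=.
  by rewrite hornerD hornerM (rootP rq) mulr0 add0r.
rewrite size_map_inj_poly ?tofrac0 // -sq Pdiv.Ring.ltn_rmodp monic_neq0 //.
Qed.

End MinimalPolynomial.

(** Modulo [g] the product is X^l, and over a domain the monic factors of X^l are powers of X. The
    lowest coefficients of [f] and [q] not divisible by [g] would produce a forbidden one in the
    product. *)
Lemma monic_factor_Xn_mod (R : idomainType) (g : R) (f q : {poly R}) l :
  prime_elt g -> f \is monic -> q \is monic -> size (f * q) = l.+1 ->
  (forall i, (i < l)%N -> dvdr g (f * q)`_i) ->
  forall i, (i < (size f).-1)%N -> dvdr g f`_i.
Proof.
move=> pg mf mq sfq hl i hi; apply: contrapT => hni.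
have exf : exists i, `[< ~ dvdr g f`_i >] by exists i; apply/asboolP.
have exq : exists j, `[< ~ dvdr g q`_j >].
  exists (size q).-1; apply/asboolP; rewrite -lead_coefE (monicP mq).
  by apply: prime_ndvd1.
case: (ex_minnP exf) => i0 /asboolP h0 min0.
case: (ex_minnP exq) => j0 /asboolP h1 min1.
have hi0 : (i0 <= i)%N by apply: min0; apply/asboolP.
have hj0 : (j0 <= (size q).-1)%N.
  apply: min1; apply/asboolP; rewrite -lead_coefE (monicP mq).
  by apply: prime_ndvd1.
have sz : size (f * q) = (size f + size q).-1 by rewrite size_monicM ?monic_neq0.
have hlt : (i0 + j0 < l)%N.
  have q0 : (0 < size q)%N by rewrite size_poly_gt0 monic_neq0.
  by move: sfq; rewrite sz; lia.
have := hl _ hlt; rewrite coefM.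
have hb : (i0 < (i0 + j0).+1)%N by lia.
rewrite (bigD1 (Ordinal hb)) //= addKn => hs.
have : dvdr g (f`_i0 * q`_j0).
  rewrite -[X in dvdr g X](addrK (\sum_(i < (i0 + j0).+1 | i != Ordinal hb) f`_i * q`_(i0 + j0 - i))).
  apply: dvdrB => //; apply: dvdr_sum => k hk.
  have hki : (k != i0 :> nat) by apply: contraNneq hk => e; apply/eqP/val_inj.
  have [lt|ge] := ltnP k i0.
    apply: dvdr_mulr; apply: contrapT => h.
    have : (i0 <= k)%N by apply: min0; apply/asboolP.
    by rewrite leqNgt lt.
  apply: dvdr_mull; apply: contrapT => h.
  have : (j0 <= i0 + j0 - k)%N by apply: min1; apply/asboolP.
  by have := ltn_ord k; move: ge hki; lia.
by case/(prime_dvdM pg).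
Qed.

Lemma ev_comp (S T : comNzRingType) (c : {rmorphism CC -> S}) (f : {rmorphism S -> T})
  n (u : 'I_n -> S) p : f (ev c u p) = ev (f \o c) (f \o u) p.
Proof.
apply: (mpoly_hom_ext (f := f \o ev c u) (g := ev (f \o c) (f \o u))) => [a|i] /=.
  by rewrite !evC.
by rewrite !evX.
Qed.

Lemma size_le_mull (R : idomainType) (p q : {poly R}) :
  p != 0 -> q != 0 -> (size q <= size (p * q)%R)%N.
Proof.
move=> p0 q0; rewrite size_mul //; move: p0; rewrite -size_poly_gt0.
by case: (size p) => // n _; rewrite addSn leq_addl.
Qed.

Lemma pred_add_le (a b c : nat) : (0 < a)%N -> (0 < c)%N -> (b <= c)%N ->
  b = (a + c).-1 -> a = 1%N.
Proof. by lia. Qed.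

Lemma horner_monic (R : nzRingType) (p : {poly R}) x : p \is monic ->
  p.[x] = \sum_(i < (size p).-1) p`_i * x ^+ i + x ^+ (size p).-1.
Proof.
move=> mp; rewrite horner_coef.
have := monicP mp; rewrite lead_coefE.
have : (0 < size p)%N by rewrite size_poly_gt0 monic_neq0.
by case: (size p) => // n _ /= e; rewrite big_ord_recr /= e mul1r.
Qed.

Section ScalePoly.
Variable R : idomainType.

(** For monic [f] of degree n this is s^n f(X / s). *)
Definition scale_roots (s : R) (f : {poly R}) :=
  \poly_(i < size f) (s ^+ ((size f).-1 - i) * f`_i).

Lemma size_scale_roots s f : f \is monic -> size (scale_roots s f) = size f.
Proof.
move=> mf; rewrite /scale_roots size_poly_eq // subnn expr0 mul1r -lead_coefE.
by rewrite (monicP mf) oner_neq0.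
Qed.

Lemma monic_scale_roots s f : f \is monic -> scale_roots s f \is monic.
Proof.
move=> mf; apply/monicP; rewrite lead_coefE size_scale_roots // coef_poly.
rewrite prednK ?size_poly_gt0 ?monic_neq0 // leqnn subnn expr0 mul1r.
exact: (monicP mf).
Qed.

Lemma root_scale_roots (F : fieldType) (phi : {rmorphism R -> F}) s f h :
  f \is monic -> root (map_poly phi f) h ->
  root (map_poly phi (scale_roots s f)) (phi s * h).
Proof.
move=> mf /rootP; rewrite !horner_poly => e.
have f0 : (0 < size f)%N by rewrite size_poly_gt0 monic_neq0.
apply/rootP; rewrite horner_poly size_scale_roots //.
transitivity (phi s ^+ (size f).-1 * (\sum_(i < size f) phi f`_i * h ^+ i)); last by rewrite e mulr0.
rewrite mulr_sumr; apply: eq_bigr => i _; rewrite coef_poly ltn_ord rmorphM rmorphXn /=.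
have -> : phi s ^+ (size f).-1 = phi s ^+ ((size f).-1 - i) * phi s ^+ i.
  by rewrite -exprD subnK // -ltnS prednK.
by rewrite exprMn; ring.
Qed.

End ScalePoly.

Section Dimension.
Variable A : comAlgType CC.
Implicit Types P Q : set A.
Local Notation evA := (ev (in_alg A)).

Definition indep_mod P n (u : 'I_n -> A) :=
  forall p : {mpoly CC[n]}, P (evA u p) -> p = 0.

Definition vsnoc n (u : 'I_n -> A) f (i : 'I_n.+1) :=
  if unlift ord_max i is Some j then u j else f.

(** Read a relation as a polynomial in the last entry [f]. Its constant term lies in [Q], so it
    vanishes by independence modulo [Q]; then [f], which is not in [P], can be cancelled. *)
Lemma indep_mod_vsnoc P Q n (u : 'I_n -> A) f : prime_ideal P -> ideal Q ->
  P `<=` Q -> Q f -> ~ P f -> indep_mod Q u -> indep_mod P (vsnoc u f).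
Proof.
move=> [_ _ pP] [Q0 QD QM] PQ Qf nPf hu p.
rewrite (ev_lchange _ _ (fun=> 0)).
set w := fun j => _; have -> : w = u.
  by apply/funext => j; rewrite /w /vsnoc liftK rmorph0 mul0r subr0.
have -> : vsnoc u f ord_max = f by rewrite /vsnoc unlift_none.
move=> h.
suff e : lchange (fun=> 0) p = 0 by rewrite -[p](lchangeK (fun=> 0)) e rmorph0.
move: (lchange _ p) h => q; elim/poly_ind: q => // q a IH.
rewrite rmorphD rmorphM /= map_polyX map_polyC hornerD hornerM hornerX hornerC /= => h.
have a0 : a = 0.
  apply: hu; have := QD _ _ (PQ _ h) (QM (- (map_poly (evA u) q).[f]) _ Qf).
  by rewrite mulNr addrAC subrr add0r.
rewrite a0 rmorph0 addr0 in h; case: (pP _ _ h) => // /IH ->.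
by rewrite a0 mul0r add0r.
Qed.

Lemma affine_generators : complex_affine A ->
  exists n (z : 'I_n -> A), forall a, exists p, a = evA z p.
Proof.
case=> -[s hs] _; exists (size s), (fun i => nth 0 s i).
apply: hs => [a|x xs|x y [p ->] [q ->]|x y [p ->] [q ->]].
- by exists a%:MP; rewrite evC.
- have hi : (index x s < size s)%N by rewrite index_mem.
  by exists 'X_(Ordinal hi); rewrite evX /= nth_index.
- by exists (p + q); rewrite rmorphD.
- by exists (p * q); rewrite rmorphM.
Qed.

Section Quotient.
Variables (P : set A) (F : fieldType) (iota : {rmorphism A -> F}).
Hypotheses (haff : complex_affine A) (hfrac : is_frac_of_quotient P iota).
Local Notation c := (iota \o in_alg A).

Lemma indep_mod_frac n (u : 'I_n -> A) : indep_mod P u <-> alg_indep c (iota \o u).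
Proof.
have [h0 _] := hfrac.
split=> h p hp; apply: h; first by apply/h0; rewrite ev_comp.
by rewrite -ev_comp; apply/h0.
Qed.

Lemma noether_quotient : exists d (X : 'I_d -> A), indep_mod P X /\
  forall a, integralOver (ev c (iota \o X)) (iota a).
Proof.
have [n [z hz]] := affine_generators haff.
have [d [x [ix intx hx]]] := noether_normalization c (iota \o z).
have [q hq] := choice hx.
have e : iota \o (fun i => evA z (q i)) = x.
  by apply/funext => i /=; rewrite ev_comp hq.
exists d, (fun i => evA z (q i)); split; first by apply/indep_mod_frac; rewrite e.
move=> a; have [p ->] := hz a; rewrite e ev_comp; exact: integral_ev.
Qed.

End Quotient.

Definition trd P n := (exists u : 'I_n -> A, indep_mod P u) /\
  forall m (u : 'I_m -> A), indep_mod P u -> (m <= n)%N.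

Lemma trd_noether P (F : fieldType) (iota : {rmorphism A -> F}) d (X : 'I_d -> A) :
  is_frac_of_quotient P iota -> indep_mod P X ->
  (forall a, integralOver (ev (iota \o in_alg A) (iota \o X)) (iota a)) -> trd P d.
Proof.
move=> hf iX intX; split=> [|m u hu]; first by exists X.
apply: (@alg_indep_card F (iota \o in_alg A) d (iota \o X) m (iota \o u)).
  by move=> i; apply: intX.
by apply/(indep_mod_frac hf).
Qed.

Lemma trd_exists P : complex_affine A -> prime_ideal P -> exists n, trd P n.
Proof.
move=> haff /frac_of_quotient_exists[F [iota hf]].
have [d [X [iX intX]]] := noether_quotient haff hf.
by exists d; apply: trd_noether hf iX intX.
Qed.

Lemma trd_uniq P n m : trd P n -> trd P m -> n = m.
Proof.
move=> [[u hu] h1] [[v hv] h2]; apply/eqP; rewrite eqn_leq.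
by rewrite (h2 _ _ hu) (h1 _ _ hv).
Qed.

Lemma trd_lt P Q n m : prime_ideal P -> prime_ideal Q -> P `<` Q ->
  trd P n -> trd Q m -> (m < n)%N.
Proof.
move=> pP [iQ _ _] [PQ nQP] [_ hn] [[u hu] _].
have [f [Qf nPf]] : exists f, Q f /\ ~ P f.
  by apply: contrapT => h; apply: nQP => f Qf; apply: contrapT => nPf; apply: h; exists f.
exact: hn (indep_mod_vsnoc pP iQ PQ Qf nPf hu).
Qed.

(** Says that Q/P has height one in A/P, the form in which next height is exploited. *)
Definition adjacent P Q := [/\ prime_ideal P, prime_ideal Q, P `<` Q
  & forall Q', prime_ideal Q' -> P `<=` Q' -> Q' `<` Q -> Q' `<=` P].

(* Adjacency makes [Q] minimal over [P + (a)], so some power of each element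
   of [Q] lies in [P + (a)] up to a factor outside [Q]. *)
Lemma adjacent_minimal P Q a b : adjacent P Q -> Q a -> ~ P a -> Q b ->
  exists k h e, ~ Q h /\ P (b ^+ k * h - e * a).
Proof.
move=> [pP pQ [PQ nQP] hadj] Qa nPa Qb.
have [[P0 PD PM] P1 _] := pP; have [[Q0 QD QM] Q1 QP] := pQ.
apply: contrapT => H.
pose I x := exists e, P (x - e * a).
pose T x := exists k h, ~ Q h /\ x = b ^+ k * h.
have [||||Q' [pQ' IQ' dQ']] := @krull_prime A I T.
- split.
  + by exists 0; rewrite mul0r subrr.
  + move=> x y [e he] [e' he']; exists (e + e').
    have -> : x + y - (e + e') * a = (x - e * a) + (y - e' * a) by ring.
    exact: PD.
  + move=> z x [e he]; exists (z * e).
    have -> : z * x - z * e * a = z * (x - e * a) by ring.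
    exact: PM.
- by exists 0%N, 1; rewrite mulr1.
- move=> x y [k [h [nh ->]]] [k' [h' [nh' ->]]]; exists (k + k')%N, (h * h').
  split; first by move=> /QP[].
  by rewrite exprD; ring.
- by move=> x [e he] [k [h [nh ex]]]; apply: H; exists k, h, e; rewrite -ex.
have sQ' : Q' `<=` Q.
  move=> x Q'x; apply: contrapT => nQx; apply: (dQ' _ Q'x).
  by exists 0%N, x; rewrite expr0 mul1r.
have nb : ~ Q' b.
  move=> Q'b; apply: (dQ' _ Q'b); exists 1%N, 1; rewrite expr1 mulr1; split=> //.
have PQ' : P `<=` Q' by move=> x Px; apply: IQ'; exists 0; rewrite mul0r subr0.
apply: nPa; apply: (hadj Q') => //; last first.
  by apply: IQ'; exists 1; rewrite mul1r subrr.
by split=> // h; apply: nb; apply: h.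
Qed.


Lemma prime_ideal_exp P x n : prime_ideal P -> P (x ^+ n) -> P x.
Proof.
move=> [_ P1 PM]; elim: n => [|n IH]; first by rewrite expr0.
by rewrite exprS => /PM[].
Qed.

Section Contraction.
Variables (P : set A) (F : fieldType) (iota : {rmorphism A -> F}).
Variables (d : nat) (X : 'I_d -> A).
Hypotheses (hfrac : is_frac_of_quotient P iota) (iX : indep_mod P X).
Hypothesis intX : forall a, integralOver (ev (iota \o in_alg A) (iota \o X)) (iota a).
Local Notation phi := (ev (iota \o in_alg A) (iota \o X)).

Let phi_inj : injective phi.
Proof. by apply: alg_indep_inj; apply/(indep_mod_frac hfrac). Qed.

Let horner_phi (q : {poly {mpoly CC[d]}}) a :
  (map_poly phi q).[iota a] = iota (map_poly (evA X) q).[a].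
Proof.
rewrite -horner_map -map_poly_comp; congr (_.[_]); apply: eq_map_poly => r /=.
by rewrite ev_comp.
Qed.

(** [f] is the constant term of the minimal polynomial of [iota a]; if it were zero, a factor X
    could be cancelled, against minimality. *)
Lemma nonzero_multiple a : ~ P a -> exists f b, f != 0 /\ P (evA X f - b * a).
Proof.
have [h0 _] := hfrac; move=> nPa.
have [q [mq rq hq]] := integral_minimal_poly (@ufd_mpoly _ d) phi_inj (intX a).
have a0 : iota a != 0 by apply/eqP => /h0.
elim/poly_ind: q mq rq hq => [|q r _] mq rq hq.
  by have := monic_neq0 mq; rewrite eqxx.
exists r, (- (map_poly (evA X) q).[a]); split; last first.
  apply/h0; rewrite rmorphB rmorphM rmorphN /= -horner_phi ev_comp.
  move: (rootP rq); rewrite rmorphD rmorphM /= map_polyX map_polyC /=.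
  by rewrite hornerD hornerM hornerX hornerC mulNr opprK addrC.
apply: contraTneq mq => r0; move: rq hq; rewrite r0 addr0.
rewrite rmorphM /= map_polyX rootM rootX (negPf a0) orbF => rq /(_ _ rq) [t e].
have [q0|q0] := eqVneq q 0; first by rewrite q0 mul0r monicE lead_coef0 eq_sym oner_eq0.
have t0 : t != 0 by apply: contraNneq q0 => t0; rewrite e t0 mul0r.
have qX : q * 'X != 0 by rewrite mulf_neq0 ?polyX_eq0.
by have := size_le_mull t0 qX; rewrite -e size_mulX // ltnn.
Qed.

(** If [b] gave an element of [Q] without being divisible by [g], minimality would provide s h = g e
    modulo [P], with s a power of [b] and h outside [Q]. The minimal polynomial of g e is a power of
    X modulo [g]; that of s h arises from the one of h by scaling the roots by s, and [g] does not
    divide s. So the minimal polynomial of h is a power of X modulo [g], and a power of h lies in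
    [Q]. *)
Lemma contraction_principal Q g b : adjacent P Q -> prime_elt g ->
  Q (evA X g) -> Q (evA X b) -> dvdr g b.
Proof.
move=> hadj pg Qg Qb; have [h0 _] := hfrac.
have [pP pQ [PQ _] _] := hadj; have [[Q0 QD QM] Q1 _] := pQ.
have nPg : ~ P (evA X g) by move=> /iX e; move: (prime_elt_neq0 pg); rewrite e eqxx.
apply: contrapT => ngb.
have [k [h [e [nQh /h0 he]]]] := adjacent_minimal hadj Qg nPg Qb.
pose s := b ^+ k.
have ngs : ~ dvdr g s by move=> /(prime_dvdX pg).
have s0 : s != 0 by apply/eqP => z; apply: ngs; rewrite z; apply: dvdr0.
have eu : phi s * iota h = phi g * iota e.
  move: he; rewrite rmorphB !rmorphM rmorphXn /= => /eqP; rewrite subr_eq0 => /eqP.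
  by rewrite /s rmorphXn /= !ev_comp mulrC [RHS]mulrC mulrC => ->.
have [f [mf rf hf]] := integral_minimal_poly (@ufd_mpoly _ d) phi_inj (intX h).
have mfs := monic_scale_roots s mf.
have rfs := root_scale_roots s mf rf.
have iu : integralOver phi (phi s * iota h) by exists (scale_roots s f).
have [f' [mf' rf' hf']] := integral_minimal_poly (@ufd_mpoly _ d) phi_inj iu.
have szf : (size f <= size f')%N.
  (* This is f'(s X), which vanishes at [iota h] and hence is a multiple of [f]. *)
  pose p := \poly_(i < size f') (f'`_i * s ^+ i).
  have sp : size p = size f'.
    rewrite /p size_poly_eq // -lead_coefE (monicP mf') mul1r.
    exact: expf_neq0.
  have [|t et] := hf p.
    apply/rootP; rewrite horner_poly sp; rewrite -[RHS](rootP rf') horner_poly.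
    apply: eq_bigr => i _; rewrite coef_poly ltn_ord rmorphM rmorphXn /=.
    by rewrite exprMn; ring.
  have t0 : t != 0.
    apply/eqP => t0; move: sp; rewrite et t0 mul0r size_poly0 => /esym/eqP.
    by rewrite size_poly_eq0 (negPf (monic_neq0 mf')).
  by rewrite -sp et; apply: size_le_mull => //; apply: monic_neq0.
have ef' : f' = scale_roots s f.
  have [t et] := hf' _ rfs.
  have mt : t \is monic by move: mfs; rewrite et monicMr.
  have := congr1 (fun p : {poly _} => size p) et.
  rewrite /= size_scale_roots // size_monicM ?monic_neq0 // => sz.
  have t1 : size t = 1%N.
    have t0 : (0 < size t)%N by rewrite size_poly_gt0 monic_neq0.
    have f0 : (0 < size f')%N by rewrite size_poly_gt0 monic_neq0.
    exact: pred_add_le t0 f0 szf sz.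
  have /size_poly1P[r r0 er] : size t == 1%N by apply/eqP.
  by rewrite et; move: mt; rewrite er monicE lead_coefC => /eqP ->; rewrite mul1r.
have [H mH rH] := intX e.
have mHg := monic_scale_roots g mH.
have := root_scale_roots g mH rH; rewrite -eu => /hf'[t et].
have mt : t \is monic by move: mHg; rewrite et monicMr.
have H0 : (0 < size H)%N by rewrite size_poly_gt0 monic_neq0.
have key := @monic_factor_Xn_mod _ g f' t (size H).-1 pg mf' mt.
have hdiv i : (i < (size f).-1)%N -> dvdr g f`_i.
  move=> hi; have : dvdr g f'`_i.
    apply: key.
    - by rewrite mulrC -et size_scale_roots // prednK.
    - move=> j hj; rewrite mulrC -et coef_poly; case: ltnP => _; last exact: dvdr0.
      apply: dvdr_mulr; rewrite -(subnSK hj).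
      by rewrite exprS; apply: dvdr_mulr; apply: dvdr_refl.
    - by rewrite ef' size_scale_roots.
  rewrite ef' coef_poly (leq_trans hi (leq_pred _)).
  by case/(prime_dvdM pg) => // /(prime_dvdX pg).
apply: nQh; apply: (@prime_ideal_exp _ _ (size f).-1) => //.
have : Q (map_poly (evA X) f).[h] by apply: PQ; apply/h0; rewrite -horner_phi (rootP rf).
have f0 : (0 < size f)%N by rewrite size_poly_gt0 monic_neq0.
rewrite horner_monic ?monic_map // size_map_poly_id0; last first.
  by rewrite (monicP mf) rmorph1 oner_neq0.
move=> hs.
rewrite -[_ ^+ _](addrK (\sum_(i < (size f).-1) (map_poly (evA X) f)`_i * h ^+ i)) addrC.
rewrite -mulN1r addrC; apply: (QD); first by rewrite addrC.
apply: (QM); elim/big_ind: _ => [//|x y|i _]; first exact: QD.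
have [r er] := hdiv i (ltn_ord i).
rewrite coef_map /= er rmorphM /= mulrAC; exact: QM.
Qed.

Lemma adjacent_prime_generator Q : adjacent P Q ->
  exists g, prime_elt g /\ Q (evA X g).
Proof.
move=> [pP pQ [PQ nQP] _]; have [[Q0 QD QM] Q1 QP] := pQ.
have [a [Qa nPa]] : exists a, Q a /\ ~ P a.
  by apply: contrapT => h; apply: nQP => f Qf; apply: contrapT => nPf; apply: h; exists f.
have [f [b [f0 /PQ hb]]] := nonzero_multiple nPa.
have : Q (evA X f).
  by rewrite -[evA X f](subrK (b * a)); apply: QD => //; apply: QM.
move: f f0 {hb}; apply: (ufd_ind (@ufd_mpoly _ d)) => [u uu Qu|g r pg r0 IH].
  case: Q1; have := QM (evA X u^-1) _ Qu.
  by rewrite -rmorphM mulVr // rmorph1.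
by rewrite rmorphM => /QP[h|/IH//]; exists g.
Qed.

End Contraction.

(** In a generic direction [g] has positive degree along the line coordinate, so no nonzero
    polynomial in the other d - 1 coordinates is a multiple of [g]: these coordinates stay
    independent modulo [Q]. *)
Lemma trd_contraction Q d (X : 'I_d -> A) g m : prime_elt g ->
  (forall b, Q (evA X b) -> dvdr g b) -> trd Q m -> (d <= m.+1)%N.
Proof.
case: d X g => // d X g pg hg [_ hm].
have g0 := prime_elt_neq0 pg; have [v hv] := topform_direction g0.
pose w j := X (lift ord_max j) - in_alg A (v j) * X ord_max.
suff iw : indep_mod Q w by have := hm _ _ iw.
move=> q Qq; have [t e] : dvdr g (lback0 v q).
  apply: hg; rewrite (ev_lchange _ _ v) -/w.
  have -> : lchange v (lback0 v q) = q%:P by rewrite -lbackC lbackK.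
  by rewrite map_polyC hornerC.
have e1 := congr1 (lchange v) e.
rewrite rmorphM /= -lbackC lbackK in e1.
apply/eqP; apply: contraT => q0.
have sg : (1 < size (lchange v g))%N.
  have sm := prime_msize_gt1 pg.
  have := lchange_top v g; set a := (topform g).@[_] in hv * => ht.
  rewrite ltnNge; apply/negP => hle; move: hv; rewrite -(mpolyC_eq0 d) -ht.
  by rewrite nth_default ?eqxx //; apply: leq_trans hle _; case: (msize g) sm => [|[]].
have t0 : lchange v t != 0.
  by apply: contraNneq q0 => z; rewrite -(polyC_eq0) e1 z mul0r.
have gg0 : lchange v g != 0 by rewrite -size_poly_gt0; apply: leq_trans sg.
have := size_le_mull t0 gg0; rewrite -e1 => h.
by have := leq_trans sg (leq_trans h (size_polyC_leq1 q)).
Qed.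

Lemma trd_adjacent P Q n m : complex_affine A -> adjacent P Q -> trd P n ->
  trd Q m -> n = m.+1.
Proof.
move=> haff hadj tP tQ; have [pP pQ PQ _] := hadj.
apply/eqP; rewrite eqn_leq (trd_lt pP pQ PQ tP tQ) andbT.
have [F [iota hf]] := frac_of_quotient_exists pP.
have [d [X [iX intX]]] := noether_quotient haff hf.
rewrite (trd_uniq tP (trd_noether hf iX intX)).
have [g [pg Qg]] := adjacent_prime_generator hf iX intX hadj.
by apply: (trd_contraction pg _ tQ) => b; apply: (contraction_principal hf iX intX hadj pg Qg).
Qed.

Lemma zero_prime : complex_affine A -> prime_ideal [set 0 : A].
Proof.
case=> _ [h1 h2]; split; first split=> //.
- by move=> x y -> ->; rewrite addr0.
- by move=> a x ->; rewrite mulr0.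
- by move=> /eqP; apply/negP.
- by move=> x y /h2.
Qed.

(** The transcendence degree drops strictly along every chain, and by exactly one between adjacent
    primes; a chain of full length is built downwards from [P]. *)
Lemma height_trd P n r : complex_affine A -> prime_ideal P ->
  trd [set 0 : A] n -> trd P r -> height P (n - r)%N.
Proof.
move=> haff pP t0 tP; have p0 := zero_prime haff.
have sub0 Q : prime_ideal Q -> [set 0] `<=` Q by move=> [[Q0 _ _] _ _] x ->.
have trd_le Q s : prime_ideal Q -> trd Q s -> (s <= n)%N.
  move=> pQ tQ; have [e|h] := EM (Q `<=` [set 0]).
    have e' : Q = [set 0] by apply/seteqP; split=> //; apply: sub0.
    by rewrite e' in tQ; rewrite (trd_uniq tQ t0).
  by apply: ltnW; apply: (trd_lt p0 pQ _ t0 tQ); split=> //; apply: sub0.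
split; last first.
  move=> c m [hp hlt] ec.
  have key i : (i <= m)%N -> forall s, trd (c i) s -> (s + i <= n)%N.
    elim: i => [|i IH] hi s ts; first by rewrite addn0; apply: trd_le ts; apply: hp.
    have [s' ts'] := trd_exists haff (hp i (ltnW hi)).
    have := IH (ltnW hi) _ ts'.
    have := trd_lt (hp _ (ltnW hi)) (hp _ hi) (hlt _ hi) ts' ts; lia.
  have := key m (leqnn m) r; rewrite ec => /(_ tP); lia.
have [k] := ubnP (n - r); elim: k P r pP tP => // k IH P r pP tP hk.
have [rn|rn] := eqVneq r n.
  exists (fun=> P); rewrite rn subnn; split=> //.
have rlt : (r < n)%N by rewrite ltn_neqAle rn (trd_le _ _ pP tP).
have ltP : [set 0] `<` P.
  split; first exact: sub0.
  move=> h; have e : P = [set 0] by apply/seteqP; split=> //; apply: sub0.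
  by rewrite e in tP; move: rn; rewrite (trd_uniq tP t0) eqxx.
(* Among the primes strictly below [P], one of least transcendence degree leaves no prime in
   between. *)
pose good s := `[< exists Q, [/\ prime_ideal Q, Q `<` P & trd Q s] >].
have ex : exists s, good s by exists n; apply/asboolP; exists [set 0].
case: (ex_minnP ex) => s /asboolP[Q [pQ QP tQ]] hmin.
have hadj : adjacent Q P.
  split=> // Q' pQ' QQ' Q'P; apply: contrapT => h.
  have [s' ts'] := trd_exists haff pQ'.
  have : (s' < s)%N by apply: (trd_lt pQ pQ' _ tQ ts'); split.
  by rewrite ltnNge hmin //; apply/asboolP; exists Q'.
have es := trd_adjacent haff hadj tQ tP.
have [|c [[hp hlt] ec]] := IH Q s pQ tQ; first by lia.
have en : (n - r = (n - s).+1)%N by have := trd_le _ _ pQ tQ; lia.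
exists (fun i => if (i <= n - s)%N then c i else P); rewrite en ltnn; split=> //.
split=> i hi.
  by case: leqP => h //; apply: hp.
have hi' : (i <= n - s)%N by rewrite -ltnS.
rewrite hi'; case: (ltnP i (n - s)) => h; first by apply: hlt.
by have -> : i = (n - s)%N by [apply/eqP; rewrite eqn_leq hi']; rewrite ec.
Qed.

End Dimension.

(** * Points avoiding countably many hypersurfaces *)

Section Presentation.
Variables (A : comAlgType CC) (P : set A) (F : fieldType) (iota : {rmorphism A -> F}).
Variables (d : nat) (X : 'I_d -> A).
Hypotheses (haff : complex_affine A) (hfrac : is_frac_of_quotient P iota).
Hypothesis iX : indep_mod P X.
Hypothesis intX : forall a, integralOver (ev (iota \o in_alg A) (iota \o X)) (iota a).
Local Notation R := {mpoly CC[d]}.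
Local Notation phi := (ev (iota \o in_alg A) (iota \o X)).
Local Notation tf := (@FracField.tofrac R).

Lemma phi_injective : injective phi.
Proof. by apply: alg_indep_inj; apply/(indep_mod_frac hfrac). Qed.

Lemma phi_eq0 r : (phi r == 0) = (r == 0).
Proof.
apply/eqP/eqP => [h|->]; last exact: rmorph0.
by apply: phi_injective; rewrite h; exact/esym/rmorph0.
Qed.

Lemma horner_iota (q : {poly R}) a :
  (map_poly phi q).[iota a] = iota (map_poly (ev (in_alg A) X) q).[a].
Proof.
rewrite -horner_map -map_poly_comp; congr (_.[_]); apply: eq_map_poly => r /=.
by rewrite ev_comp.
Qed.

(** The primitive element theorem in characteristic zero, applied to one generator at a time; it
    yields integer combinations, so [y] is an element of [A]. *)
Lemma primitive_combination (g : {rmorphism {fraction R} -> F}) n (u : 'I_n -> A) :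
  (forall r, g (tf r) = phi r) ->
  exists y, forall i, exists q : {poly {fraction R}}, iota (u i) = (map_poly g q).[iota y].
Proof.
move=> hg; elim: n u => [|n IH] u; first by exists 0; case.
have [y hy] := IH (fun i => u (lift ord_max i)).
have root_of a : exists2 q : {poly {fraction R}}, q != 0 & root (map_poly g q) (iota a).
  have [q mq rq] := intX a; exists (map_poly tf q).
    by apply: monic_neq0; apply: monic_map.
  rewrite -map_poly_comp; have -> : map_poly (g \o tf) q = map_poly phi q => //.
  by apply: eq_map_poly => r /=; apply: hg.
have [p1 p10 r1] := root_of y; have [p2 p20 r2] := root_of (u ord_max).
have ch0 : [pchar {fraction R}] =i pred0.
  move=> l; apply/negbTE/negP => /andP[pl /eqP e].
  have : (l%:R : {fraction R}) = tf (l%:R)%:MP by rewrite mpolyC_nat rmorph_nat.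
  rewrite e => /esym/eqP; rewrite tofrac_eq0 mpolyC_eq0 Num.Theory.pnatr_eq0.
  by move: pl; case: (l).
have [m [[q1 h1] [q2 h2]]] := pchar0_PET p10 r1 p20 r2 ch0.
exists (u ord_max *+ m - y); rewrite rmorphB rmorphMn => i.
case: (unliftP ord_max i) => [j|] ->; last by exists q2; rewrite h2.
have [q hq] := hy j; exists (q \Po q1).
by rewrite map_comp_poly horner_comp h1.
Qed.

(** [D] has two tasks: its powers clear the denominators of A/P relative to R[y], and it is a
    multiple of p'(y) with cofactor w(y), so that the extension is unramified where [D] is
    invertible. *)
Lemma presentation : exists (y : A) (p w : {poly R}) (D : R),
  [/\ p \is monic, root (map_poly phi p) (iota y),
      (forall q, root (map_poly phi q) (iota y) -> dvdr p q), D != 0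
    & (forall a, exists k f, phi D ^+ k * iota a = (map_poly phi f).[iota y]) /\
      (map_poly phi p^`()).[iota y] * (map_poly phi w).[iota y] = phi D].
Proof.
have [g hg] := frac_lift phi_injective.
have [n [z hz]] := affine_generators haff.
have [y hy] := primitive_combination z hg.
have hy2 i : exists r (f : {poly R}), r != 0 /\ phi r * iota (z i) = (map_poly phi f).[iota y].
  have [q hq] := hy i; have [r [f [r0 hf]]] := frac_poly_clear_denom q.
  exists r, f; split=> //; rewrite hq -hg -hornerZ -map_polyZ -hf -map_poly_comp.
  by congr (_.[_]); apply: eq_map_poly => a /=; rewrite hg.
have [r hr] := choice hy2; have [f hf] := choice hr.
pose D0 := \prod_i r i.
have D00 : D0 != 0 by apply/prodf_neq0 => i _; case: (hf i).
pose good a := exists k q, phi D0 ^+ k * iota a = (map_poly phi q).[iota y].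
have goodC (r' : R) : good (ev (in_alg A) X r').
  exists 0%N, r'%:P; rewrite expr0 mul1r map_polyC hornerC /=; exact: ev_comp.
have goodD a b : good a -> good b -> good (a + b).
  move=> [k [q hq]] [k' [q' hq']]; exists (k + k')%N, (D0%:P ^+ k' * q + D0%:P ^+ k * q').
  rewrite !rmorphD !rmorphM !rmorphXn /= map_polyC hornerD !hornerM !horner_exp hornerC.
  by rewrite -hq -hq' exprD /=; ring.
have goodM a b : good a -> good b -> good (a * b).
  move=> [k [q hq]] [k' [q' hq']]; exists (k + k')%N, (q * q').
  by rewrite !rmorphM /= hornerM -hq -hq' exprD; ring.
have goodz i : good (z i).
  exists 1%N, ((\prod_(j | j != i) r j) *: f i).
  rewrite map_polyZ hornerZ -(proj2 (hf i)) expr1 /D0 (bigD1 i) //=.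
  by rewrite rmorphM; ring.
have good_all a : good a.
  have [p ->] := hz a; rewrite [p]mpolyE rmorph_sum.
  apply: (big_ind good) => [|//|m _].
    by exists 0%N, 0; rewrite rmorph0 mulr0 rmorph0 horner0.
  rewrite -mul_mpolyC rmorphM /= evC; apply: (@goodM).
    by have := goodC (p@_m)%:MP; rewrite evC.
  rewrite mpolyXE_id rmorph_prod; apply: (big_ind good) => [|//|i _].
    by exists 0%N, 1; rewrite rmorph1 mulr1 expr0 rmorph1 hornerC.
  rewrite rmorphXn /= evX; elim: (m i) => [|k IH].
    by rewrite expr0; exists 0%N, 1; rewrite rmorph1 mulr1 expr0 rmorph1 hornerC.
  by rewrite exprS; apply: (@goodM).
have [p [mp rp hp]] := integral_minimal_poly (@ufd_mpoly _ d) phi_injective (intX y).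
have sp : (1 < size p)%N.
  rewrite ltnNge; apply/negP => sp; have := rp; rewrite [p]size1_polyC //.
  rewrite map_polyC rootC phi_eq0 => /eqP e; move: (monic_neq0 mp).
  by rewrite [p]size1_polyC // e eqxx.
have p'0 : p^`() != 0.
  apply/eqP => /(congr1 (fun q : {poly R} => q`_(size p).-2)).
  rewrite coef_deriv coef0.
  have -> : (size p).-2.+1 = (size p).-1 by case: (size p) sp => [|[]].
  rewrite -lead_coefE (monicP mp) -mpolyC_nat => /eqP.
  rewrite mpolyC_eq0 Num.Theory.pnatr_eq0.
  by case: (size p) sp => [|[]].
have nP : ~ P (map_poly (ev (in_alg A) X) p^`()).[y].
  move=> h; have : root (map_poly phi p^`()) (iota y).
    by rewrite /root horner_iota; apply/eqP/(proj1 hfrac).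
  case/hp => t e; have t0 : t != 0 by apply: contraNneq p'0 => z0; rewrite e z0 mul0r.
  have := size_le_mull t0 (monic_neq0 mp); rewrite -e leqNgt.
  by rewrite lt_size_deriv ?monic_neq0.
have [f1 [b [f10 /(proj1 hfrac) hb]]] := nonzero_multiple hfrac iX intX nP.
have {}hb : phi f1 = (map_poly phi p^`()).[iota y] * iota b.
  move: hb; rewrite rmorphB rmorphM /= -horner_iota ev_comp => /eqP.
  by rewrite subr_eq0 => /eqP ->; rewrite mulrC.
have [k [w0 hw]] := good_all b.
(* In [F] one has p'(y) b = f1 and D0^k b = w0(y). The extra factor [D0] keeps the denominator
   divisible by [D0] even when [k] is 0. *)
exists y, p, (D0 *: w0), (D0 ^+ k.+1 * f1); split=> //.
  by rewrite mulf_neq0 // expf_neq0.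
split.
  move=> a; have [j [q hq]] := good_all a; exists j, ((D0 ^+ k * f1) ^+ j *: q).
  rewrite map_polyZ hornerZ /= -hq exprS -mulrA [in LHS]rmorphM exprMn rmorphXn /=.
  by rewrite -mulrA mulrCA mulrA -rmorphXn mulrC mulrA.
by rewrite map_polyZ hornerZ -hw !rmorphM rmorphXn /= hb exprS; ring.
Qed.

(* A root over [CC] of the minimal polynomial of a primitive element, at a
   parameter value where finitely or countably many given elements and the
   denominator [D] do not vanish, defines a point of the variety. *)
Lemma generic_point (g : nat -> A) : (forall i, ~ P (g i)) ->
  exists chi : {rmorphism A -> CC}, [/\ forall a, chi a%:A = a,
    forall a, P a -> chi a = 0 & forall i, chi (g i) != 0].
Proof.
move=> hg; have [y [p [w [D [mp rp hp D0 [hD _]]]]]] := presentation.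
have [f hf] := choice (fun i => nonzero_multiple hfrac iX intX (hg i)).
have [|v hv] := @mpoly_avoid _ (fun i => D * f i).
  by move=> i; have [e0 [f0 _]] := hf i; rewrite mulf_neq0.
have Dv : D.@[v] != 0 by have := hv 0%N; rewrite mevalM mulf_eq0 negb_or => /andP[].
have fv i : (f i).@[v] != 0 by have := hv i; rewrite mevalM mulf_eq0 negb_or => /andP[].
pose mv : {poly R} -> {poly CC} := map_poly (meval v).
have sp : (1 < size p)%N.
  rewrite ltnNge; apply/negP => sp; have := rp; rewrite [p]size1_polyC //.
  rewrite map_polyC rootC phi_eq0 => /eqP e; move: (monic_neq0 mp).
  by rewrite [p]size1_polyC // e eqxx.
have spv : size (mv p) = size p.
  by rewrite size_map_poly_id0 // (monicP mp) rmorph1 oner_neq0.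
have [b rb] : exists b, root (mv p) b.
  apply: (@closed_rootP (complex Rdefinitions.R)).
  by rewrite spv; case: (size p) sp => [|[]].
have ez (q : {poly R}) : root (map_poly phi q) (iota y) -> (mv q).[b] = 0.
  by case/hp => t ->; rewrite /mv rmorphM /= hornerM (rootP rb) mulr0.
have hx a : exists c, exists k q, phi D ^+ k * iota a = (map_poly phi q).[iota y] /\
    D.@[v] ^+ k * c = (mv q).[b].
  have [k [q hq]] := hD a; exists ((mv q).[b] / D.@[v] ^+ k), k, q; split=> //.
  by rewrite mulrC divfK // expf_neq0.
have [chi hchi] := choice hx.
(* Well-definedness: two representations differ by a polynomial vanishing at [iota y], hence by a
   multiple of [p], which vanishes at the chosen root [b]. *)
have chiE a k q : phi D ^+ k * iota a = (map_poly phi q).[iota y] ->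
    D.@[v] ^+ k * chi a = (mv q).[b].
  move=> h; have [k' [q' [h1 h2]]] := hchi a.
  have : (mv (D ^+ k' *: q - D ^+ k *: q')).[b] = 0.
    apply: ez; rewrite /root rmorphB /= !map_polyZ !hornerD hornerN !hornerZ /=.
    by rewrite -h -h1 !rmorphXn /= mulrCA subrr.
  rewrite /mv rmorphB /= !map_polyZ hornerD hornerN !hornerZ /= -!/(mv _) -h2 !rmorphXn /=.
  move/eqP; rewrite subr_eq0 => /eqP e; apply: (mulfI (expf_neq0 k' Dv)).
  by rewrite e mulrCA.
have chiX (r : R) : chi (ev (in_alg A) X r) = r.@[v].
  have := @chiE (ev (in_alg A) X r) 0%N r%:P.
  rewrite !expr0 !mul1r /mv !map_polyC !hornerC /=; apply; exact: ev_comp.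
have chiC a : chi a%:A = a.
  by have := chiX a%:MP; rewrite evC mevalC.
have chi0 a : P a -> chi a = 0.
  move/(proj1 hfrac) => e; have := @chiE a 0%N 0.
  by rewrite e mulr0 /mv !rmorph0 !horner0 expr0 mul1r; apply.
have chiB : zmod_morphism chi.
  move=> a a'; have [k [q [h1 h2]]] := hchi a; have [k' [q' [h1' h2']]] := hchi a'.
  apply: (mulfI (expf_neq0 (k + k') Dv)).
  rewrite (chiE _ _ (D ^+ k' *: q - D ^+ k *: q')).
    rewrite /mv rmorphB /= !map_polyZ hornerD hornerN !hornerZ -!/(mv _) -h2 -h2' !rmorphXn /=.
    by rewrite exprD; ring.
  rewrite !rmorphB /= !map_polyZ hornerD hornerN !hornerZ -h1 -h1' !rmorphXn /= exprD.
  by ring.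
have chiM : monoid_morphism chi.
  split; first by rewrite -(chiC 1) scale1r.
  move=> a a'; have [k [q [h1 h2]]] := hchi a; have [k' [q' [h1' h2']]] := hchi a'.
  apply: (mulfI (expf_neq0 (k + k') Dv)).
  rewrite (chiE _ _ (q * q')).
    by rewrite /mv rmorphM /= hornerM -!/(mv _) -h2 -h2' exprD; ring.
  by rewrite !rmorphM /= hornerM -h1 -h1' exprD; ring.
pose ga := GRing.isZmodMorphism.Build _ _ chi chiB.
pose gm := GRing.isMonoidMorphism.Build _ _ chi chiM.
pose CHI : {rmorphism A -> CC} := HB.pack chi ga gm.
exists CHI; split=> // i; apply: contraNneq (fv i) => /= e.
have [e0 [_ /chi0]] := hf i.
by rewrite chiB chiM.2 e mulr0 subr0 chiX => ->.
Qed.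

End Presentation.

(** * Derivations and induced brackets *)

Section Derivations.
Variable F : fieldType.
Implicit Types D : F -> F.

Definition is_der D := (forall x y, D (x + y) = D x + D y) /\
  (forall x y, D (x * y) = x * D y + D x * y).

Section Theory.
Variable D : F -> F.
Hypothesis hD : is_der D.

Lemma der0 : D 0 = 0.
Proof. by have := hD.1 0 0; rewrite addr0 => /eqP; rewrite -subr_eq0 opprD addrA subrr sub0r oppr_eq0 => /eqP. Qed.
Lemma derN x : D (- x) = - D x.
Proof. by apply/eqP; rewrite -addr_eq0 -hD.1 addNr der0. Qed.
Lemma derB x y : D (x - y) = D x - D y.
Proof. by rewrite hD.1 derN. Qed.
Lemma der1 : D 1 = 0.
Proof.
by have := hD.2 1 1; rewrite !mulr1 mul1r => /eqP; rewrite -subr_eq0 opprD addrA subrr sub0r oppr_eq0 => /eqP.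
Qed.
Lemma der_sum (I : Type) (r : seq I) (f : I -> F) :
  D (\sum_(i <- r) f i) = \sum_(i <- r) D (f i).
Proof. by elim: r => [|i r IH]; rewrite ?big_nil ?der0 // !big_cons hD.1 IH. Qed.
Lemma der_div x y : y != 0 -> D (x / y) = (D x * y - x * D y) / y ^+ 2.
Proof.
move=> y0; have := hD.2 (x / y) y; rewrite divfK // => e.
by rewrite e; field.
Qed.
End Theory.

Lemma is_der_add D1 D2 : is_der D1 -> is_der D2 -> is_der (fun x => D1 x + D2 x).
Proof.
by move=> [a1 m1] [a2 m2]; split=> x y; rewrite ?a1 ?a2 ?m1 ?m2; ring.
Qed.
Lemma is_der_scale c D : is_der D -> is_der (fun x => c * D x).
Proof. by move=> [a m]; split=> x y; rewrite ?a ?m; ring. Qed.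
Lemma is_der_opp D : is_der D -> is_der (fun x => - D x).
Proof. by move=> [a m]; split=> x y; rewrite ?a ?m; ring. Qed.
Lemma is_der0 : is_der (fun=> 0).
Proof. by split=> x y; rewrite ?addr0 ?mulr0 ?mul0r ?addr0. Qed.

Section Extension.
Variables (C0 : comNzRingType) (psi : {rmorphism C0 -> F}).
Hypothesis hfrac : forall z : F, exists a b, psi b != 0 /\ z = psi a / psi b.

Lemma der_ext D1 D2 : is_der D1 -> is_der D2 ->
  (forall a, D1 (psi a) = D2 (psi a)) -> forall z, D1 z = D2 z.
Proof.
move=> d1 d2 h z; have [a [b [b0 ->]]] := hfrac z.
by rewrite !der_div // !h.
Qed.

(** The quotient rule defines [D]; as [d] kills the kernel of [psi], its value does not depend on
    the fraction chosen. *)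
Lemma der_extend (d : C0 -> F) : (forall a b, d (a + b) = d a + d b) ->
  (forall a b, d (a * b) = psi a * d b + d a * psi b) ->
  (forall a, psi a = 0 -> d a = 0) ->
  exists D, is_der D /\ forall a, D (psi a) = d a.
Proof.
move=> dD dM d0.
have d00 : d 0 = 0 by apply: d0; rewrite rmorph0.
have dN a : d (- a) = - d a by apply/eqP; rewrite -addr_eq0 -dD addNr d00.
have d1 : d 1 = 0.
  have := dM 1 1; rewrite rmorph1 !mulr1 mul1r => /eqP.
  by rewrite -subr_eq0 opprD addrA subrr sub0r oppr_eq0 => /eqP.
have hz z : exists w, exists a b, [/\ psi b != 0, z = psi a / psi b
    & w = (d a * psi b - psi a * d b) / psi b ^+ 2].
  by have [a [b [b0 e]]] := hfrac z; eexists; exists a, b; split.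
have [D hD] := choice hz.
have DE a b : psi b != 0 -> D (psi a / psi b) = (d a * psi b - psi a * d b) / psi b ^+ 2.
  move=> b0; have [a' [b' [b0' e ->]]] := hD (psi a / psi b).
  have e1 : psi a * psi b' = psi a' * psi b.
    by apply/eqP; rewrite -eqr_div //; apply/eqP.
  have e2 : psi a * d b' + d a * psi b' = psi a' * d b + d a' * psi b.
    rewrite -!dM; apply/eqP; rewrite -subr_eq0 -dN -dD; apply/eqP/d0.
    by rewrite rmorphD rmorphN !rmorphM /= e1 subrr.
  have e3 : d a * psi b' = psi a' * d b + d a' * psi b - psi a * d b' by rewrite -e2; ring.
  apply: (mulIf (x := psi b ^+ 2 * psi b' ^+ 2)); first by rewrite mulf_neq0 ?expf_neq0.
  rewrite mulrCA divfK ?expf_neq0 // mulrA divfK ?expf_neq0 //.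
  have -> : (d a * psi b - psi a * d b) * psi b' ^+ 2 =
     (d a * psi b') * psi b * psi b' - (psi a * psi b') * d b * psi b' by ring.
  rewrite e1 e3.
  have -> : (psi a' * d b + d a' * psi b - psi a * d b') * psi b * psi b' =
     psi a' * d b * psi b * psi b' + d a' * psi b ^+ 2 * psi b' - (psi a * psi b') * (d b' * psi b) by ring.
  by rewrite e1; ring.
exists D; split; last first.
  move=> a; have := @DE a 1; rewrite rmorph1 divr1 d1 mulr0 subr0 mulr1 expr1n divr1.
  by apply; apply: oner_neq0.
split=> x y; have [a [b [b0 ->]]] := hfrac x; have [a' [b' [b0' ->]]] := hfrac y.
  have -> : psi a / psi b + psi a' / psi b' = psi (a * b' + a' * b) / psi (b * b').
    by rewrite rmorphD !rmorphM /=; field; rewrite b0 b0'.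
  rewrite !DE ?rmorphM ?mulf_neq0 // !dD !dM !rmorphD !rmorphM /=.
  by field; rewrite b0 b0'.
have -> : psi a / psi b * (psi a' / psi b') = psi (a * a') / psi (b * b').
  by rewrite !rmorphM /=; field; rewrite b0 b0'.
have bb : psi (b * b') != 0 by rewrite rmorphM mulf_neq0.
rewrite !DE // !dM !rmorphM /=.
by field; rewrite b0 b0'.
Qed.

End Extension.

(* A relation of minimal support, normalized to have a coefficient 1, is
   shortened by applying the derivations to its coefficients, so that these
   are all constants. *)
Lemma constants_descent (S : Type) (delta : S -> F -> F) n (rel : ('I_n -> F) -> Prop) :
  (forall s, is_der (delta s)) ->
  (forall c a, rel c -> rel (fun i => a * c i)) ->
  (forall c s, rel c -> rel (fun i => delta s (c i))) ->
  (forall c, rel c -> (forall i s, delta s (c i) = 0) -> forall i, c i = 0) ->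
  forall c, rel c -> forall i, c i = 0.
Proof.
move=> hd hZ hdel h0 c hc.
have [m] := ubnP #|[pred i | c i != 0]|; elim: m c hc => // m IH c hc hm i.
apply/eqP/negPn/negP => ci0.
pose c1 j := (c i)^-1 * c j.
have r1 : rel c1 by apply: hZ.
have c1i : c1 i = 1 by rewrite /c1 mulVf.
have dc s j : delta s (c1 j) = 0.
  apply: (IH (fun j => delta s (c1 j))); first exact: hdel.
  move: hm; rewrite ltnS; apply: leq_trans; apply: proper_card; apply/properP; split.
    apply/fintype.subsetP => k; rewrite !inE; apply: contraNneq => e.
    by rewrite /c1 e mulr0 der0.
  by exists i; rewrite !inE // c1i der1 // eqxx.
have := h0 _ r1 (fun j s => dc s j) i.
by rewrite c1i => /eqP; rewrite oner_eq0.
Qed.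

(** A family annihilated by no nonzero functional spans F^n, so independent members can be picked
    one at a time. *)
Lemma nonzero_minor (T : Type) n (v : T -> 'I_n -> F) :
  (forall c, (forall t, \sum_i c i * v t i = 0) -> forall i, c i = 0) ->
  exists t : 'I_n -> T, \det (\matrix_(i, j) v (t i) j) != 0.
Proof.
move=> hv; suff H k : (k <= n)%N -> exists t : 'I_k -> T, row_free (\matrix_(i < k, j < n) v (t i) j).
  have [t] := H n (leqnn n); rewrite row_free_unit unitmxE unitfE => h.
  by exists t.
elim: k => [|k IH] hk; first by exists (fun i : 'I_0 => False_rect T (notF (ltn_ord i))); rewrite /row_free flatmx0 mxrank0.
have [t ft] := IH (ltnW hk); set M := (\matrix_(i, j) _) in ft.
have : kermx M^T != 0.
  rewrite -mxrank_eq0 mxrank_ker mxrank_tr subn_eq0 -ltnNge.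
  by rewrite (eqP ft).
case/rowV0Pn => c /sub_kermxP cM c0.
have [t1 ht1] : exists t1, \sum_i c 0 i * v t1 i != 0.
  apply: contrapT => h; move/eqP: c0; apply; apply/rowP => i; rewrite mxE.
  apply: (hv (fun i => c 0 i)) => t1; apply: contrapT => /eqP h1.
  by apply: h; exists t1.
pose t' (i : 'I_k.+1) := if unlift ord_max i is Some j then t j else t1.
exists t'; rewrite -kermx_eq0; apply/rowV0P => a /sub_kermxP haM.
have ha j : \sum_i a 0 i * v (t' i) j = 0.
  have := congr1 (fun B : 'rV_n => B 0 j) haM; rewrite !mxE => e; rewrite -[RHS]e.
  by apply: eq_bigr => i _; rewrite mxE.
have cM' i : \sum_j c 0 j * v (t i) j = 0.
  have := congr1 (fun B : 'rV_k => B 0 i) cM; rewrite !mxE => e; rewrite -[RHS]e.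
  by apply: eq_bigr => j _; rewrite !mxE.
have s0 : \sum_i a 0 i * \sum_j c 0 j * v (t' i) j = 0.
  under eq_bigr => i _ do rewrite mulr_sumr.
  rewrite exchange_big big1 // => j _.
  transitivity (c 0 j * \sum_i a 0 i * v (t' i) j); last by rewrite ha mulr0.
  by rewrite mulr_sumr; apply: eq_bigr => i _; ring.
have am : a 0 ord_max = 0.
  move: s0; rewrite big_ord_recr /= big1 ?add0r => [|i _].
    rewrite /t' unlift_none => /eqP; rewrite mulf_eq0 (negPf ht1) orbF => /eqP //.
  have -> : widen_ord (leqnSn k) i = lift ord_max i by apply/val_inj; rewrite /= /bump leqNgt ltn_ord.
  by rewrite /t' liftK cM' mulr0.
have : (\row_(i < k) a 0 (lift ord_max i)) *m M = 0.
  apply/rowP => j; rewrite !mxE; have := ha j; rewrite big_ord_recr /= am mul0r addr0 => e.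
  rewrite -[RHS]e; apply: eq_bigr => i _; rewrite !mxE.
  have -> : widen_ord (leqnSn k) i = lift ord_max i by apply/val_inj; rewrite /= /bump leqNgt ltn_ord.
  by rewrite /t' liftK.
move/eqP; rewrite mulmx_free_eq0 // => /eqP/rowP h.
apply/rowP => i; rewrite mxE; case: (unliftP ord_max i) => [j|] -> //.
by have := h j; rewrite !mxE.
Qed.

End Derivations.

Section PoissonBracket.
Variables (A : comAlgType CC) (br : A -> A -> A).
Hypothesis hbr : poisson_bracket br.

Lemma brDl x y z : br (x + y) z = br x z + br y z.
Proof. by have [h _ _ _ _] := hbr; have := h 1 x y z; rewrite !scale1r. Qed.
Lemma brDr x y z : br z (x + y) = br z x + br z y.
Proof. by have [_ h _ _ _] := hbr; have := h 1 x y z; rewrite !scale1r. Qed.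
Lemma br0l z : br 0 z = 0.
Proof. by apply: (addrI (br 0 z)); rewrite -brDl !addr0. Qed.
Lemma brZl c x z : br (c *: x) z = c *: br x z.
Proof. by have [h _ _ _ _] := hbr; have := h c x 0 z; rewrite !addr0 br0l addr0. Qed.
Lemma brxx x : br x x = 0. Proof. by case: hbr. Qed.
Lemma br_anti x y : br x y = - br y x.
Proof.
have := brxx (x + y); rewrite brDl !brDr !brxx add0r addr0 => /eqP.
by rewrite addr_eq0 => /eqP.
Qed.
Lemma brMl x y z : br (x * y) z = x * br y z + br x z * y.
Proof. by case: hbr. Qed.
Lemma brMr x y z : br z (x * y) = x * br z y + br z x * y.
Proof. by rewrite br_anti brMl opprD -mulrN -mulNr -!br_anti. Qed.
Lemma br1l z : br 1 z = 0.
Proof.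
apply: (addrI (br 1 z)); rewrite addr0.
by have := brMl 1 1 z; rewrite !mulr1 mul1r => <-.
Qed.
Lemma brCl c z : br c%:A z = 0. Proof. by rewrite brZl br1l scaler0. Qed.

Section Induced.
Variables (P : set A) (F : fieldType) (iota : {rmorphism A -> F}).
Hypotheses (pP : poisson_ideal br P) (hfrac : is_frac_of_quotient P iota).

Lemma hamiltonian_exists b : exists D : F -> F, is_der D /\
  forall a, D (iota a) = iota (br a b).
Proof.
have [h0 hf] := hfrac.
apply: (der_extend hf) => [a a'|a a'|a /h0 Pa].
- by rewrite brDl rmorphD.
- by rewrite brMl rmorphD !rmorphM.
- by apply/h0; case: pP => _; apply.
Qed.

Lemma F_nat_neq0 n : (n.+1%:R : F) != 0.
Proof.
have -> : (n.+1%:R : F) = (iota \o in_alg A) n.+1%:R by rewrite rmorph_nat.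
by rewrite fmorph_eq0 Num.Theory.pnatr_eq0.
Qed.

(** The bracket is extended in one argument by the derivations of [hamiltonian_exists], then in the
    other. Each identity is reduced to [A] one variable at a time, because two derivations that
    agree on the image of [A] are equal. *)
Lemma induced_bracket_exists : exists brF : F -> F -> F,
  induced_bracket br iota brF /\ forall z, is_der (brF z).
Proof.
have [h0 hf] := hfrac.
have [dl hdl] := choice hamiltonian_exists.
have dlD b b' z : dl (b + b') z = dl b z + dl b' z.
  apply: (der_ext hf (D2 := fun z => dl b z + dl b' z)).
  - exact: (hdl _).1.
  - by apply: is_der_add; apply: (hdl _).1.
  - by move=> a; rewrite !(hdl _).2 brDr rmorphD.
have dlM b b' z : dl (b * b') z = iota b * dl b' z + dl b z * iota b'.
  rewrite [dl b z * _]mulrC.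
  apply: (der_ext hf (D2 := fun z => iota b * dl b' z + iota b' * dl b z)).
  - exact: (hdl _).1.
  - by apply: is_der_add; apply: is_der_scale; apply: (hdl _).1.
  - by move=> a; rewrite !(hdl _).2 brMr rmorphD !rmorphM /= [iota b' * _]mulrC.
have dl0 b z : iota b = 0 -> dl b z = 0.
  move=> /h0 Pb; apply: (der_ext hf (D2 := fun=> 0)).
  - exact: (hdl _).1.
  - exact: is_der0.
  - move=> a; rewrite (hdl _).2; apply/h0; rewrite br_anti.
    have [[P0 PD PM] hP] := pP; rewrite -mulN1r; apply: PM; exact: hP.
have he z : exists D : F -> F, is_der D /\ forall b, D (iota b) = dl b z.
  by apply: (der_extend hf (d := fun b => dl b z)) => [b b'|b b'|b]; [exact: dlD|exact: dlM|exact: dl0].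
have [brF hbF] := choice he.
have bD z z' w : brF (z + z') w = brF z w + brF z' w.
  apply: (der_ext hf (D2 := fun w => brF z w + brF z' w)).
  - exact: (hbF _).1.
  - by apply: is_der_add; apply: (hbF _).1.
  - by move=> b; rewrite !(hbF _).2 (hdl _).1.1.
have bM z z' w : brF (z * z') w = z * brF z' w + brF z w * z'.
  rewrite [brF z w * _]mulrC.
  apply: (der_ext hf (D2 := fun w => z * brF z' w + z' * brF z w)).
  - exact: (hbF _).1.
  - by apply: is_der_add; apply: is_der_scale; apply: (hbF _).1.
  - by move=> b; rewrite !(hbF _).2 (hdl _).1.2 [z' * _]mulrC.
have bder w : is_der (fun z => brF z w) by split=> x y.
have bA z b : brF z (iota b) = dl b z by rewrite (hbF _).2.
have biota a b : brF (iota a) (iota b) = iota (br a b) by rewrite bA (hdl _).2.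
have anti z w : brF z w = - brF w z.
  apply: (der_ext hf (D2 := fun w => - brF w z)).
  - exact: (hbF _).1.
  - by apply: is_der_opp; apply: bder.
  move=> b; apply: (der_ext hf (D1 := fun z => brF z (iota b)) (D2 := fun z => - brF (iota b) z)).
  - exact: bder.
  - by apply: is_der_opp; apply: (hbF _).1.
  - by move=> a; rewrite !biota br_anti rmorphN.
exists brF; split=> [|z]; last exact: (hbF _).1.
have bDr z w w' : brF z (w + w') = brF z w + brF z w' by rewrite (hbF _).1.1.
have bMr z w w' : brF z (w * w') = w * brF z w' + brF z w * w' by rewrite (hbF _).1.2.
split=> //.
  move=> x; have /eqP := anti x x; rewrite -addr_eq0 -mulr2n -mulr_natr mulf_eq0.
  by rewrite (negPf (F_nat_neq0 1)) orbF => /eqP.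
(* The Jacobiator is a derivation in its first argument and invariant under cyclic permutations, so
   it vanishes once it does so on [A]. *)
pose J x y z := brF x (brF y z) + brF y (brF z x) + brF z (brF x y).
have Jder y z : is_der (fun x => J x y z).
  rewrite /J; split=> x x'; first by rewrite !(bD, bDr); ring.
  by rewrite !(bM, bMr, bD, bDr) [brF y x]anti [brF y x']anti; ring.
have Jcyc x y z : J x y z = J y z x by rewrite /J; ring.
have J1 a b c : J (iota a) (iota b) (iota c) = 0.
  by rewrite /J !biota -!rmorphD; have [_ _ _ -> _] := hbr; rewrite rmorph0.
have Jz y z : (forall a, J (iota a) y z = 0) -> forall x, J x y z = 0.
  by move=> h x; exact: (der_ext hf (Jder y z) (is_der0 F) h x).
have J2 x b c : J x (iota b) (iota c) = 0 by apply: Jz => a; apply: J1.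
have J3 x y c : J x y (iota c) = 0.
  by rewrite Jcyc; apply: (Jz) => b; rewrite -Jcyc.
move=> x y z; rewrite -/(J x y z) Jcyc Jcyc.
by apply: (Jz) => c; rewrite Jcyc.
Qed.

Lemma algebraic_is_constant z : algebraic_over_C iota z -> exists l : CC, z = iota l%:A.
Proof.
case=> p [p0 rp]; have [rs e] := @closed_field_poly_normal (complex Rdefinitions.R) p.
have l0 : lead_coef p != 0 by rewrite lead_coef_eq0.
have : root (map_poly (iota \o in_alg A) p) z by [].
rewrite [p]e map_polyZ rootZ; last by rewrite fmorph_eq0.
rewrite rmorph_prod /root horner_prod => /eqP.
move/eqP; rewrite prodf_seq_eq0 => /hasP[r _ /=].
by rewrite map_polyXsubC hornerXsubC subr_eq0 => /eqP ->; exists r.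
Qed.

End Induced.
End PoissonBracket.

(** * Norms of prime elements *)

Lemma rev_index (n i : nat) : (i < n)%N -> (n.-1 - (n - i.+1))%N = i /\
  n.-1 = ((n - i.+1) + i)%N /\ (n - i.+1 < n)%N.
Proof. by lia. Qed.

Lemma mulr_perm4 (C : comNzRingType) (a b c d : C) :
  a * (b * c) * d = d * c * (a * b).
Proof. by ring. Qed.

Section NormPrime.
Variables (A : comAlgType CC) (P : set A) (F : fieldType) (iota : {rmorphism A -> F}).
Variables (d : nat) (X : 'I_d -> A).
Hypotheses (pP : prime_ideal P) (hfrac : is_frac_of_quotient P iota).
Hypothesis iX : indep_mod P X.
Hypothesis intX : forall a, integralOver (ev (iota \o in_alg A) (iota \o X)) (iota a).
Local Notation R := {mpoly CC[d]}.
Local Notation phi := (ev (iota \o in_alg A) (iota \o X)).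
Local Notation evA := (ev (in_alg A)).

(** The polynomial on the left is X^n q(s / X), with n the degree of [q]: it passes from an equation
    for f to one for e = s / f. *)
Lemma horner_rev_poly (q : {poly R}) (s : R) (e f : F) : f * e = phi s ->
  (map_poly phi (\poly_(i < size q) (q`_((size q).-1 - i) * s ^+ ((size q).-1 - i)))).[e] =
  e ^+ (size q).-1 * (map_poly phi q).[f].
Proof.
move=> hs.
rewrite (@horner_coef_wide _ (size q)); last by rewrite (leq_trans (size_poly _ _)) ?size_poly.
rewrite (@horner_coef_wide _ (size q) (map_poly phi q)); last exact: size_poly.
rewrite mulr_sumr (reindex_inj rev_ord_inj) /=; apply: eq_bigr => i _.
have hi := ltn_ord i.
have [e1 [e2 e3]] := rev_index hi.
rewrite !coef_map /= coef_poly.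
rewrite e3 e1 [in RHS]e2 rmorphM rmorphXn /= -hs exprMn exprD; exact: mulr_perm4.
Qed.

(* If [s] is divisible by [f] in the integral closure of [R], then a power of
   [s] is divisible in [R] by the norm [N] of [f]. *)
Lemma norm_prime f : ~ P f -> exists N : R, [/\ N != 0,
   (exists b, P (evA X N - b * f)) &
   forall g, prime_elt g -> dvdr g N -> exists Q, [/\ prime_ideal Q, P `<=` Q, Q f, Q (evA X g)
     & forall b, Q (evA X b) -> dvdr g b]].
Proof.
move=> nPf; have [h0 _] := hfrac.
have phii := phi_injective hfrac iX.
have [q [mq rq hq]] := integral_minimal_poly (@ufd_mpoly _ d) phii (intX f).
have f0 : iota f != 0 by apply/eqP => /h0.
have sq0 : (0 < size q)%N by rewrite size_poly_gt0 monic_neq0.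
have N0 : q`_0 != 0.
  elim/poly_ind: q mq rq hq {sq0} => [|q r _] mq rq hq; first by have := monic_neq0 mq; rewrite eqxx.
  rewrite coefD coefMX coefC /= add0r; apply: contraTneq mq => r0; move: rq hq; rewrite r0 addr0.
  rewrite rmorphM /= map_polyX rootM rootX (negPf f0) orbF => rq /(_ _ rq) [t e].
  have [q0|q0] := eqVneq q 0; first by rewrite q0 mul0r monicE lead_coef0 eq_sym oner_eq0.
  have t0 : t != 0 by apply: contraNneq q0 => t0; rewrite e t0 mul0r.
  have qX : q * 'X != 0 by rewrite mulf_neq0 ?polyX_eq0.
  by have := size_le_mull t0 qX; rewrite -e size_mulX // ltnn.
have hN : exists b, P (evA X q`_0 - b * f).
  elim/poly_ind: q mq rq hq {sq0 N0} => [|q r _] mq rq hq; first by have := monic_neq0 mq; rewrite eqxx.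
  rewrite coefD coefMX coefC /= add0r.
  exists (- (map_poly (evA X) q).[f]).
  apply/h0; rewrite rmorphB rmorphM rmorphN /= -horner_iota ev_comp.
  move: (rootP rq); rewrite rmorphD rmorphM /= map_polyX map_polyC /=.
  by rewrite hornerD hornerM hornerX hornerC mulNr opprK addrC.
exists q`_0; split=> // g pg gN.
have key s e : iota e * iota f = phi s -> s != 0 -> dvdr g s.
  move=> hs s0.
  have phis0 : phi s != 0 by rewrite (phi_eq0 hfrac iX).
  have [qe [mqe rqe hqe]] := integral_minimal_poly (@ufd_mpoly _ d) phii (intX e).
  (* Reversal sends the minimal polynomial of f to an equation for e, and conversely, so both have
     the same degree n and [rv q] is a constant times [qe]. The leading coefficient shows the
     constant to be the norm, and the constant terms then exhibit s^n as a multiple of it. *)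
  pose rv (q : {poly R}) := \poly_(i < size q) (q`_((size q).-1 - i) * s ^+ ((size q).-1 - i)).
  have rv0 (p : {poly R}) : p \is monic -> rv p != 0 /\ (size (rv p) <= size p)%N.
    move=> mp; split; last exact: size_poly.
    apply/eqP => /(congr1 (fun p : {poly R} => p`_0)); rewrite coef0 coef_poly.
    rewrite size_poly_gt0 monic_neq0 // subn0 -lead_coefE (monicP mp) mul1r => /eqP.
    by rewrite expf_eq0 (negPf s0) andbF.
  have [|t et] := hqe (rv q).
    by rewrite /root (@horner_rev_poly q s (iota e) (iota f)) ?(rootP rq) ?mulr0 // mulrC.
  have [|t' et'] := hq (rv qe).
    by rewrite /root (@horner_rev_poly qe s (iota f) (iota e)) ?(rootP rqe) ?mulr0.
  have [rq0 srq] := rv0 _ mq; have [rqe0 srqe] := rv0 _ mqe.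
  have t0 : t != 0 by apply: contraNneq rq0 => z; rewrite et z mul0r.
  have t0' : t' != 0 by apply: contraNneq rqe0 => z; rewrite et' z mul0r.
  have l1 : (size qe <= size q)%N.
    by apply: leq_trans srq; rewrite et; apply: size_le_mull => //; apply: monic_neq0.
  have l2 : (size q <= size qe)%N.
    by apply: leq_trans srqe; rewrite et'; apply: size_le_mull => //; apply: monic_neq0.
  have sqe : size qe = size q by apply/eqP; rewrite eqn_leq l1.
  have st : size t = 1%N.
    have sz : size (rv q) = (size t + size qe).-1 by rewrite et size_mul // monic_neq0.
    have sr : size (rv q) = size qe.
      apply/eqP; rewrite eqn_leq sqe srq /= -sqe [X in (_ <= X)%N]sz.
      by move: t0; rewrite -size_poly_gt0; case: (size t) => // n _; rewrite addSn leq_addl.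
    have h1 : (0 < size t)%N by rewrite size_poly_gt0.
    have h2 : (0 < size qe)%N by rewrite size_poly_gt0 monic_neq0.
    exact: (pred_add_le h1 h2 (leqnn _) (etrans (esym sr) sz)).
  have /size_poly1P[r r0 er] : size t == 1%N by apply/eqP.
  have eN : q`_0 = r.
    have := congr1 (fun p : {poly R} => p`_(size q).-1) et.
    rewrite /= coef_poly er coefCM -sqe -lead_coefE (monicP mqe) mulr1 sqe subnn expr0 mulr1.
    by rewrite prednK // leqnn.
  have := congr1 (fun p : {poly R} => p`_0) et.
  rewrite /= coef_poly sq0 subn0 -lead_coefE (monicP mq) mul1r er coefCM -eN => es.
  apply: (@prime_dvdX _ g s (size q).-1) => //; rewrite es; exact: dvdr_mulr.
have [P0 PD PM] : ideal P by case: pP.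
pose I x := exists e, P (x - e * f).
(* By [key], an element of R lying in the ideal generated by [P] and [f] is divisible by [g]; so a
   prime over that ideal can avoid [T], and it contracts into (g). *)
pose T x := exists2 s, ~ dvdr g s & x = evA X s.
have [||||Q [pQ IQ dQ]] := @krull_prime A I T.
- split.
  + by exists 0; rewrite mul0r subrr.
  + move=> x y [e he] [e' he']; exists (e + e').
    have -> : x + y - (e + e') * f = (x - e * f) + (y - e' * f) by ring.
    exact: PD.
  + move=> z x [e he]; exists (z * e).
    have -> : z * x - z * e * f = z * (x - e * f) by ring.
    exact: PM.
- exists 1; last by rewrite rmorph1.
  by apply: prime_ndvd1.
- move=> x y [s hs ->] [s' hs' ->]; exists (s * s'); last by rewrite rmorphM.
  by case/(prime_dvdM pg).
- move=> x [e he] [s ns ex]; apply: ns; move: he; rewrite ex => /h0 /eqP.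
  rewrite rmorphB rmorphM /= ev_comp subr_eq0 => /eqP he.
  have [->|s0] := eqVneq s 0; first exact: dvdr0.
  by apply: (key s e).
have [[Q0 QD QM] Q1 QP] := pQ.
have PQ : P `<=` Q by move=> x Px; apply: IQ; exists 0; rewrite mul0r subr0.
have Qf : Q f by apply: IQ; exists 1; rewrite mul1r subrr.
have hQ b : Q (evA X b) -> dvdr g b.
  by move=> Qb; apply: contrapT => nb; apply: (dQ _ Qb); exists b.
exists Q; split=> //.
have [b hb] := hN.
have : Q (evA X q`_0).
  by rewrite -[evA X _](subrK (b * f)); apply: (QD); [exact: PQ|exact: QM].
move: (q`_0) N0; apply: (ufd_ind (@ufd_mpoly _ d)) => [u uu Qu|g' r pg' r0 IH].
  case: Q1; have := QM (evA X u^-1) _ Qu.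
  by rewrite -rmorphM mulVr // rmorph1.
rewrite rmorphM => /QP[h|/IH//].
have [u uu e] := prime_assoc pg pg' (hQ _ h).
have := QM (evA X u^-1) _ h.
by rewrite e -rmorphM mulrA mulVr // mul1r.
Qed.

End NormPrime.

(** * Primitive and rational ideals *)

Section Implications.
Variables (A : comAlgType CC) (br : A -> A -> A).
Hypotheses (hbr : poisson_bracket br) (haff : complex_affine A).
Variable P : set A.
Hypothesis hP : poisson_prime br P.

Let pP : prime_ideal P := hP.1.
Let iP : poisson_ideal br P := hP.2.

Lemma ideal_opp (I : set A) x : ideal I -> I x -> I (- x).
Proof. by move=> [_ _ IM] Ix; rewrite -mulN1r; apply: IM. Qed.

Lemma ideal_sub (I : set A) x y : ideal I -> I x -> I y -> I (x - y).
Proof. by move=> iI Ix Iy; have [_ ID _] := iI; apply: ID => //; apply: ideal_opp. Qed.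

Lemma maximal_prime (M : set A) : maximal_ideal M -> prime_ideal M.
Proof.
move=> [iM M1 mM]; split=> // x y Mxy; have [M0 MD MM] := iM.
have [|nMx] := EM (M x); first by left.
right; pose J z := exists m a, M m /\ z = m + a * x.
have iJ : ideal J.
  split.
  - by exists 0, 0; rewrite mul0r addr0.
  - move=> u v [q [a [hq ->]]] [q' [a' [hq' ->]]]; exists (q + q'), (a + a').
    by split; [exact: MD|ring].
  - move=> b u [q [a [hq ->]]]; exists (b * q), (b * a).
    by split; [exact: MM|ring].
have MJ : M `<=` J by move=> m Mm; exists m, 0; rewrite mul0r addr0.
case: (mM J iJ MJ) => [e|[m [a [Mm e]]]].
  by case: nMx; rewrite -e; exists 0, 1; rewrite add0r mul1r.
have -> : y = y * m + a * (x * y) by rewrite -[LHS]mulr1 e; ring.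
by apply: MD; apply: MM.
Qed.

Lemma point_maximal (chi : {rmorphism A -> CC}) : (forall a, chi a%:A = a) ->
  maximal_ideal [set a | chi a = 0].
Proof.
move=> hchi; split.
- split=> [|x y /= hx hy|a x /= hx]; first exact: rmorph0.
    by rewrite rmorphD hx hy addr0.
  by rewrite rmorphM hx mulr0.
- by rewrite /= rmorph1 => /eqP; rewrite oner_eq0.
move=> J iJ sJ; have [|H] := EM (J `<=` [set a | chi a = 0]).
  by move=> h; left; apply/seteqP.
right; have [a [Ja ca]] : exists a, J a /\ chi a != 0.
  apply: contrapT => h; apply: H => a Ja /=; apply/eqP; apply: contrapT => /negP ca.
  by apply: h; exists a.
have [J0 JD JM] := iJ.
have -> : 1 = ((chi a)^-1)%:A * (a - (a - (chi a)%:A)).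
  by rewrite opprB addrC subrK -(rmorphM (in_alg A)) /= mulVf // scale1r.
apply: (JM); apply: ideal_sub => //; apply: sJ => /=.
by rewrite rmorphB hchi subrr.
Qed.

Lemma generic_point_of (g : nat -> A) (Q : set A) : prime_ideal Q ->
  (forall i, ~ Q (g i)) ->
  exists chi : {rmorphism A -> CC}, [/\ forall a, chi a%:A = a,
    forall a, Q a -> chi a = 0 & forall i, chi (g i) != 0].
Proof.
move=> pQ hg; have [F [iota hf]] := frac_of_quotient_exists pQ.
have [d [X [iX intX]]] := noether_quotient haff hf.
exact: (generic_point haff hf iX intX).
Qed.

Lemma constant_algebraic (F : fieldType) (iota : {rmorphism A -> F}) l :
  algebraic_over_C iota (iota l%:A).
Proof.
exists ('X - l%:P); split; first by rewrite polyXsubC_eq0.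
have -> : map_poly (fun c => iota c%:A) ('X - l%:P) = 'X - (iota l%:A)%:P.
  apply/polyP => i; rewrite coef_map_id0 ?scale0r ?rmorph0 // !coefB !coefX !coefC.
  by case: i => [|[|i]] /=; rewrite ?sub0r ?subr0 ?scaleNr ?scale1r ?scale0r ?rmorphN ?rmorph1 ?rmorph0.
by rewrite root_XsubC.
Qed.

Lemma rational_of_primitive : poisson_primitive br P -> poisson_rational br P.
Proof.
move=> [M [mM _ PM hM]] F iota brF hfrac hbF z hz.
have pM := maximal_prime mM; have [iM M1 mM2] := mM.
(* The weak Nullstellensatz: a point of the variety of [M] gives a character, whose kernel is then
   [M]. *)
have [chi [hchi chiM _]] := @generic_point_of (fun=> 1) M pM (fun=> M1).
have Mchi a : chi a = 0 -> M a.
  have [ichi _ _] := point_maximal hchi.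
  case: (mM2 _ ichi) => [x /chiM //|e|]; last by rewrite /= rmorph1 => /eqP; rewrite oner_eq0.
  by move=> h; rewrite -e.
have [h0 hf] := hfrac; have [bD bx _ bM bi] := hbF.
have der w : is_der (fun z => brF z w) by split=> x y.
(* The denominators of [z]. They form a Poisson ideal because [z] is a Casimir; inside [M] it would
   lie in [P], which is absurd. So [z] has a value [l] at the point. *)
pose I b := exists a, iota b * z = iota a.
have [b [[a hb] nMb]] : exists b, I b /\ ~ M b.
  apply: contrapT => H; have pI : poisson_ideal br I.
    split; first split.
    - by exists 0; rewrite rmorph0 mul0r.
    - by move=> x y [a ha] [a' ha']; exists (a + a'); rewrite !rmorphD mulrDl ha ha'.
    - by move=> c x [a ha]; exists (c * a); rewrite !rmorphM -mulrA ha.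
    move=> x c [a ha]; exists (br a c); rewrite -!bi -ha.
    by rewrite bM hz mulr0 add0r.
  have IP : I `<=` P.
    apply: hM => // x Ix; apply: contrapT => nx; apply: H; by exists x.
  have [a [b [b0 e]]] := hf z.
  have : P b by apply: IP; exists a; rewrite e mulrC divfK.
  by move/h0/eqP; apply/negP.
pose l : CC := chi a / chi b.
have cb : chi b != 0 by apply/eqP => /Mchi.
have b0 : iota b != 0 by apply/eqP => /h0 /PM.
pose zl := z - iota l%:A.
have hzl w : brF zl (iota w) = 0.
  by rewrite /zl (derB (der _)) hz sub0r bi (brCl hbr) rmorph0 oppr0.
pose J c := exists s u, ~ M s /\ iota s * iota c = zl * iota u.
have [P0 PD PM'] : ideal P by case: pP.
have [_ _ MM] := pM.
have pJ : poisson_ideal br J.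
  split; first split.
  - by exists 1, 0; rewrite !rmorph0 !mulr0.
  - move=> x y [s [u [ns hs]]] [s' [u' [ns' hs']]]; exists (s * s'), (s' * u + s * u').
    split; first by case/MM.
    by rewrite !rmorphD !rmorphM mulrDr mulrAC hs -[_ * _ * iota y]mulrA hs'; ring.
  - move=> c x [s [u [ns hs]]]; exists s, (c * u); split=> //.
    by rewrite !rmorphM mulrCA hs; ring.
  move=> c w [s [u [ns hs]]]; exists (s * s), (s * br u w - u * br s w).
  split; first by case/MM.
  have : brF (iota s * iota c) (iota w) = brF (zl * iota u) (iota w) by rewrite hs.
  rewrite !bM hzl mul0r addr0 !bi => e.
  rewrite rmorphB !rmorphM.
  have -> : iota s * iota s * iota (br c w) = iota s * (iota s * iota (br c w) + iota (br s w) * iota c)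
     - iota (br s w) * (iota s * iota c) by ring.
  by rewrite e hs; ring.
have JM : J `<=` M.
  move=> c [s [u [ns hs]]]; apply: (Mchi).
  have : P (s * b * c - (a - l%:A * b) * u).
    apply/h0; rewrite rmorphB !rmorphM rmorphB rmorphM /= -hb.
    by rewrite mulrAC hs /zl; ring.
  move/PM/chiM/eqP; rewrite rmorphB !rmorphM rmorphB rmorphM /= hchi /l divfK //.
  rewrite subrr mul0r subr0 mulf_eq0 => /orP[|/eqP //].
  by rewrite mulf_eq0 (negPf cb) orbF => /eqP /Mchi.
have : P (a - l%:A * b).
  apply: (hM J) => //; exists 1, b; split=> //.
  by rewrite rmorph1 mul1r rmorphB rmorphM /= -hb /zl; ring.
move/h0 => e.
have {}e : z = iota l%:A.
  apply/eqP; rewrite -subr_eq0; apply/eqP/(mulfI b0).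
  by rewrite mulr0 mulrBr hb -[RHS]e rmorphB rmorphM [_ * iota b]mulrC.
by rewrite e; apply: constant_algebraic.
Qed.

Definition brword (w : seq A) (a : A) : A := foldr (fun b x => br x b) a w.

Lemma brwordD w a b : brword w (a + b) = brword w a + brword w b.
Proof. by elim: w => //= c w ->; rewrite brDl. Qed.
Lemma brwordZ w k a : brword w (k *: a) = k *: brword w a.
Proof. by elim: w => //= c w ->; rewrite brZl. Qed.
Lemma brword0 w : brword w 0 = 0.
Proof. by elim: w => //= c w ->; rewrite br0l. Qed.
Lemma brword_sum w (I : Type) (r : seq I) (f : I -> A) :
  brword w (\sum_(i <- r) f i) = \sum_(i <- r) brword w (f i).
Proof. by elim: r => [|i r IH]; rewrite ?big_nil ?brword0 // !big_cons brwordD IH. Qed.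
Lemma brword_ideal w a (I : set A) : poisson_ideal br I -> I a -> I (brword w a).
Proof. by move=> [_ hI] Ia; elim: w => //= c w; apply: hI. Qed.

Definition lin_indep_mod n (f : 'I_n -> A) :=
  forall c : 'I_n -> CC, P (\sum_i c i *: f i) -> forall i, c i = 0.
Definition in_span_mod n (f : 'I_n -> A) a :=
  exists c : 'I_n -> CC, P (a - \sum_i c i *: f i).

Lemma basis_mod (s : seq A) : exists n (f : 'I_n -> A), lin_indep_mod f /\
  forall a, a \in s -> in_span_mod f a.
Proof.
have [[P0 PD PM] _ _] := pP; have ideP : ideal P by [].
have PZ k a : P a -> P (k *: a) by move=> Pa; rewrite -mulr_algl; apply: PM.
elim: s => [|a s [n [f [fi fs]]]].
  by exists 0%N, (fun=> 0); split=> // c _; case.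
have [sa|nsa] := EM (in_span_mod f a).
  by exists n, f; split=> // b; rewrite in_cons => /orP[/eqP -> //|/fs].
have wl (i : 'I_n) : widen_ord (leqnSn n) i = lift ord_max i.
  by apply/val_inj; rewrite /= /bump leqNgt ltn_ord.
have sumE (c : 'I_n.+1 -> CC) : \sum_i c i *: vsnoc f a i =
    \sum_i c (lift ord_max i) *: f i + c ord_max *: a.
  rewrite big_ord_recr /=; congr (_ + _).
    by apply: eq_bigr => i _; rewrite wl /vsnoc liftK.
  by rewrite /vsnoc unlift_none.
exists n.+1, (vsnoc f a); split.
  move=> c; rewrite sumE => h.
  have cm : c ord_max = 0.
    apply: contrapT => /eqP cm; apply: nsa.
    exists (fun i => - (c ord_max)^-1 * c (lift ord_max i)).
    have -> : a - \sum_i (- (c ord_max)^-1 * c (lift ord_max i)) *: f i =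
      (c ord_max)^-1 *: (\sum_i c (lift ord_max i) *: f i + c ord_max *: a).
      rewrite scalerDr scalerA mulVf // scale1r addrC; congr (_ + _).
      by rewrite scaler_sumr -sumrN; apply: eq_bigr => i _; rewrite scalerA mulNr scaleNr opprK.
    exact: PZ.
  rewrite cm scale0r addr0 in h; have := fi _ h => h' i.
  by case: (unliftP ord_max i) => [j|] ->.
move=> b; rewrite in_cons => /orP[/eqP ->|/fs [c hc]].
  exists (fun i => if i == ord_max then 1 else 0); rewrite sumE eqxx scale1r big1.
    by rewrite add0r subrr.
  by move=> i _; rewrite eq_sym (negPf (neq_lift _ _)) scale0r.
exists (fun i => if unlift ord_max i is Some j then c j else 0); rewrite sumE unlift_none scale0r addr0.
by under eq_bigr => i _ do rewrite liftK.
Qed.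

Definition in_lin_span (s : seq A) (u : A) := forall V : set A, V 0 ->
  (forall x y, V x -> V y -> V (x + y)) -> (forall l x, V x -> V (l *: x)) ->
  (forall x, x \in s -> V x) -> V u.

(** By rationality, an F-linear relation among basis vectors modulo [P] that persists under all
    iterated brackets descends to one with complex coefficients, so there is none, and some minor
    [g] is not in [P]. Where [g] is nonzero, the vanishing of all iterated brackets of [u] is a
    linear system with only the zero solution. *)
Lemma wronskian_witness (s : seq A) : poisson_rational br P ->
  exists g, ~ P g /\ forall chi : {rmorphism A -> CC}, (forall a, chi a%:A = a) ->
    (forall a, P a -> chi a = 0) -> chi g != 0 ->
    forall u, in_lin_span s u -> (forall w, chi (brword w u) = 0) -> P u.
Proof.
move=> hrat; have [[P0 PD PM] P1 PP] := pP; have ideP : ideal P by [].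
have [F [iota hfrac]] := frac_of_quotient_exists pP; have [h0 hf] := hfrac.
have [brF [hbF derR]] := induced_bracket_exists hbr iP hfrac.
have [bD bx _ bM bi] := hbF.
have der w : is_der (fun z => brF z w) by split=> x y.
have hconst z : (forall b, brF z (iota b) = 0) -> exists l : CC, z = iota l%:A.
  move=> hz; apply: (algebraic_is_constant (iota := iota)).
  apply: (hrat _ _ _ hfrac hbF) => w.
  exact: (der_ext hf (derR z) (is_der0 F) hz w).
pose DF (w : seq A) z : F := foldr (fun b x => brF x (iota b)) z w.
have DFi w a : DF w (iota a) = iota (brword w a).
  by elim: w => //= b w ->; rewrite bi.
have [n [f [fi fs]]] := basis_mod s.
have [|w hw] := @nonzero_minor F (seq A) n (fun w i => DF w (iota (f i))).
  apply: (@constants_descent F A (fun b z => brF z (iota b)) n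
    (fun c => forall w, \sum_i c i * DF w (iota (f i)) = 0)).
  - by move=> b.
  - move=> c a hc w; transitivity (a * \sum_i c i * DF w (iota (f i))); last first.
      by rewrite hc mulr0.
    by rewrite mulr_sumr; apply: eq_bigr => i _; rewrite mulrA.
  - move=> c b hc w; have := congr1 (fun z => brF z (iota b)) (hc w).
    rewrite (der0 (der _)) (der_sum (der _)).
    under eq_bigr => i _ do rewrite bM.
    rewrite big_split /=.
    have -> : \sum_i c i * brF (DF w (iota (f i))) (iota b) = 0 by exact: (hc (b :: w)).
    by rewrite add0r.
  move=> c hc hcb; have hl i : exists l : CC, c i = iota l%:A by apply: hconst => b; apply: hcb.
  have [l el] := choice hl.
  have : P (\sum_i l i *: f i).
    apply/h0; rewrite rmorph_sum /=; transitivity (\sum_i c i * DF [::] (iota (f i))) => //.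
    by apply: eq_bigr => i _; rewrite -[l i *: f i]mulr_algl rmorphM -el.
  by move/fi => z i; rewrite el z scale0r rmorph0.
pose W := \matrix_(i, j) brword (w i) (f j).
exists (\det W); split.
  move=> /h0 /eqP; rewrite -det_map_mx; apply/negP; move: hw.
  by congr (\det _ != 0); apply/matrixP => i j; rewrite !mxE DFi.
move=> chi hchi chiP; rewrite -det_map_mx => hdet u su hu.
have [c hc] : in_span_mod f u.
  apply: (su) => //.
  - by exists (fun=> 0); under eq_bigr => i _ do rewrite scale0r; rewrite big1 ?subr0.
  - move=> a b [c hc] [c' hc']; exists (fun i => c i + c' i).
    under eq_bigr => i _ do rewrite scalerDl.
    by rewrite big_split /= opprD addrACA; apply: PD.
  move=> l a [c hc]; exists (fun i => l * c i).
  under eq_bigr => i _ do rewrite -scalerA.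
  by rewrite -scaler_sumr -scalerBr -mulr_algl; apply: PM.
have hv : map_mx chi W *m (\col_i c i) = 0.
  apply/matrixP => i j; rewrite !mxE.
  have /chiP := brword_ideal (w i) iP hc.
  rewrite brwordD -scaleN1r brwordZ scaleN1r rmorphB (hu (w i)) sub0r => /eqP.
  rewrite oppr_eq0 brword_sum rmorph_sum => /eqP h; refine (etrans _ h).
  apply: eq_bigr => l _ /=; rewrite !mxE brwordZ -mulr_algl rmorphM /= hchi.
  by rewrite mulrC.
have c0 i : c i = 0.
  have W1 : map_mx chi W \in unitmx by rewrite unitmxE unitfE.
  have := congr1 (mulmx (invmx (map_mx chi W))) hv.
  rewrite mulKmx // mulmx0 => /matrixP /(_ i ord0).
  by rewrite !mxE.
by move: hc; rewrite big1 ?subr0 // => i _; rewrite c0 scale0r.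
Qed.

(** Countably many finite-dimensional spaces, spanned by monomials with exponents at most [k],
    exhaust [A], and the point avoids the witness of each. An element of a Poisson ideal inside the
    kernel of the point has all its iterated brackets vanishing there. *)
Lemma primitive_of_rational : poisson_rational br P -> poisson_primitive br P.
Proof.
move=> hrat; have [m [z hz]] := affine_generators haff.
pose mon k (b : {ffun 'I_m -> 'I_k.+1}) := ev (in_alg A) z 'X_[[multinom (b i : nat) | i < m]].
have [g hg] := choice (fun k => wronskian_witness [seq mon k b | b : {ffun 'I_m -> 'I_k.+1}] hrat).
have [chi [hchi chiP chig]] := generic_point_of pP (fun k => (hg k).1).
exists [set a | chi a = 0]; split=> //; first exact: point_maximal.
move=> I pI IM u Iu.
have [p ep] := hz u; apply: ((hg (msize p)).2 chi hchi chiP (chig _)); last first.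
  by move=> w; apply: IM; apply: brword_ideal.
move=> V V0 VD VZ Vs; rewrite ep [p]mpolyE rmorph_sum big_seq.
apply: (big_ind V) => // mm hm.
rewrite -mul_mpolyC rmorphM /= evC mulr_algl; apply: (VZ); apply: (Vs).
have hlt i : (mm i < (msize p).+1)%N.
  rewrite ltnS; apply: ltnW; apply: leq_ltn_trans (msize_mdeg_lt hm).
  by rewrite mdegE (bigD1 i) //= leq_addr.
apply/fintype.imageP; exists [ffun i => Ordinal (hlt i)] => //.
by rewrite /mon; congr (ev _ _ 'X_[_]); apply/mnmP => i; rewrite mnmE ffunE.
Qed.

Lemma brBl x y z : br (x - y) z = br x z - br y z.
Proof. by rewrite (brDl hbr); congr (_ + _); rewrite -scaleN1r (brZl hbr) scaleN1r. Qed.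

Lemma brX u w k : br (u ^+ k.+1) w = k.+1%:R * u ^+ k * br u w.
Proof.
elim: k => [|k IH]; first by rewrite expr1 expr0 mulr1 mul1r.
by rewrite exprS (brMl hbr) IH [k.+2%:R]mulrS [u ^+ k.+1]exprS; ring.
Qed.

Lemma height_uniq (Q : set A) n m : height Q n -> height Q m -> n = m.
Proof.
move=> [[c [hc ec]] hm] [[c' [hc' ec']] hm'].
by apply/eqP; rewrite eqn_leq (hm' _ _ hc ec) (hm _ _ hc' ec').
Qed.

(* [a / b] is a Casimir of the bracket on [Frac (A / P)]. *)
Lemma casimir_poisson_prime (a b : A) (l : CC) (Q : set A) :
  (forall w, P (br a w * b - a * br b w)) -> adjacent P Q ->
  ~ P (a - l%:A * b) -> Q (a - l%:A * b) -> ~ Q b -> poisson_prime br Q.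
Proof.
set f := a - _ => hab hadj nPf Qf nQb; have [_ pQ [PQ _] _] := hadj.
have [[Q0 QD QM] Q1 QP] := pQ; have [[P0 PD PM] _ _] := pP; have idP : ideal P by [].
(* The ideal generated by [P] and [f], localized at [Q]. It is stable under brackets because b {f,
   w} = {b, w} f modulo [P] and b is a unit at [Q]. *)
pose I c := exists s e, ~ Q s /\ P (s * c - e * f).
have IQ c : I c -> Q c.
  move=> [s [e [ns h]]]; have : Q (s * c).
    by rewrite -[s * c](subrK (e * f)); apply: QD; [exact: PQ|exact: QM].
  by case/QP.
have Ibr c w : I c -> I (br c w).
  move=> [s [e [ns h]]]; exists (s * s * b), (s * b * br e w + s * e * br b w - br s w * b * e).
  split; first by case/QP => [/QP[]|].
  have h1 := iP.2 _ w h; have h2 : P (b * br f w - br b w * f).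
    have -> : b * br f w - br b w * f = br a w * b - a * br b w.
      by rewrite /f brBl (brMl hbr) (brCl hbr); ring.
    exact: hab.
  have -> : s * s * b * br c w - (s * b * br e w + s * e * br b w - br s w * b * e) * f =
     s * b * br (s * c - e * f) w - br s w * b * (s * c - e * f) + s * e * (b * br f w - br b w * f).
    by rewrite brBl !(brMl hbr); ring.
  by apply: PD; [apply: ideal_sub|] => //; apply: PM.
split=> //; split; first by split.
move=> u w Qu; apply: contrapT => nQ.
have [k [h [e [nQh he]]]] := adjacent_minimal hadj Qf nPf Qu.
have : I (u ^+ k) by exists h, e; split=> //; rewrite mulrC.
(* If u^(k+1) is in [I], its bracket with w puts (k+1) u^k {u, w} there; were {u, w} outside [Q],
   the exponent could be lowered until 1 lies in [Q]. *)
elim: k {he} => [|k IH]; first by rewrite expr0 => /IQ.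
move=> /(Ibr _ w) [s [e' [ns he]]]; apply: IH.
exists (s * k.+1%:R * br u w), e'; split.
  case/QP => // /QP[] //; rewrite -scaler_nat => /(QM ((k.+1%:R : CC)^-1)%:A).
  rewrite mulr_algl scalerA mulVf ?scale1r // Num.Theory.pnatr_eq0 //.
have -> : s * k.+1%:R * br u w * u ^+ k = s * br (u ^+ k.+1) w by rewrite brX; ring.
by [].
Qed.

Lemma prime_zero_factor d (X : 'I_d -> A) (chi : {rmorphism A -> CC}) (N : {mpoly CC[d]}) :
  N != 0 -> chi (ev (in_alg A) X N) = 0 ->
  exists g, [/\ prime_elt g, dvdr g N & chi (ev (in_alg A) X g) = 0].
Proof.
move: N; apply: (ufd_ind (@ufd_mpoly _ d)) => [u uu hu|g r pg r0 IH].
  have : chi (ev (in_alg A) X (u^-1 * u)) = 0 by rewrite !rmorphM hu mulr0.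
  by rewrite mulVr // !rmorph1 => /eqP; rewrite oner_eq0.
rewrite !rmorphM => /eqP; rewrite mulf_eq0 => /orP[/eqP h|/eqP/IH [g' [pg' d' h]]].
  by exists g; split=> //; exists r; rewrite mulrC.
by exists g'; split=> //; apply: dvdr_mull.
Qed.

Lemma rational_of_finite : next_height_finite br P -> poisson_rational br P.
Proof.
move=> [n [hn fin]] F iota brF hfrac hbF z hz; apply: contrapT => nalg.
have [h0 hf] := hfrac; have [bD bx _ bM bi] := hbF.
have [[P0 PD PM] P1 PP] := pP; have idP : ideal P by [].
have [a [b [b0 ez]]] := hf z.
have hb : iota b * z = iota a by rewrite ez mulrC divfK.
have nPb : ~ P b by move=> /h0 e; rewrite e eqxx in b0.
have hab w : P (br a w * b - a * br b w).
  apply/h0; rewrite rmorphB !rmorphM -!bi -hb bM hz; ring.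
have nPf l : ~ P (a - l%:A * b).
  move=> /h0 /eqP; rewrite rmorphB rmorphM subr_eq0 -hb mulrC => /eqP e.
  by apply: nalg; rewrite (mulIf b0 e); apply: constant_algebraic.
have [d [X [iX intX]]] := noether_quotient haff hfrac.
have [be [b' [be0 hbe]]] := nonzero_multiple hfrac iX intX nPb.
have p0 := zero_prime haff; have [t0 ht0] := trd_exists haff p0.
have tP := trd_noether hfrac iX intX.
have en := height_uniq hn (height_trd haff pP ht0 tP).
have many (s : seq CC) : exists l Q, [/\ l \notin s, poisson_prime br Q /\ P `<=` Q /\ height Q n.+1,
    Q (a - l%:A * b) & ~ Q b].
  (* Avoiding [b] gives a / b a value at the point, avoiding the a - l b for listed l makes this
     value new, and avoiding the multiple [be] of [b] in R will keep [b] out of the prime found. *)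
  pose L := b :: ev (in_alg A) X be :: [seq a - l%:A * b | l <- s].
  have [i|chi [hchi chiP chiL]] := @generic_point_of (nth b L) P pP.
    have [hi|hi] := ltnP i (size L); last by rewrite nth_default.
    have := mem_nth b hi; rewrite !in_cons => /or3P[/eqP -> //|/eqP ->|/mapP[l _ ->] //].
    by move=> /iX e; rewrite e eqxx in be0.
  have {}chiL x : x \in L -> chi x != 0 by move=> /(nth_index b) <-.
  have cb : chi b != 0 by apply: chiL; rewrite mem_head.
  have cbe : chi (ev (in_alg A) X be) != 0 by apply: chiL; rewrite !in_cons eqxx orbT.
  pose l := chi a / chi b.
  have cf : chi (a - l%:A * b) = 0 by rewrite rmorphB rmorphM /= hchi divfK // subrr.
  have [N [N0 [e he] hN]] := norm_prime pP hfrac iX intX (nPf l).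
  have cN : chi (ev (in_alg A) X N) = 0.
    by have := chiP _ he; rewrite rmorphB rmorphM cf mulr0 subr0.
  have [g [pg gN cg]] := prime_zero_factor N0 cN.
  have [Q [pQ PQ Qf Qg hQ]] := hN g pg gN; have [[Q0 QD QM] Q1 QP] := pQ.
  (* [Q] contracts into (g), and g vanishes at the point while [be] does not. *)
  have nQb : ~ Q b.
    move=> Qb; have : Q (ev (in_alg A) X be).
      by rewrite -[ev _ _ _](subrK (b' * b)); apply: (QD); [exact: PQ|exact: QM].
    by move=> /hQ [c ec]; rewrite ec !rmorphM /= cg mulr0 eqxx in cbe.
  have [m tQ] := trd_exists haff pQ.
  have prPQ : P `<` Q by split=> // QP'; apply: (nPf l); apply: QP'.
  have dm : d = m.+1.
    by apply/eqP; rewrite eqn_leq (trd_contraction pg hQ tQ) (trd_lt pP pQ prPQ tP tQ).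
  have hadj : adjacent P Q.
    split=> // Q' pQ' PQ' Q'Q; apply: contrapT => nQ'P.
    have [m' tQ'] := trd_exists haff pQ'.
    have l1 := trd_lt pQ' pQ Q'Q tQ' tQ.
    have := trd_lt pP pQ' (conj PQ' nQ'P) tP tQ'.
    by rewrite dm ltnS leqNgt l1.
  exists l, Q; split=> //.
    apply/negP => ls; have : a - l%:A * b \in L.
      by rewrite !in_cons (map_f (fun l => a - l%:A * b) ls) !orbT.
    by move/chiL; rewrite cf eqxx.
  split; first exact: casimir_poisson_prime hab hadj (nPf l) Qf nQb.
  split=> //; have mt : (m < t0)%N.
    apply: (trd_lt p0 pQ _ ht0 tQ); split=> [x ->//|QP0]; apply: nQb.
    exfalso; apply: (nPf l); have -> : a - l%:A * b = 0 by apply: QP0.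
    by [].
  by have := height_trd haff pQ ht0 tQ; rewrite en dm subnSK.
have [Qs eQs] := (finite_seqP _).1 fin.
pose R Q l := Q (a - l%:A * b) /\ ~ Q b.
(* A prime not containing [b] contains a - l b for at most one l; [lam] picks it, with 0 as default.
   A value l outside the finite list of these contradicts uniqueness. *)
have [lam hlam] := @choice (set A) CC (fun Q l => (exists l, R Q l) -> R Q l)
   (fun Q => match EM (exists l, R Q l) with
     | or_introl (ex_intro l h) => ex_intro _ l (fun=> h)
     | or_intror h => ex_intro _ 0 (fun h' => False_ind _ (h h')) end).
have [l [Q [ls hQ Qf nQb]]] := many [seq lam Q | Q <- Qs].
have QQs : Q \in Qs by have : [set` Qs] Q by rewrite -eQs.
have [Qf' _] := hlam Q (ex_intro _ l (conj Qf nQb)).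
have [[pQ _] _] := hQ; have [[Q0 QD QM] Q1 QP] := pQ.
have ll : lam Q - l != 0.
  by rewrite subr_eq0; apply: contraNneq ls => <-; apply: map_f.
apply: nQb; have -> : b = ((lam Q - l)^-1)%:A * ((a - l%:A * b) - (a - (lam Q)%:A * b)).
  have -> : (a - l%:A * b) - (a - (lam Q)%:A * b) = (lam Q - l)%:A * b by rewrite scalerBl; ring.
  by rewrite mulrA -(rmorphM (in_alg A)) /= mulVf // scale1r mul1r.
apply: (QM); apply: ideal_sub => //; split=> //.
Qed.

End Implications.

(** * Interpolation of residues *)

Lemma irreducible_factor (K : fieldType) (p : {poly K}) : (1 < size p)%N ->
  exists2 q, irreducible_poly q & q %| p.
Proof.
elim: {p}(size p) {-2}p (leqnn (size p)) => [|N IH] p hN hp.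
  by move: hN; rewrite leqn0 => /eqP e; rewrite e in hp.
have [irr|nirr] := EM (irreducible_poly p); first by exists p.
have [q [hq1 hqp hqn]] : exists q : {poly K}, [/\ size q != 1%N, q %| p & ~~ (q %= p)].
  apply: contrapT => h; apply: nirr; split=> // q q1 qp.
  by apply: contraT => nqp; case: h; exists q.
have p0 : p != 0 by rewrite -size_poly_gt0 ltnW.
have q0 : q != 0 by apply: contraNneq p0 => e; move: hqp; rewrite e dvd0p.
have lq : (size q < size p)%N.
  rewrite ltn_neqAle dvdp_leq // andbT; apply: contra hqn => /eqP e.
  by rewrite -dvdp_size_eqp // e.
have [||t it tq] := IH q.
- by rewrite -ltnS (leq_trans lq).
- by rewrite ltn_neqAle eq_sym hq1 size_poly_gt0.
by exists t => //; apply: dvdp_trans hqp.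
Qed.

Lemma splitting_extension (K : fieldType) (p : {poly K}) : p != 0 ->
  exists (L : fieldType) (i : {rmorphism K -> L}) (s : seq L),
    map_poly i p = i (lead_coef p) *: \prod_(a <- s) ('X - a%:P).
Proof.
move e: (size p) => N; elim: N K p e => [|N IH] K p e p0.
  by move/eqP: e; rewrite size_poly_eq0 (negPf p0).
case: N IH e => [|N] IH e.
  have /size_poly1P[c c0 ->] : size p == 1%N by rewrite e.
  by exists K, idfun, [::]; rewrite big_nil map_polyC lead_coefC alg_polyC.
have [|q iq qp] := @irreducible_factor _ p; first by rewrite e.
have [L _ [z rz _]] := irredp_FAdjoin iq.
have rpz : root (map_poly (in_alg L) p) z.
  by apply: root_dvdp rz; rewrite dvdp_map.
have /factor_theorem[p1 ep1] := rpz.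
have mp0 : map_poly (in_alg L) p != 0 by rewrite map_poly_eq0.
have p10 : p1 != 0 by apply: contraNneq mp0 => e1; rewrite ep1 e1 mul0r.
have sp1 : size p1 = N.+1.
  have := size_map_poly (in_alg L) p.
  by rewrite e ep1 size_mul ?polyXsubC_eq0 // size_XsubC addn2 /= => -[].
have [L' [i [s es]]] := IH L p1 sp1 p10.
exists L', (i \o in_alg L), (i z :: s); rewrite map_poly_comp ep1 rmorphM /= es.
rewrite map_polyXsubC big_cons -scalerAl [_ * ('X - _)]mulrC; congr (i _ *: _).
by have := congr1 lead_coef ep1; rewrite lead_coef_map lead_coefM lead_coefXsubC mulr1.
Qed.

Lemma weight_split w N M i j : (j <= i)%N -> (j <= N)%N -> (i - j <= M)%N ->
  (w * (N - j) + w * (M - (i - j)) = w * (N + M - i))%N.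
Proof. by move=> h1 h2 h3; rewrite -mulnDr; congr (_ * _)%N; lia. Qed.

(** * Degree at infinity of algebraic functions *)

Section Weight.
Variables (n : nat) (K : fieldType) (emb : {rmorphism {mpoly CC[n]} -> K}).
Hypothesis emb_inj : injective emb.
Local Notation S0 := {mpoly CC[n]}.
Local Notation S := {mpoly CC[n.+1]}.

Definition rees_var (i : 'I_n.+1) : {poly S0} :=
  if unlift ord_max i is Some j then ('X_j)%:P * 'X else 'X.
(* [S] is the Rees algebra of the degree filtration of [S0], embedded in [S0[t]]. *)
Definition rees0 : S -> {poly S0} := ev (polyC \o @mpolyC n CC) rees_var.
HB.instance Definition _ := GRing.RMorphism.on rees0.
Definition rees : S -> {poly K} := map_poly emb \o rees0.
HB.instance Definition _ := GRing.RMorphism.on rees.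

Lemma rees0_max : rees0 'X_ord_max = 'X.
Proof. by rewrite /rees0 evX /rees_var unlift_none. Qed.

Lemma rees_max : rees 'X_ord_max = 'X.
Proof. by rewrite /rees /= rees0_max map_polyX. Qed.

Lemma rees_homE U u k : rees0 U = u%:P * 'X^k -> rees U = (emb u)%:P * 'X^k.
Proof. by rewrite /rees /= => ->; rewrite rmorphM /= map_polyC map_polyXn. Qed.

Lemma rees0_hom (u : S0) k : (msize u <= k.+1)%N ->
  exists U, rees0 U = u%:P * 'X^k.
Proof.
pose good k u := exists U, rees0 U = u%:P * 'X^k.
have goodD l a b : good l a -> good l b -> good l (a + b).
  by move=> [U hU] [V hV]; exists (U + V); rewrite rmorphD /= hU hV polyCD mulrDl.
have goodM l l' a b : good l a -> good l' b -> good (l + l')%N (a * b).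
  move=> [U hU] [V hV]; exists (U * V); rewrite rmorphM /= hU hV polyCM exprD; ring.
have goodC l c : good l c%:MP.
  by exists (c%:MP * 'X_ord_max ^+ l); rewrite rmorphM rmorphXn /= rees0_max /rees0 evC.
have goodX j : good 1%N 'X_j.
  by exists 'X_(lift ord_max j); rewrite /rees0 evX /rees_var liftK expr1.
move=> hu; rewrite [u]mpolyE big_seq; apply: (big_ind (good k)).
- by rewrite -mpolyC0; apply: goodC.
- by move=> a b; apply: goodD.
move=> m hm; have hk : (mdeg m <= k)%N.
  by have := leq_trans (msize_mdeg_lt hm) hu; rewrite ltnS.
rewrite -mul_mpolyC -(subnK hk); apply: (@goodM) => //.
rewrite mpolyXE_id mdegE.
elim: (index_enum _) => [|j s IH]; first by rewrite !big_nil -mpolyC1.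
rewrite !big_cons; apply: (@goodM) => //.
elim: (m j) => [|l IHl]; first by rewrite expr0 -mpolyC1.
by rewrite exprS -addn1 addnC; apply: (@goodM).
Qed.

Lemma rees0_degree U i : (msize (rees0 U)`_i <= i.+1)%N.
Proof.
pose good (F : {poly S0}) := forall i, (msize F`_i <= i.+1)%N.
have good0 : good 0 by move=> j; rewrite coef0 msize0.
have goodD a b : good a -> good b -> good (a + b).
  move=> ha hb j; rewrite coefD; apply: leq_trans (msizeD_le _ _) _.
  by rewrite geq_max ha hb.
have goodM a b : good a -> good b -> good (a * b).
  move=> ha hb j; rewrite coefM; apply: (big_ind (fun x => msize x <= j.+1)%N).
  - by rewrite msize0.
  - move=> x y hx hy; apply: leq_trans (msizeD_le _ _) _.
    by rewrite geq_max hx hy.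
  move=> l _; have hl : (l <= j)%N by rewrite -ltnS.
  have [->|a0] := eqVneq a`_l 0; first by rewrite mul0r msize0.
  have [->|b0] := eqVneq b`_(j - l) 0; first by rewrite mulr0 msize0.
  rewrite msizeM //; have := leq_add (ha l) (hb (j - l)%N).
  rewrite addSn addnS subnKC //.
  by case: (_ + _)%N.
have goodC c : good (c%:MP)%:P.
  by move=> [|j]; rewrite coefC /= ?msize0 // msizeC; case: eqP.
have goodX j : good (rees_var j).
  rewrite /rees_var; case: unlift => [l|] [|[|k]]; rewrite ?coefCM !coefX /= ?mulr0 ?mulr1 ?msize0 //.
    by rewrite msizeX mdeg1.
  by rewrite msize1.
move: i; rewrite -/(good _) [U]mpolyE rmorph_sum; apply: (big_ind good) => // m _.
rewrite -mul_mpolyC rmorphM /=; apply: (goodM); first by rewrite /rees0 evC; apply: goodC.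
rewrite mpolyXE_id rmorph_prod; apply: (big_ind good) => [|//|j _].
  by rewrite -polyC1 -mpolyC1; apply: goodC.
rewrite rmorphXn /= {1}/rees0 evX; elim: (m j) => [|l IHl].
  by rewrite expr0 -polyC1 -mpolyC1; apply: goodC.
by rewrite exprS; apply: (goodM).
Qed.

Lemma rees_inj : injective rees.
Proof.
have mi : injective (map_poly emb) by apply: map_inj_poly; rewrite ?rmorph0.
suff h U : rees0 U = 0 -> U = 0.
  move=> U V /mi e; apply/eqP; rewrite -subr_eq0; apply/eqP/h.
  by rewrite rmorphB /= e subrr.
move=> e; apply/eqP; apply: contraT => U0.
have [|c hc] := @mpoly_nonroot _ ('X_ord_max * U).
  by rewrite mulf_neq0 // -msize_poly_eq0 msizeX.
move: hc; rewrite mevalM mevalXU mulf_eq0 negb_or => /andP[c0 /negP[]].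
pose x := c ord_max; pose f : {rmorphism {mpoly CC[n]} -> CC} := meval (fun j => c (lift ord_max j) / x).
have -> : U.@[c] = (horner_eval x \o map_poly f \o rees0) U.
  apply: (mpoly_hom_ext (f := meval c) (g := horner_eval x \o map_poly f \o rees0)) => [a|i] /=.
    by rewrite mevalC /rees0 evC /= map_polyC /= mevalC /horner_eval hornerC.
  rewrite mevalXU /rees0 evX /rees_var /horner_eval; case: (unliftP ord_max i) => [j|] ->.
    by rewrite rmorphM /= map_polyC map_polyX hornerM hornerC hornerX /= mevalXU divfK.
  by rewrite map_polyX hornerX.
by rewrite /= e rmorph0 /horner_eval horner0.
Qed.

(** Extends the bound on the degree by [m] from polynomials to algebraic functions: z t^m has to be
    integral over the Rees algebra. *)
Definition weight m (z : K) := integralOver rees (z%:P * 'X^m).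

(** The Rees algebra is a polynomial ring, hence integrally closed, so a rational function of weight
    [m] is a polynomial of degree at most [m]. *)
Lemma weight_frac m (u v : S0) c : v != 0 -> emb v * c = emb u -> weight m c ->
  exists2 c0, c = emb c0 & (msize c0 <= m.+1)%N.
Proof.
move=> v0 huv [p mp rp].
pose k := maxn (msize u) (msize v).
have [|U hU] := @rees0_hom u k; first by rewrite leqW // leq_maxl.
have [|V hV] := @rees0_hom v k; first by rewrite leqW // leq_maxr.
pose f : {rmorphism S -> {fraction {poly K}}} := @FracField.tofrac {poly K} \o rees.
have f_inj : injective f by move=> x y /eqP; rewrite /f /= tofrac_eq => /eqP /rees_inj.
have [g hg] := frac_lift f_inj.
have V0 : V != 0.
  apply: contraNneq v0 => V0; have := congr1 (fun F : {poly S0} => F`_k) hV.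
  by rewrite V0 rmorph0 coef0 coefMXn ltnn subnn coefC eqxx => <-.
have eUV : rees V * (c%:P * 'X^m) = rees (U * 'X_ord_max ^+ m).
  have -> : rees (U * 'X_ord_max ^+ m) = rees U * rees 'X_ord_max ^+ m.
    by rewrite (rmorphM rees) (rmorphXn rees).
  by rewrite rees_max (rees_homE hU) (rees_homE hV) -huv polyCM mulrACA !mulrA.
pose z := tofrac (U * 'X_ord_max ^+ m) / tofrac V.
have gz : g z = tofrac (c%:P * 'X^m).
  rewrite /z fmorph_div !hg /f /= -eUV tofracM mulrC mulKf // tofrac_eq0.
  by rewrite -[0](rmorph0 rees) (inj_eq rees_inj).
have [s es] : exists s, z = tofrac s.
  apply: (@ufd_int_closed _ (@ufd_mpoly _ _)); exists p => //.
  rewrite -(fmorph_root g) gz -map_poly_comp.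
  have -> : map_poly (g \o @FracField.tofrac S) p = map_poly f p by apply: eq_map_poly => a /=; rewrite hg.
  by rewrite /f map_poly_comp; apply: rmorph_root.
have e2 : rees s = c%:P * 'X^m.
  by apply/eqP; rewrite -tofrac_eq -gz es hg.
exists ((rees0 s)`_m); last exact: rees0_degree.
have := congr1 (fun F : {poly K} => F`_m) e2.
by rewrite /rees /= coef_map coefMXn ltnn subnn coefC eqxx => <-.
Qed.

Lemma weight_emb m u : (msize u <= m.+1)%N -> weight m (emb u).
Proof.
move=> /rees0_hom[U hU]; rewrite /weight.
rewrite -(rees_homE hU); exact: integral_id.
Qed.

Lemma weight0 m : weight m 0.
Proof. by rewrite /weight mul0r; apply: integral0. Qed.
Lemma weight1 m : weight m 1.
Proof. by rewrite -(rmorph1 emb); apply: weight_emb; rewrite msize1. Qed.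
Lemma weightD m a b : weight m a -> weight m b -> weight m (a + b).
Proof. by move=> ha hb; rewrite /weight polyCD mulrDl; apply: integral_add. Qed.
Lemma weightN m a : weight m a -> weight m (- a).
Proof. by move=> ha; rewrite /weight polyCN mulNr; apply: integral_opp. Qed.
Lemma weightM l m a b : weight l a -> weight m b -> weight (l + m) (a * b).
Proof. by move=> ha hb; rewrite /weight polyCM exprD mulrACA; apply: integral_mul. Qed.
Lemma weightMn m a k : weight m a -> weight m (a *+ k).
Proof.
by move=> ha; elim: k => [|k IH]; rewrite ?mulrS; [apply: weight0|apply: weightD].
Qed.
Lemma weight_sum m (I : Type) (r : seq I) (P : pred I) (f : I -> K) :
  (forall i, P i -> weight m (f i)) -> weight m (\sum_(i <- r | P i) f i).
Proof.
by move=> h; apply: (big_ind (weight m)) => //; [apply: weight0|move=> *; apply: weightD].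
Qed.

(** Modelled on a product of [N] factors X - a with all roots of weight [w]: the coefficient of X^i
    then has weight w (N - i). *)
Definition weighted w N (F : {poly K}) := (size F <= N.+1)%N /\
  forall i, weight (w * (N - i)) F`_i.

Lemma weightedM w N M F G : weighted w N F -> weighted w M G -> weighted w (N + M) (F * G).
Proof.
move=> [sF hF] [sG hG]; split.
  apply: leq_trans (size_polyMleq _ _) _.
  by have := leq_add sF sG; rewrite addSn addnS; case: (_ + _)%N.
move=> i; rewrite coefM; apply: weight_sum => j _.
have ji : (j <= i)%N by rewrite -ltnS.
have [hj|hj] := leqP j N; last first.
  by rewrite [F`_j]nth_default ?mul0r; [apply: weight0|apply: leq_trans sF _].
have [hk|hk] := leqP (i - j) M; last first.
  by rewrite [G`_(i - j)]nth_default ?mulr0; [apply: weight0|apply: leq_trans sG _].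
by rewrite -(weight_split w ji hj hk); apply: weightM.
Qed.

Lemma weighted1 w : weighted w 0 1.
Proof.
split=> [|i]; first by rewrite size_poly1.
by rewrite coef1; case: eqP => _; [apply: weight1|apply: weight0].
Qed.

Lemma weightedXsubC w a : weight w a -> weighted w 1 ('X - a%:P).
Proof.
move=> ha; split=> [|i]; first by rewrite size_XsubC.
rewrite coefB coefX coefC; case: i => [|[|i]] /=.
- by rewrite sub0r muln1; apply: weightN.
- by rewrite subr0; apply: weight1.
by rewrite subr0; apply: weight0.
Qed.

Lemma weighted_prod w s : (forall a, a \in s -> weight w a) ->
  weighted w (size s) (\prod_(a <- s) ('X - a%:P)).
Proof.
elim: s => [|a s IH] h; first by rewrite big_nil; apply: weighted1.
rewrite big_cons /= -add1n; apply: weightedM.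
  by apply: weightedXsubC; apply: h; rewrite mem_head.
by apply: IH => b hb; apply: h; rewrite in_cons hb orbT.
Qed.

Lemma weighted_deriv w N F : weighted w N F -> weighted w N.-1 F^`().
Proof.
move=> [sF hF]; split.
  apply: leq_trans (size_poly _ _) _; apply: leq_trans (leqSpred N); move: sF.
  by case: (size F).
move=> i; rewrite coef_deriv; apply: weightMn.
by have := hF i.+1; case: N {sF hF} => [|N] //=; rewrite ?subSS // !sub0n.
Qed.

Lemma weight_root w N F b : F \is monic -> size F = N.+1 -> weighted w N F ->
  root F b -> weight w b.
Proof.
move=> mF sF [_ hF] rb.
pose G : {poly {poly K}} := \poly_(i < N.+1) ((F`_i)%:P * 'X^(w * (N - i))).
have eN : F`_N = 1 by rewrite -(monicP mF) lead_coefE sF.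
have sG : size G = N.+1.
  by rewrite size_poly_eq // eN subnn muln0 mulr1 polyC_eq0 oner_neq0.
apply: (integral_root_monic (p := G)).
- by rewrite monicE lead_coefE sG coef_poly ltnSn eN subnn muln0 mulr1.
- rewrite /root horner_poly.
  have -> : \sum_(i < N.+1) (F`_i)%:P * 'X^(w * (N - i)) * (b%:P * 'X^w) ^+ i = (F.[b])%:P * 'X^(w * N).
    rewrite horner_coef sF rmorph_sum mulr_suml; apply: eq_bigr => i _.
    rewrite exprMn -exprM mulrACA -exprD /= polyCM polyC_exp -mulnDr subnK //.
    by rewrite -ltnS.
  by rewrite (rootP rb) mul0r.
move=> c /(nthP 0)[i hi <-]; rewrite coef_poly -sG hi; exact: hF.
Qed.

Lemma weighted0 w N : weighted w N 0.
Proof. by split=> [|i]; rewrite ?size_poly0 // coef0; apply: weight0. Qed.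

Lemma weightX m a k : weight m a -> weight (m * k) (a ^+ k).
Proof.
move=> ha; elim: k => [|k IH]; first by rewrite expr0; apply: weight1.
by rewrite exprS mulnS; apply: weightM.
Qed.

Lemma weighted_horner w k F a : weighted w k F -> weight w a -> weight (w * k) F.[a].
Proof.
move=> [sF hF] ha; rewrite (horner_coef_wide _ sF); apply: weight_sum => i _.
have hi : (i <= k)%N by rewrite -ltnS.
have -> : (w * k = w * (k - i) + w * i)%N by rewrite -mulnDr subnK.
by apply: weightM => //; apply: weightX.
Qed.

(** [qa] and [ha] come without degree bounds. Made monic they are complementary factors of [pa], so
    their roots have weight [w], and h q' / r is bounded like the derivative of [pa]. For e = 0 the
    bound at [e.-1] would be too weak, hence the separate clause. *)
Lemma weighted_cofactor w e (pa qa ha : {poly K}) r sb :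
  pa \is monic -> size pa = e.+1 -> weighted w e pa ->
  pa %| \prod_(b <- sb) ('X - b%:P) -> r != 0 -> r *: pa = qa * ha ->
  weighted w e.-1 (r^-1 *: (ha * qa^`())) /\ (e = 0%N -> r^-1 *: (ha * qa^`()) = 0).
Proof.
move=> mpa spa wpa hsb r0 e1.
have pa0 : pa != 0 by apply: monic_neq0.
have qa0 : qa != 0.
  by apply: contraNneq pa0 => z; rewrite -(scale1r pa) -(mulVf (r0)) -scalerA e1 z mul0r scaler0.
pose l := lead_coef qa; have l0 : l != 0 by rewrite lead_coef_eq0.
pose q1 := l^-1 *: qa; pose h1 := (l / r) *: ha.
have e2 : q1 * h1 = pa.
  rewrite /q1 /h1 -scalerAl -scalerAr -e1 !scalerA.
  by rewrite (mulKf l0) mulVf // scale1r.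
have mq1 : q1 \is monic by rewrite monicE lead_coefZ mulVf.
have mh1 : h1 \is monic by move: mpa; rewrite -e2 monicMl.
have eH : (r)^-1 *: (ha * qa^`()) = h1 * q1^`().
  rewrite /h1 /q1 derivZ -scalerAl -scalerAr scalerA; congr (_ *: _).
  by rewrite mulrAC mulfV ?mul1r.
have wd (t : {poly K}) : t \is monic -> t %| pa -> weighted w (size t).-1 t.
  move=> mt tp; have [m hm] := dvdp_prod_XsubC (dvdp_trans tp hsb).
  have et : t = \prod_(b <- mask m sb) ('X - b%:P).
    by apply/eqP; rewrite -eqp_monic // monic_prod_XsubC.
  rewrite {2}et {1}et size_prod_XsubC /=; apply: weighted_prod => b hb.
  apply: (weight_root mpa spa wpa); apply: root_dvdp tp _.
  by rewrite et root_prod_XsubC.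
have w1 : weighted w (size q1).-1 q1 by apply: wd => //; rewrite -e2 dvdp_mulr.
have w2 : weighted w (size h1).-1 h1 by apply: wd => //; rewrite -e2 dvdp_mull.
have ez : ((size q1).-1 + (size h1).-1 = e)%N.
  have := spa; rewrite -e2 size_mul ?monic_neq0 //.
  have : (0 < size q1)%N by rewrite size_poly_gt0 monic_neq0.
  have : (0 < size h1)%N by rewrite size_poly_gt0 monic_neq0.
  case: (size q1) => // x; case: (size h1) => // y _ _.
  by rewrite addSn addnS => -[].
rewrite eH.
have [s1|s1] := leqP (size q1) 1.
  have -> : q1^`() = 0 by rewrite (size1_polyC s1) derivC.
  by rewrite mulr0; split=> //; apply: weighted0.
split; last by move: s1 ez; case: (size q1) => [|[|x]] //= _ <-; rewrite addSn.
have -> : (e.-1 = (size h1).-1 + (size q1).-1.-1)%N.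
  by rewrite -ez; move: s1; case: (size q1) => [|[|x]] //= _; rewrite addnC.
by apply: weightedM => //; apply: weighted_deriv.
Qed.

End Weight.

Lemma mderivX1 m (i : 'I_m) : 'X_i^`M(i) = 1 :> {mpoly CC[m]}.
Proof.
rewrite mderivX mnm1E eqxx scale1r -mpolyX0; congr mpolyX.
by apply/mnmP => k; rewrite mnmBE subnn mnm0E.
Qed.

Lemma msizeM_bound m (a b : {mpoly CC[m]}) k l :
  (msize a <= k.+1)%N -> (msize b <= l.+1)%N -> (msize (a * b) <= (k + l).+1)%N.
Proof.
have [->|a0] := eqVneq a 0; first by rewrite mul0r msize0.
have [->|b0] := eqVneq b 0; first by rewrite mulr0 msize0.
by rewrite msizeM // => ha hb; have := leq_add ha hb; rewrite addSn addnS; case: (_ + _)%N.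
Qed.

Lemma msize_exp m (a : {mpoly CC[m]}) l : (msize a <= 2)%N -> (msize (a ^+ l) <= l.+1)%N.
Proof.
move=> ha; elim: l => [|l IH]; first by rewrite expr0 msize1.
by rewrite exprS -(add1n l); apply: msizeM_bound.
Qed.

Section WeightedDegree.
Variables (n w : nat).
Local Notation S0 := {mpoly CC[n]}.

(** Weighted degree at most [k], with X counted as [w]. As [msize] is the degree plus one and 0 for
    the zero polynomial, zero coefficients are set apart so that they impose no bound on the
    index. *)
Definition xdeg k (F : {poly S0}) := forall j, (msize F`_j + w * j <= k.+1)%N \/ F`_j = 0.

Lemma xdeg0 k : xdeg k 0.
Proof. by move=> j; right; rewrite coef0. Qed.

Lemma xdegD k F G : xdeg k F -> xdeg k G -> xdeg k (F + G).
Proof.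
move=> hF hG j; rewrite coefD.
case: (hF j) (hG j) => [h1|->] [h2|->]; rewrite ?add0r ?addr0; try by left.
  left; apply: leq_trans (leq_add (msizeD_le _ _) (leqnn (w * j))) _.
  by rewrite addn_maxl geq_max h1 h2.
by right.
Qed.

Lemma xdegM k l F G : xdeg k F -> xdeg l G -> xdeg (k + l) (F * G).
Proof.
move=> hF hG j; rewrite coefM.
apply: (big_ind (fun x => (msize x + w * j <= (k + l).+1)%N \/ x = 0)); first by right.
  move=> x y [h1|->] [h2|->]; rewrite ?add0r ?addr0; try by [left|right].
  left; apply: leq_trans (leq_add (msizeD_le _ _) (leqnn (w * j))) _.
  by rewrite addn_maxl geq_max h1 h2.
move=> i _; have hi : (i <= j)%N by rewrite -ltnS.
case: (hF i) (hG (j - i)%N) => [h1|->] [h2|->]; rewrite ?mul0r ?mulr0; try by right.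
have [->|a0] := eqVneq F`_i 0; first by rewrite mul0r; right.
have [->|b0] := eqVneq G`_(j - i) 0; first by rewrite mulr0; right.
left; rewrite msizeM //.
have p1 : (0 < msize F`_i)%N by rewrite lt0n msize_poly_eq0.
have -> : (w * j = w * i + w * (j - i))%N by rewrite -mulnDr subnKC.
by move: h1 h2 p1; move: (msize _) (msize _) (w * i)%N (w * (j - i))%N => x y; lia.
Qed.

Lemma xdegC k c : xdeg k (c%:MP)%:P.
Proof.
move=> [|j]; rewrite coefC /=; last by right.
by left; rewrite muln0 addn0 msizeC; case: eqP.
Qed.

Lemma xdegX : xdeg w 'X.
Proof. by move=> [|[|j]]; rewrite coefX /=; [right|left; rewrite msize1 muln1|right]. Qed.

Lemma xdeg_exp k F m : xdeg k F -> xdeg (k * m) (F ^+ m).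
Proof.
move=> hF; elim: m => [|m IH]; first by rewrite expr0 -polyC1 -mpolyC1; apply: xdegC.
by rewrite exprS mulnS; apply: xdegM.
Qed.

End WeightedDegree.

Section LinearChangeDegree.
Variables (n : nat) (v : 'I_n -> CC).
Local Notation S0 := {mpoly CC[n]}.
Local Notation R := {mpoly CC[n.+1]}.

Lemma lchange_xdeg k (f : R) : (msize f <= k.+1)%N -> xdeg 1 k (lchange v f).
Proof.
move=> hf; rewrite [f]mpolyE rmorph_sum big_seq; apply: (big_ind (xdeg 1 k)).
- exact: xdeg0.
- by move=> a b; apply: xdegD.
move=> m hm; have hk : (mdeg m <= k)%N.
  by have := leq_trans (msize_mdeg_lt hm) hf; rewrite ltnS.
rewrite -mul_mpolyC rmorphM /= lchangeC -(subnK hk); apply: xdegM; first exact: xdegC.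
rewrite mpolyXE_id rmorph_prod mdegE.
elim: (index_enum _) => [|i s IH].
  by rewrite !big_nil -polyC1 -mpolyC1; apply: xdegC.
rewrite !big_cons; apply: xdegM => //.
rewrite rmorphXn /= lchangeX -[m i in X in xdeg _ X]mul1n; apply: xdeg_exp.
case: (unliftP ord_max i) => [j|] ->; last by rewrite lchange_im_max; apply: xdegX.
rewrite lchange_im_lift; apply: xdegD.
  by move=> [|l]; rewrite coefC /=; [left; rewrite msizeX mdeg1|right].
by rewrite -[1%N]add0n; apply: xdegM; [apply: xdegC|apply: xdegX].
Qed.

Lemma lback_msize k (F : {poly S0}) : xdeg 1 k F -> (msize (lback v F) <= k.+1)%N.
Proof.
move=> hF; rewrite -[F]coefK poly_def rmorph_sum.
apply: (big_ind (fun x => msize x <= k.+1)%N); first by rewrite msize0.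
  by move=> x y hx hy; apply: leq_trans (msizeD_le _ _) _; rewrite geq_max hx hy.
move=> j _; rewrite -mul_polyC rmorphM rmorphXn /= lbackC lbackX.
have [->|Fj] := eqVneq F`_j 0; first by rewrite rmorph0 mul0r msize0.
case: (hF j) => [|e]; last by rewrite e eqxx in Fj.
rewrite mul1n => h.
have ex l : (msize ('X_ord_max ^+ l : R) <= l.+1)%N by apply: msize_exp; rewrite msizeX mdeg1.
have h0 (f : S0) l : (msize f <= l.+1)%N -> (msize (lback0 v f) <= l.+1)%N.
  move=> hf; rewrite [f]mpolyE rmorph_sum big_seq.
  apply: (big_ind (fun x => msize x <= l.+1)%N); first by rewrite msize0.
    by move=> x y hx hy; apply: leq_trans (msizeD_le _ _) _; rewrite geq_max hx hy.
  move=> m hm; rewrite -mul_mpolyC rmorphM /= lback0C.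
  have hl := leq_trans (msize_mdeg_lt hm) hf; apply: leq_trans hl.
  rewrite -[mdeg m]add0n; apply: msizeM_bound; first by rewrite msizeC; case: eqP.
  rewrite mpolyXE_id rmorph_prod mdegE.
  elim: (index_enum _) => [|i s IH]; first by rewrite !big_nil msize1.
  rewrite !big_cons; apply: msizeM_bound => //.
  rewrite rmorphXn /=; apply: msize_exp; rewrite lback0X.
  apply: leq_trans (msizeD_le _ _) _; rewrite geq_max msizeX mdeg1 /= msizeN.
  by rewrite -[2%N]/(0 + 1).+1; apply: msizeM_bound; rewrite ?msizeX ?mdeg1 // msizeC; case: eqP.
have hj : (j <= k)%N by rewrite -ltnS; apply: leq_trans h; rewrite -add1n leq_add2r lt0n msize_poly_eq0.
rewrite -(subnK hj); apply: msizeM_bound => //; apply: h0.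
by rewrite -(leq_add2r j) addSn subnK.
Qed.

Definition dirder m (u : 'I_m -> CC) (f : {mpoly CC[m]}) := \sum_k (u k)%:MP * f^`M(k).

Lemma dirderM m (u : 'I_m -> CC) f g : dirder u (f * g) = dirder u f * g + f * dirder u g.
Proof.
rewrite /dirder mulr_suml mulr_sumr -big_split; apply: eq_bigr => i _ /=.
by rewrite mderivM; ring.
Qed.

Lemma dirderD m (u : 'I_m -> CC) f g : dirder u (f + g) = dirder u f + dirder u g.
Proof. by rewrite /dirder -big_split; apply: eq_bigr => i _; rewrite mderivD mulrDr. Qed.

Lemma lchange_deriv f : lchange v (dirder (vext v) f) = (lchange v f)^`().
Proof.
pose good f := lchange v (dirder (vext v) f) = (lchange v f)^`().
have d0 : dirder (vext v) 0 = 0 by rewrite /dirder big1 // => i _; rewrite linear0 mulr0.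
have dC c : dirder (vext v) c%:MP = 0.
  by rewrite /dirder big1 // => i _; rewrite mderivC mulr0.
have gC c : good c%:MP by rewrite /good dC rmorph0 lchangeC derivC.
have gM a b : good a -> good b -> good (a * b).
  by rewrite /good => ha hb; rewrite dirderM rmorphD !rmorphM /= ha hb derivM.
have gD a b : good a -> good b -> good (a + b).
  have LD x y : lchange v (x + y) = lchange v x + lchange v y by exact: rmorphD.
  by rewrite /good => ha hb; rewrite dirderD !LD ha hb derivD.
have gX i : good 'X_i.
  rewrite /good.
  have -> : dirder (vext v) 'X_i = (vext v i)%:MP.
    rewrite /dirder (bigD1 i) //= big1 => [|j ji]; last first.
      by rewrite mderivX mnm1E eq_sym (negPf ji) scale0r mulr0.
    by rewrite mderivX1 mulr1 addr0.
  rewrite lchangeC lchangeX /vext; case: (unliftP ord_max i) => [j|] ->.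
    by rewrite lchange_im_lift derivD derivC derivM derivX derivC mul0r add0r mulr1 add0r.
  by rewrite lchange_im_max derivX; exact: rmorph1.
rewrite -/(good f) [f]mpolyE; apply: (big_ind good) => [|//|m _].
  by rewrite -mpolyC0.
rewrite -mul_mpolyC; apply: (@gM) => //; rewrite mpolyXE_id.
apply: (big_ind good) => [|//|i _]; first by rewrite -mpolyC1.
elim: (m i) => [|l IH]; first by rewrite expr0 -mpolyC1.
by rewrite exprS; exact: (gM _ _ (gX i) IH).
Qed.

End LinearChangeDegree.

(** [M a] is G / (X - a), with value G'(a) at [a]. Writing the prescribed values as G'(a) H(a)
    cancels the usual denominators, so weights of [H] and [M] will bound that of [F]. *)
Lemma lagrange_interpolation (K : fieldType) (s : seq K) (G F : {poly K})
    (M : K -> {poly K}) (H : K -> K) : uniq s ->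
  (forall a, a \in s -> G = ('X - a%:P) * M a) ->
  (forall a, a \in s -> (size (M a) <= size s)%N) -> (size F <= size s)%N ->
  (forall a, a \in s -> F.[a] = G^`().[a] * H a) -> F = \sum_(a <- s) H a *: M a.
Proof.
move=> us hG sM sF hF; apply/eqP; rewrite -subr_eq0; apply/eqP.
apply: (@roots_geq_poly_eq0 _ _ s) => //; last first.
  apply: leq_trans (size_polyD _ _) _; rewrite geq_max sF size_polyN /=.
  rewrite big_seq; apply: (big_ind (fun x : {poly K} => size x <= size s)%N); first by rewrite size_poly0.
    by move=> x y hx hy; apply: leq_trans (size_polyD _ _) _; rewrite geq_max hx hy.
  by move=> a ha; apply: leq_trans (size_scale_leq _ _) _; apply: sM.
apply/allP => a ha; rewrite /root hornerD hornerN subr_eq0 horner_sum.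
rewrite (bigD1_seq a) //= big_seq_cond big1 => [|b /andP[hb ab]].
  rewrite addr0 hornerZ hF // (hG a ha) derivM derivB derivX derivC subr0 mul1r.
  by rewrite hornerD hornerM hornerXsubC subrr mul0r addr0 mulrC.
have := congr1 (horner^~ a) (hG b hb); rewrite (hG a ha) !hornerM !hornerXsubC subrr mul0r.
move/esym/eqP; rewrite mulf_eq0 subr_eq0 eq_sym (negPf ab) /= => /eqP e.
by rewrite hornerZ e mulr0.
Qed.

Lemma map_poly_relation (R0 K : comNzRingType) (V : {rmorphism R0 -> K}) r (p q h : {poly R0}) :
  (forall i, V (r * p`_i - (q * h)`_i) = 0) ->
  V r *: map_poly V p = map_poly V q * map_poly V h.
Proof.
move=> H; rewrite -rmorphM; apply/polyP => i; rewrite coefZ !coef_map /=.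
by have /eqP := H i; rewrite rmorphB rmorphM subr_eq0 => /eqP.
Qed.

Lemma deriv_mapM (R0 K : comNzRingType) (V : {rmorphism R0 -> K}) (q h : {poly R0}) :
  map_poly V h * (map_poly V q)^`() = map_poly V (h * q^`()).
Proof. by rewrite rmorphM deriv_map. Qed.

Lemma coprimep_of_roots (K0 K : fieldType) (j : {rmorphism K0 -> K}) (a b : {poly K0}) c s :
  map_poly j b = c *: \prod_(x <- s) ('X - x%:P) -> c != 0 ->
  (forall x, x \in s -> (map_poly j a).[x] != 0) -> coprimep a b.
Proof.
move=> eb c0 ha; rewrite -(coprimep_map j) eb coprimepZr //.
elim: s {eb} ha => [|x s IH] ha; first by rewrite big_nil coprimep1.
rewrite big_cons coprimepMr coprimep_XsubC /root ha ?mem_head //= IH // => y hy.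
by apply: ha; rewrite in_cons hy orbT.
Qed.

Lemma modular_quotient (K0 K : fieldType) (j : {rmorphism K0 -> K}) (a b t : {poly K0}) :
  coprimep a b -> b != 0 -> exists eta : {poly K0}, (size eta < size b)%N /\
  forall x, (map_poly j b).[x] = 0 -> (map_poly j a).[x] * (map_poly j eta).[x] = (map_poly j t).[x].
Proof.
move=> /Bezout_eq1_coprimepP[[u u'] /= eu] b0; exists ((u * t) %% b).
split; first by rewrite ltn_modp.
move=> x hx.
have ur : (map_poly j u).[x] * (map_poly j a).[x] = 1.
  have := congr1 (fun F => (map_poly j F).[x]) eu.
  by rewrite rmorphD !rmorphM rmorph1 hornerD !hornerM hx mulr0 addr0 hornerC.
have := congr1 (fun F => (map_poly j F).[x]) (divp_eq (u * t) b).
rewrite rmorphD !rmorphM hornerD !hornerM hx mulr0 add0r => <-.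
by rewrite mulrA [_ * (map_poly j u).[x]]mulrC ur mul1r.
Qed.

(** * Interpolation along a general line *)

Section DirectionalInterpolation.
Variables (n : nat) (v : 'I_n -> CC) (g : {mpoly CC[n.+1]}).
Hypotheses (pg : prime_elt g) (gv : (topform g).@[vext v] != 0).
Local Notation S0 := {mpoly CC[n]}.
Local Notation R := {mpoly CC[n.+1]}.
Local Notation c0 := ((topform g).@[vext v]).
Let N := (msize g).-1.

Lemma size_lchange : size (lchange v g) = N.+1 /\ lead_coef (lchange v g) = c0%:MP.
Proof.
have sm : (0 < msize g)%N by rewrite lt0n msize_poly_eq0 prime_elt_neq0.
have s1 : size (lchange v g) = N.+1.
  apply/eqP; rewrite eqn_leq; apply/andP; split; first by apply: lchange_size; rewrite prednK.
  rewrite ltnNge; apply/negP => h.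
  by have /eqP := lchange_top v g; rewrite nth_default // eq_sym mpolyC_eq0 (negPf gv).
by split=> //; rewrite lead_coefE s1 lchange_top.
Qed.

Section Embedded.
Variables (K : fieldType) (emb : {rmorphism S0 -> K}).
Hypothesis emb_inj : injective emb.

Definition value (a : K) : R -> K := horner_eval a \o map_poly emb \o lchange v.
HB.instance Definition _ a := GRing.RMorphism.on (value a).

Lemma valueM a x y : value a (x * y) = value a x * value a y.
Proof. exact: rmorphM. Qed.
Lemma valueB a x y : value a (x - y) = value a x - value a y.
Proof. exact: rmorphB. Qed.

(** The root [a] gives a generic point of the hypersurface g = 0: its minimal polynomial over [S0],
    read back in R, divides [g], is not a unit, and divides every [f] with value 0. *)
Lemma value_kernel a : root (map_poly emb (lchange v g)) a -> forall f, value a f = 0 -> dvdr g f.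
Proof.
move=> ra f hf; have [sg lg] := size_lchange.
have ia : integralOver emb a.
  exists ((c0^-1)%:MP *: lchange v g).
    by rewrite monicE lead_coefZ lg -mpolyCM mulVf ?mpolyC1.
  by rewrite map_polyZ /= rootZ // -[0](rmorph0 emb) (inj_eq emb_inj) mpolyC_eq0 invr_eq0.
have [q [mq rq hq]] := integral_minimal_poly (@ufd_mpoly _ n) emb_inj ia.
have back x : dvdr q (lchange v x) -> dvdr (lback v q) x.
  case=> t e; exists (lback v t); rewrite -[x](lchangeK v) e; exact: rmorphM.
have [s es] := back _ (hq _ ra).
have hqf : dvdr (lback v q) f by apply: back; apply: hq; rewrite /root; apply/eqP.
have : dvdr g (s * lback v q) by rewrite -es; apply: dvdr_refl.
case/(prime_dvdM pg) => [[t et]|h]; last exact: dvdr_trans hqf.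
have g0 := prime_elt_neq0 pg.
have e1 : t * lback v q = 1.
  by apply: (mulIf g0); rewrite mul1r {2}es et; ring.
have : lchange v t * q = 1.
  by rewrite -[q in LHS](lbackK v) -[1](rmorph1 (lchange v)) -e1; exact/esym/rmorphM.
move=> /(congr1 (fun x => (map_poly emb x).[a])).
rewrite rmorphM hornerM (rootP rq) mulr0 rmorph1 hornerC => /esym/eqP.
by rewrite oner_eq0.
Qed.

End Embedded.

Variables (w e : nat) (p : {poly R}).
Hypotheses (mp : p \is monic) (sp : size p = e.+1).
Hypothesis wp : forall i, (msize p`_i <= (w * (e - i)).+1)%N.

(** One field contains the roots of [g] on the generic line and the roots of [p] specialized at each
    of them; the latter are what gives weights to the factors of [p]. *)
Lemma splitting_data : exists (K : fieldType) (j : {rmorphism {fraction S0} -> K}) (s sb : seq K),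
  map_poly (j \o @FracField.tofrac S0) (lchange v g) = j (tofrac c0%:MP) *: \prod_(a <- s) ('X - a%:P) /\
  forall a, a \in s -> map_poly (value (j \o @FracField.tofrac S0) a) p %| \prod_(b <- sb) ('X - b%:P).
Proof.
have [sg lg] := size_lchange.
have [|K1 [j1 [s1 e1]]] := @splitting_extension _ (map_poly (@FracField.tofrac S0) (lchange v g)).
  rewrite map_poly_eq0_id0 ?lg ?tofrac_eq0 ?mpolyC_eq0 //.
  by rewrite -size_poly_eq0 sg.
pose val1 a := value (j1 \o @FracField.tofrac S0) a.
have [|K [j [sb e2]]] := @splitting_extension _ (\prod_(a <- s1) map_poly (val1 a) p).
  by apply: monic_neq0; apply: monic_prod => a _; apply: monic_map.
exists K, (j \o j1), (map j s1), sb; split.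
  have -> : map_poly ((j \o j1) \o @FracField.tofrac S0) (lchange v g) =
     map_poly j (map_poly j1 (map_poly (@FracField.tofrac S0) (lchange v g))).
    by rewrite -!map_poly_comp.
  rewrite e1 lead_coef_map_inj //; last first.
    by move=> x y /eqP; rewrite tofrac_eq => /eqP.
  rewrite lg map_polyZ rmorph_prod big_map /=; congr (_ *: _).
  by apply: eq_bigr => a _; rewrite map_polyXsubC.
move=> _ /mapP[a ha ->].
have -> : map_poly (value ((j \o j1) \o @FracField.tofrac S0) (j a)) p = map_poly j (map_poly (val1 a) p).
  rewrite -map_poly_comp; apply: eq_map_poly => f /=.
  rewrite /val1 /value /= /horner_eval -horner_map -map_poly_comp //.
have e3 : map_poly j (\prod_(a <- s1) map_poly (val1 a) p) = \prod_(b <- sb) ('X - b%:P).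
  rewrite e2 (monicP _) ?rmorph1 ?scale1r //.
  by apply: monic_prod => b _; apply: monic_map.
by rewrite -e3 dvdp_map (big_rem a) //= dvdp_mulr.
Qed.

Lemma xdeg_weighted (K : fieldType) (emb : {rmorphism S0 -> K}) k F :
  xdeg 1 k F -> weighted emb 1 k (map_poly emb F).
Proof.
move=> hF; split.
  apply: leq_trans (size_poly _ _) _; apply/leq_sizeP => j hj.
  case: (hF j) => //; rewrite mul1n => h; apply/eqP; rewrite -msize_poly_eq0 -leqn0 -(leq_add2r j).
  exact: leq_trans h hj.
move=> j; rewrite coef_map mul1n /=; case: (hF j) => [|->]; last first.
  by rewrite rmorph0; apply: weight0.
rewrite mul1n => h.
have [->|F0] := eqVneq F`_j 0; first by rewrite rmorph0; apply: weight0.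
apply: weight_emb; have hj : (j <= k)%N.
  by rewrite -ltnS; apply: leq_trans h; rewrite -add1n leq_add2r lt0n msize_poly_eq0.
by rewrite -(leq_add2r j) addSn subnK.
Qed.

Variables (r : R) (q h : {poly R}).
Hypothesis ngr : ~ dvdr g r.
Hypothesis rpqh : forall i, dvdr g (r * p`_i - (q * h)`_i).
Local Notation dg := (dirder (vext v) g).

Section Split.
Variables (K0 K : fieldType) (i0 : {rmorphism S0 -> K0}) (j : {rmorphism K0 -> K}).
Variables (emb : {rmorphism S0 -> K}) (s sb : seq K).
Hypotheses (emb_inj : injective emb) (embE : forall x, emb x = j (i0 x)).
Hypothesis fracK0 : forall z, exists a b, b != 0 /\ i0 b * z = i0 a.
Local Notation val := (value emb).
Local Notation G := (map_poly emb (lchange v g)).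
Hypothesis eG : G = emb c0%:MP *: \prod_(a <- s) ('X - a%:P).
Hypothesis hsb : forall a, a \in s -> map_poly (val a) p %| \prod_(b <- sb) ('X - b%:P).

Let c00 : emb c0%:MP != 0.
Proof. by rewrite -[0](rmorph0 emb) (inj_eq emb_inj) mpolyC_eq0. Qed.

Let rG a : (a \in s) = root G a.
Proof. by rewrite eG rootZ // root_prod_XsubC. Qed.

Lemma value_eq0 a : a \in s -> forall f, val a f = 0 <-> dvdr g f.
Proof.
move=> ha f; rewrite rG in ha; split; first exact: value_kernel.
by case=> t ->; rewrite valueM (eqP ha : val a g = 0) mulr0.
Qed.

Let ss : size s = N.
Proof.
have [sg _] := size_lchange.
have := size_map_inj_poly emb_inj (rmorph0 _) (lchange v g); rewrite eG size_scale //.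
by rewrite size_prod_XsubC sg => -[].
Qed.

Let msize_gt0 : (0 < msize g)%N.
Proof. by rewrite lt0n msize_poly_eq0 prime_elt_neq0. Qed.

Let N_gt0 : (0 < N)%N.
Proof. by rewrite /N -ltnS prednK //; apply: prime_msize_gt1. Qed.

Let value_deriv a : val a dg = G^`().[a].
Proof. by rewrite /value /= /horner_eval lchange_deriv deriv_map. Qed.

(** At a multiple root the derivative of [g] along the line would vanish, hence be divisible by [g];
    but it has smaller degree along the line and is nonzero in characteristic zero. *)
Lemma root_simple a : a \in s -> G^`().[a] != 0.
Proof.
have [sg lg] := size_lchange.
move=> ha; apply/eqP; rewrite -value_deriv => /(value_eq0 ha)[t et].
have := congr1 (lchange v) et; rewrite lchange_deriv.
have -> : lchange v (t * g) = lchange v t * lchange v g by exact: rmorphM.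
move=> e1; have g0 : lchange v g != 0 by rewrite -size_poly_eq0 sg.
have d0 : (lchange v g)^`() != 0.
  apply/eqP => /(congr1 (fun q : {poly S0} => q`_N.-1)).
  rewrite coef_deriv coef0 prednK //.
  have := lead_coefE (lchange v g); rewrite sg lg /= => <- /eqP.
  by rewrite -mulr_natr -mpolyC_nat -mpolyCM mpolyC_eq0 mulf_eq0 (negPf gv) Num.Theory.pnatr_eq0 eqn0Ngt N_gt0.
have t0 : lchange v t != 0 by apply: contraNneq d0 => t0; rewrite e1 t0 mul0r.
have := size_le_mull t0 g0; rewrite -e1 sg => hs.
have h2 : (size (lchange v g)^`() <= (size (lchange v g)).-1)%N by exact: size_poly.
by move: (leq_trans hs h2); rewrite sg ltnn.
Qed.

Let us : uniq s.
Proof.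
apply: contraT => /(uniqPn 0)[i [k [ik hk e1]]].
have hi := ltn_trans ik hk.
have := root_simple (mem_nth 0 hi); rewrite eG derivZ.
rewrite (big_nth 0) (big_mkord xpredT (fun i => 'X - (s`_i)%:P)).
rewrite (bigD1 (Ordinal hi)) //= (bigD1 (Ordinal hk)) /=; last first.
  by rewrite -(inj_eq val_inj) /= eq_sym neq_ltn ik.
rewrite -e1 mulrA !derivM !derivB !derivX !derivC !subr0 mul1r mulr1.
case/eqP; rewrite hornerZ hornerD !hornerM hornerXsubC subrr.
by rewrite [('X - _ + _).[_]]hornerD hornerXsubC subrr !(mul0r, mulr0, addr0, add0r).
Qed.

Let factor a : {poly K} := emb c0%:MP *: \prod_(b <- rem a s) ('X - b%:P).

Let factorE a : a \in s -> G = ('X - a%:P) * factor a.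
Proof. by move=> ha; rewrite eG (big_rem a) //= /factor -scalerAr. Qed.

Let weight_point a : a \in s -> weight emb 1 a.
Proof.
rewrite rG => ra; have [sg lg] := size_lchange.
have gdeg : weighted emb 1 N (map_poly emb ((c0^-1)%:MP *: lchange v g)).
  apply: xdeg_weighted; rewrite -mul_polyC -[N]add0n; apply: xdegM; first exact: xdegC.
  by apply: lchange_xdeg; rewrite prednK.
have mF : (c0^-1)%:MP *: lchange v g \is monic.
  by rewrite monicE lead_coefZ lg -mpolyCM mulVf ?mpolyC1.
apply: (weight_root _ _ gdeg); first exact: monic_map.
  by rewrite (size_map_inj_poly emb_inj (rmorph0 _)) size_scale ?sg // mpolyC_eq0 invr_eq0.
by rewrite map_polyZ /= rootZ // -[0](rmorph0 emb) (inj_eq emb_inj) mpolyC_eq0 invr_eq0.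
Qed.

Let weight_value k f a : a \in s -> (msize f <= k.+1)%N -> weight emb k (val a f).
Proof.
move=> ha hf; rewrite -[k]mul1n; apply: weighted_horner; last exact: weight_point.
by apply: xdeg_weighted; apply: lchange_xdeg.
Qed.

Let value_r a : a \in s -> val a r != 0.
Proof. by move=> ha; apply/eqP => /(value_eq0 ha). Qed.

Let H a : {poly K} := (val a r)^-1 *: (map_poly (val a) h * (map_poly (val a) q)^`()).

Let weighted_H a : a \in s -> weighted emb w e.-1 (H a) /\ (e = 0%N -> H a = 0).
Proof.
move=> ha; pose pa := map_poly (val a) p.
have mpa : pa \is monic by apply: monic_map.
have spa : size pa = e.+1 by rewrite size_map_poly_id0 ?sp // (monicP mp) rmorph1 oner_neq0.
have wpa : weighted emb w e pa.
  by split=> [|i]; rewrite ?spa // coef_map; apply: weight_value.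
have e1 : val a r *: pa = map_poly (val a) q * map_poly (val a) h.
  by apply: map_poly_relation => i; apply/(value_eq0 ha)/rpqh.
exact: weighted_cofactor mpa spa wpa (hsb ha) (value_r ha) e1.
Qed.

Let value_target a i : val a (dg%:P * (h * q^`()))`_i =
  G^`().[a] * (map_poly (val a) h * (map_poly (val a) q)^`())`_i.
Proof. by rewrite coefCM valueM value_deriv deriv_mapM coef_map. Qed.

(** Inverting [r] modulo [g] over the fraction field of [S0] gives a solution [eta0] without control
    of degree. Lagrange interpolation at the roots [s] rewrites it as a sum of terms of known
    weight, and [weight_frac] turns its coefficients into polynomials of bounded degree. *)
Lemma interpolation_coef i : exists E : {poly S0}, [/\ xdeg 1 (N.-1 + w * (e.-1 - i)) E,
  (e <= i)%N -> E = 0 & forall a, a \in s -> (map_poly emb E).[a] = G^`().[a] * (H a)`_i].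
Proof.
pose m0 x : {poly K0} := map_poly i0 (lchange v x).
have m0E x a : (map_poly j (m0 x)).[a] = val a x.
  rewrite /m0 /value /= /horner_eval -map_poly_comp; congr (_.[_]).
  by apply: eq_map_poly => y /=; rewrite embE.
have jm0g : map_poly j (m0 g) = G.
  by rewrite /m0 -map_poly_comp; apply: eq_map_poly => y /=; rewrite embE.
have m0g0 : m0 g != 0.
  by rewrite -(map_poly_eq0 j) jm0g eG scaler_eq0 (negPf c00) /= monic_neq0 // monic_prod_XsubC.
have cop : coprimep (m0 r) (m0 g).
  by apply: coprimep_of_roots (etrans jm0g eG) c00 _ => x /value_r; rewrite m0E.
have [eta0 [seta0 heta0]] := modular_quotient j (m0 (dg%:P * (h * q^`()))`_i) cop m0g0.
pose eta := map_poly j eta0.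
have seta : (size eta <= size s)%N.
  rewrite size_map_poly ss -ltnS; apply: leq_trans seta0 _.
  by rewrite -(size_map_poly j) jm0g eG size_scale // size_prod_XsubC ss.
have eta_val a : a \in s -> eta.[a] = G^`().[a] * (H a)`_i.
  move=> ha; have ga : (map_poly j (m0 g)).[a] = 0 by rewrite jm0g; apply/rootP; rewrite -rG.
  apply: (mulfI (value_r ha)); rewrite -[in LHS]m0E heta0 // m0E value_target.
  by rewrite /H coefZ [RHS]mulrCA mulVKf ?value_r.
have eta_sum : eta = \sum_(a <- s) (H a)`_i *: factor a.
  apply: (lagrange_interpolation (G := G)) => //.
  move=> a ha; rewrite /factor size_scale // size_prod_XsubC size_rem // prednK //.
  by rewrite ss.
have eta0_out : (e <= i)%N -> eta = 0.
  move=> hi; rewrite eta_sum big_seq big1 // => a ha; have [[sH _] H0] := weighted_H ha.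
  have [e0|e0] := posnP e; first by rewrite H0 // coef0 scale0r.
  by rewrite nth_default ?scale0r //; apply: leq_trans sH _; rewrite prednK.
have wfactor a : a \in s -> weighted emb 1 N.-1 (factor a).
  move=> ha; have -> : N.-1 = (0 + size (rem a s))%N by rewrite size_rem // ss.
  rewrite /factor -mul_polyC; apply: weightedM; last first.
    by apply: weighted_prod => b /mem_rem /weight_point.
  split=> [|[|k]]; rewrite ?size_polyC_leq1 // coefC /=; last exact: weight0.
  by apply: weight_emb; rewrite msizeC; case: eqP.
have ex k : exists c, j (eta0`_k) = emb c /\ ((k <= N.-1)%N -> (msize c + k <= (N.-1 + w * (e.-1 - i)).+1)%N).
  have [a [b [b0 hb]]] := fracK0 eta0`_k.
  have [kN|kN] := leqP k N.-1; last first.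
    exists 0; split=> //; rewrite rmorph0 -coef_map nth_default //.
    by apply: leq_trans seta _; rewrite ss -(prednK N_gt0).
  have [|||c ec sc] := @weight_frac n K emb emb_inj (N.-1 - k + w * (e.-1 - i))%N a b (j eta0`_k) => //.
    - by rewrite !embE -rmorphM hb.
    - rewrite -coef_map -/eta eta_sum coef_sum big_seq; apply: weight_sum => a' ha'.
      rewrite coefZ mulrC; apply: weightM.
        by have [_] := wfactor _ ha'; move/(_ k); rewrite mul1n.
      by have [[_ hH] _] := weighted_H ha'.
  exists c; split=> // _; rewrite -(leq_add2r k) in sc; apply: leq_trans sc _.
  by rewrite addSn addnAC subnK.
have [c hc] := choice ex.
pose E := \poly_(k < N) c k.
have eE : map_poly emb E = eta.
  have ek k : eta`_k = emb (c k) by rewrite coef_map; case: (hc k).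
  apply/polyP => k; rewrite coef_map coef_poly /=; case: ltnP => hk; first by rewrite ek.
  by rewrite rmorph0 [RHS]nth_default // (leq_trans seta) // ss.
exists E; split.
- move=> k; rewrite coef_poly; case: ltnP => hk; last by right.
  by left; rewrite mul1n; have [_] := hc k; apply; rewrite -ltnS prednK.
- by move=> hi; apply: (map_inj_poly emb_inj (rmorph0 _)); rewrite eE eta0_out // rmorph0.
by move=> a ha; rewrite eE eta_val.
Qed.

Lemma split_interpolation : exists eta : {poly R},
  [/\ (size eta <= e)%N, (forall i, (msize eta`_i <= (N.-1 + w * (e.-1 - i)).+1)%N)
    & forall i, dvdr g (r * eta`_i - (dg%:P * (h * q^`()))`_i)].
Proof.
have [E hE] := choice interpolation_coef.
have eE i : (\poly_(i < e) lback v (E i))`_i = lback v (E i).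
  rewrite coef_poly; case: ltnP => // hi; have [_ -> // _] := hE i.
  exact/esym/rmorph0.
exists (\poly_(i < e) lback v (E i)); split.
- exact: size_poly.
- by move=> i; rewrite eE; apply: lback_msize; case: (hE i).
move=> i; rewrite eE.
have [a ha] : exists a, a \in s by move: N_gt0; rewrite -ss; case: (s) => // a s' _; exists a; rewrite mem_head.
apply/(value_eq0 ha); rewrite valueB valueM.
have -> : val a (lback v (E i)) = G^`().[a] * (H a)`_i.
  by have [_ _ <- //] := hE i; rewrite /value /= lbackK.
rewrite value_target /H coefZ; apply/eqP; rewrite subr_eq0; apply/eqP.
by rewrite mulrCA mulVKf ?value_r.
Qed.

End Split.

Lemma directional_interpolation : exists eta : {poly R},
  [/\ (size eta <= e)%N, (forall i, (msize eta`_i <= (N.-1 + w * (e.-1 - i)).+1)%N)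
    & forall i, dvdr g (r * eta`_i - (dg%:P * (h * q^`()))`_i)].
Proof.
have [K [j [s [sb [eG hsb]]]]] := splitting_data.
apply: (@split_interpolation {fraction S0} K (@FracField.tofrac S0) j (j \o @FracField.tofrac S0) s sb) => //.
  by move=> x y /= /fmorph_inj /eqP; rewrite tofrac_eq => /eqP.
exact: frac_clear_denom.
Qed.

End DirectionalInterpolation.

Lemma coef_combination (R0 : comNzRingType) (r a b c : R0) (E E' F : {poly R0}) i :
  r * E`_i - (a%:P * F)`_i + c * (r * E'`_i - (b%:P * F)`_i) =
  r * (E + c *: E')`_i - ((a + c * b)%:P * F)`_i.
Proof. by rewrite coefD coefZ !coefCM; ring. Qed.

(** Provides a second admissible direction differing from [v] in one coordinate, so that the
    difference of the two is a nonzero multiple of a coordinate vector. *)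
Lemma generic_shift n (T : {mpoly CC[n.+1]}) (v : 'I_n -> CC) (j : 'I_n) :
  T.@[vext v] != 0 -> exists2 t, t != 0 & T.@[vext (fun i => v i + (i == j)%:R * t)] != 0.
Proof.
move=> Tv; pose x i : {poly CC} := (vext v i)%:P + (i == lift ord_max j)%:R%:P * 'X.
pose F := mmap (@polyC CC) x T.
have FE t : F.[t] = T.@[vext (fun i => v i + (i == j)%:R * t)].
  apply: (mpoly_hom_ext (f := horner_eval t \o mmap (@polyC CC) x) (g := meval _)) => [a|i] /=.
    by rewrite mmapC /horner_eval hornerC mevalC.
  rewrite mmapX mmap1U mevalXU /horner_eval /x hornerD hornerM !hornerC hornerX /vext.
  case: (unliftP ord_max i) => [l|] ->; first by rewrite (inj_eq lift_inj).
  by rewrite (negPf (neq_lift _ _)) mul0r addr0.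
have F0 : 'X * F != 0.
  rewrite mulf_neq0 ?polyX_eq0 //; apply: contraNneq Tv => F0.
  have := FE 0; rewrite F0 horner0 => /esym/eqP; congr (_ == _).
  by apply: meval_eq => i; rewrite /vext; case: unlift => // l; rewrite mulr0 addr0.
have [t ht] := poly_avoid (fun=> F0); move: (ht 0%N).
by rewrite hornerM hornerX mulf_eq0 negb_or FE => /andP[t0 tT]; exists t.
Qed.

Lemma vext_decomposition n (v : 'I_n -> CC) i :
  vext v i + \sum_j - v j * (i == lift ord_max j)%:R = (i == ord_max)%:R.
Proof.
rewrite /vext; case: (unliftP ord_max i) => [l|] ->.
  have -> : (lift ord_max l == ord_max) = false by rewrite eq_sym (negPf (neq_lift _ _)).
  rewrite (bigD1 l) //= eqxx mulr1 big1 => [|j jl]; first by rewrite addr0 subrr.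
  by rewrite (inj_eq lift_inj) eq_sym (negPf jl) mulr0.
by rewrite eqxx big1 ?addr0 // => j _; rewrite (negPf (neq_lift _ _)) mulr0.
Qed.

(* In the fraction field of [R[y]/p] the form with components [eta_k / (g p'(y))]
   has a simple pole with residue 1 along the prime over [g] where [q(y)]
   vanishes, and no pole along the other primes over [g].  By Lagrange
   interpolation at the roots of [g] its degree at infinity is bounded. *)
Lemma gradient_interpolation d w e (p : {poly {mpoly CC[d]}}) (g r : {mpoly CC[d]})
    (q h : {poly {mpoly CC[d]}}) (k : 'I_d) :
  p \is monic -> size p = e.+1 -> (forall i, (msize p`_i <= (w * (e - i)).+1)%N) ->
  prime_elt g -> ~ dvdr g r -> (forall i, dvdr g (r * p`_i - (q * h)`_i)) ->
  exists eta : {poly {mpoly CC[d]}}, [/\ (size eta <= e)%N,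
    (forall i, (msize eta`_i <= ((msize g).-2 + w * (e.-1 - i)).+1)%N)
    & forall i, dvdr g (r * eta`_i - ((g^`M(k))%:P * (h * q^`()))`_i)].
Proof.
case: d p g r q h k => [|n] p g r q h k mp sp wp pg ngr rpqh; first by case: k.
(* The solvable directions are closed under linear combinations with the same degree bound, and the
   admissible ones span, so coordinate directions are reached although they may themselves be
   inadmissible. *)
pose good (u : 'I_n.+1 -> CC) := exists eta : {poly {mpoly CC[n.+1]}}, [/\ (size eta <= e)%N,
    (forall i, (msize eta`_i <= ((msize g).-2 + w * (e.-1 - i)).+1)%N)
    & forall i, dvdr g (r * eta`_i - ((dirder u g)%:P * (h * q^`()))`_i)].
have goodL c u u' : good u -> good u' -> good (fun i => u i + c * u' i).
  move=> [E [h1 h2 h3]] [E' [h1' h2' h3']]; exists (E + c%:MP *: E'); split.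
  - apply: leq_trans (size_polyD _ _) _; rewrite geq_max h1.
    exact: leq_trans (size_scale_leq _ _) h1'.
  - move=> i; rewrite coefD coefZ; apply: leq_trans (msizeD_le _ _) _; rewrite geq_max h2 /=.
    by apply: (@msizeM_bound _ c%:MP E'`_i 0) => //; rewrite msizeC; case: eqP.
  move=> i; have := dvdrD (h3 i) (dvdr_mull c%:MP (h3' i)).
  have -> : dirder (fun i => u i + c * u' i) g = dirder u g + c%:MP * dirder u' g.
    rewrite /dirder mulr_sumr -big_split; apply: eq_bigr => l _ /=.
    by rewrite mpolyCD mpolyCM mulrDl mulrA.
  by rewrite coef_combination.
have good_ext u u' : u =1 u' -> good u -> good u'.
  by move=> /funext ->.
have [v hv] := topform_direction (prime_elt_neq0 pg).
have goodv v' : (topform g).@[vext v'] != 0 -> good (vext v').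
  by move=> h'; apply: (directional_interpolation pg h' mp sp wp ngr rpqh).
pose dl k := fun i : 'I_n.+1 => (i == k)%:R : CC.
have goodj j : good (dl (lift ord_max j)).
  have [t t0 ht] := generic_shift j hv.
  have good0 : good (fun=> 0).
    apply: good_ext (goodL (-1) _ _ (goodv v hv) (goodv v hv)) => i.
    by rewrite mulN1r subrr.
  apply: good_ext (goodL t^-1 _ _ good0 (goodL (-1) _ _ (goodv _ ht) (goodv _ hv))) => i.
  rewrite add0r mulN1r /dl /vext; case: (unliftP ord_max i) => [l|] ->.
    by rewrite (inj_eq lift_inj) addrAC subrr add0r mulrC mulfK.
  by rewrite subrr mulr0 (negPf (neq_lift _ _)).
have goodk : good (dl k).
  case: (unliftP ord_max k) => [j|] ->; first exact: goodj.
  have hs s : good (fun i => vext v i + \sum_(j <- s) - v j * dl (lift ord_max j) i).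
    elim: s => [|j s IH].
      by apply: good_ext (goodv v hv) => i; rewrite big_nil addr0.
    apply: good_ext (goodL (- v j) _ _ IH (goodj j)) => i.
    by rewrite big_cons addrCA addrC -addrA; congr (_ + _); rewrite addrC.
  apply: good_ext (hs (index_enum _)) => i.
  exact: vext_decomposition.
have -> : g^`M(k) = dirder (dl k) g.
  rewrite /dirder (bigD1 k) //= big1 => [|i ik]; last by rewrite /dl (negPf ik) mpolyC0 mul0r.
  by rewrite /dl eqxx mpolyC1 mul1r addr0.
exact: goodk.
Qed.

(** * Residue forms *)

Section LocalAnalysis.
Variables (A : comAlgType CC) (P : set A) (F : fieldType) (iota : {rmorphism A -> F}).
Hypotheses (pP : prime_ideal P) (hfrac : is_frac_of_quotient P iota).
Variables (R : idomainType) (sA : {rmorphism R -> A}) (y : A).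

Definition peval : {poly R} -> A := horner_eval y \o map_poly sA.
HB.instance Definition _ := GRing.RMorphism.on peval.

Definition frac_eval : {poly R} -> F := iota \o peval.
HB.instance Definition _ := GRing.RMorphism.on frac_eval.

Local Notation E := peval.
Local Notation e := frac_eval.

Lemma pevalC r : E r%:P = sA r.
Proof. by rewrite /peval /= map_polyC /horner_eval hornerC. Qed.
Lemma pevalX : E 'X = y.
Proof. by rewrite /peval /= map_polyX /horner_eval hornerX. Qed.
Lemma pevalD f g : E (f + g) = E f + E g. Proof. exact: rmorphD. Qed.
Lemma pevalM f g : E (f * g) = E f * E g. Proof. exact: rmorphM. Qed.
Lemma frac_evalC r : e r%:P = iota (sA r). Proof. by rewrite /frac_eval /= pevalC. Qed.
Lemma frac_evalE f : e f = iota (E f). Proof. by []. Qed.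

Lemma frac_evalZ r f : e (r *: f) = iota (sA r) * e f.
Proof. by rewrite -mul_polyC /frac_eval /= pevalM pevalC rmorphM. Qed.

Section Regular.
Variable n : set A.
Hypotheses (pn : prime_ideal n) (Pn : P `<=` n).

Definition regular (z : F) := exists s, ~ n s /\ exists a, iota s * z = iota a.

Lemma prime_notM s t : ~ n s -> ~ n t -> ~ n (s * t).
Proof. by case: pn => _ _ h ns nt /h[]. Qed.

Lemma iota_neq0 s : ~ n s -> iota s != 0.
Proof. by move=> ns; apply/eqP => /hfrac.1 /Pn. Qed.

Lemma regular_iota a : regular (iota a).
Proof. by exists 1; split; [case: pn|exists a; rewrite rmorph1 mul1r]. Qed.

Lemma regularD z t : regular z -> regular t -> regular (z + t).
Proof.
move=> [s [ns [a ha]]] [s' [ns' [a' ha']]]; exists (s * s'); split; first exact: prime_notM.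
by exists (s' * a + s * a'); rewrite !(rmorphM, rmorphD) -ha -ha'; ring.
Qed.

Lemma regularM z t : regular z -> regular t -> regular (z * t).
Proof.
move=> [s [ns [a ha]]] [s' [ns' [a' ha']]]; exists (s * s'); split; first exact: prime_notM.
by exists (a * a'); rewrite !rmorphM -ha -ha'; ring.
Qed.

Lemma regularN z : regular z -> regular (- z).
Proof. by move=> [s [ns [a ha]]]; exists s; split=> //; exists (- a); rewrite mulrN ha rmorphN. Qed.

Lemma regular_sum (I : Type) (r : seq I) (f : I -> F) :
  (forall i, regular (f i)) -> regular (\sum_(i <- r) f i).
Proof.
move=> h; apply: (big_ind regular) => //; last exact: regularD.
by rewrite -(rmorph0 iota); apply: regular_iota.
Qed.

Lemma regular_cancel s z : ~ n s -> regular (iota s * z) -> regular z.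
Proof.
move=> ns [t [nt [a ha]]]; exists (t * s); split; first exact: prime_notM.
by exists a; rewrite rmorphM -mulrA.
Qed.

Lemma regular_der (D : F -> F) : is_der D -> (forall a, regular (D (iota a))) ->
  forall z, regular z -> regular (D z).
Proof.
move=> dD hD z [s [ns [a ha]]]; apply: (regular_cancel ns).
have := congr1 D ha; rewrite dD.2 => /(canRL (addrK _)) ->.
apply: regularD => //; apply: regularN; apply: regularM => //.
by exists s; split=> //; exists a.
Qed.

End Regular.

Variables (p w0 : {poly R}) (D0 : R).
Hypotheses (mp : p \is monic) (ep0 : e p = 0) (ekerp : forall f, e f = 0 -> dvdr p f).
Hypothesis sA_inj : forall r, P (sA r) -> r = 0.
Hypothesis eden : forall a, exists k f, iota (sA D0) ^+ k * iota a = e f.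
Hypothesis ew : e (p^`() * w0) = iota (sA D0).

Variables (Q : set A) (g : R).
Hypotheses (pQ : prime_ideal Q) (PQ : P `<=` Q) (pg : prime_elt g).
Hypotheses (Qg : Q (sA g)) (Qc : forall b, Q (sA b) -> dvdr g b).
Hypothesis gD0 : ~ dvdr g D0.
Hypothesis Qmax : forall n, prime_ideal n -> (forall b, n (sA b) -> dvdr g b) -> Q `<=` n -> n `<=` Q.

Let Q_iota a b : iota a = iota b -> Q a -> Q b.
Proof.
have [[_ QD _] _ _] := pQ; move=> h Qa; rewrite -[b](subrK a) addrC; apply: QD => //.
by apply: PQ; apply/hfrac.1; rewrite rmorphB h subrr.
Qed.

Let notQ r : ~ dvdr g r -> ~ Q (sA r). Proof. by move=> h /Qc. Qed.

(* The factorization of the minimal polynomial [p] modulo [g] in which [q] is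
   the minimal polynomial of [y] modulo [Q]. *)
Definition splits_at (q h : {poly R}) r (rho : {poly R}) := [/\ Q (E q), ~ dvdr g (lead_coef q),
  (forall f, Q (E f) -> ~ dvdr g (lead_coef f) -> (size q <= size f)%N),
  ~ dvdr g r & r *: p = q * h + g *: rho].

(** By minimality of [q] the leading coefficient of [f] is divisible by [g]; removing the leading
    term stays in [Q] and below the degree of [q]. *)
Lemma small_dvdr (q f : {poly R}) : (forall f, Q (E f) -> ~ dvdr g (lead_coef f) -> (size q <= size f)%N) ->
  Q (E f) -> (size f < size q)%N -> exists f1, f = g *: f1.
Proof.
move=> hq; have [[Q0 QD QM] _ _] := pQ.
elim: {f}(size f) {-2}f (leqnn (size f)) => [|n IH] f hn Qf sf.
  by exists 0; move: hn; rewrite leqn0 size_poly_eq0 scaler0 => /eqP.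
have [f0|f0] := eqVneq f 0; first by exists 0; rewrite f0 scaler0.
have [c hc] : dvdr g (lead_coef f).
  by apply: contrapT => h; have := hq f Qf h; rewrite leqNgt sf.
pose t : {poly R} := c%:P * 'X^((size f).-1).
have et : f = (f - g *: t) + g *: t by rewrite subrK.
have [|||f1 e1] := IH (f - g *: t).
- rewrite -ltnS; apply: leq_trans hn.
  have -> : g *: t = lead_coef f *: 'X^((size f).-1) by rewrite /t mul_polyC scalerA hc mulrC.
  have sp : (0 < size f)%N by rewrite size_poly_gt0.
  rewrite -{2}(prednK sp) ltnS; apply/leq_sizeP => i hi; rewrite coefB coefZ coefXn.
  case: eqP => [->|/eqP ni]; first by rewrite mulr1 lead_coefE subrr.
  rewrite mulr0 subr0 nth_default // -(prednK sp) ltn_neqAle hi andbT eq_sym //.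
- rewrite pevalD; apply: (QD) => //; rewrite -scalerN -mul_polyC pevalM pevalC mulrC.
  exact: QM.
- apply: leq_ltn_trans (size_polyD _ _) _; rewrite gtn_max sf size_polyN /=.
  apply: leq_ltn_trans (size_scale_leq _ _) _.
  apply: leq_ltn_trans (size_polyMleq _ _) _; rewrite size_polyXn.
  apply: leq_ltn_trans sf; have sp : (0 < size f)%N by rewrite size_poly_gt0.
  by rewrite prednK //; have := size_polyC_leq1 c; case: (size c%:P) => [|[]] //= _; rewrite leq_pred.
by exists (f1 + t); rewrite et e1 scalerDr.
Qed.

Lemma pseudo_division (q f : {poly R}) : Q (E q) -> ~ dvdr g (lead_coef q) ->
  (forall f, Q (E f) -> ~ dvdr g (lead_coef f) -> (size q <= size f)%N) ->
  Q (E f) -> exists r t rho, ~ dvdr g r /\ r *: f = q * t + g *: rho.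
Proof.
move=> Qq lq hq Qf; have [[Q0 QD QM] _ _] := pQ.
have q0 : q != 0.
  by apply: contra_notN lq => /eqP ->; rewrite lead_coef0; apply: dvdr0.
have e1 := Pdiv.Idomain.divp_eq f q.
have [||rho erho] := @small_dvdr q (f %% q) hq.
- have -> : f %% q = lead_coef q ^+ scalp f q *: f - f %/ q * q by rewrite e1 addrC addKr.
  rewrite rmorphB /=; apply: ideal_sub; first by split.
    by rewrite -mul_polyC pevalM; apply: QM.
  by rewrite pevalM; apply: QM.
- by rewrite ltn_modp.
exists (lead_coef q ^+ scalp f q), (f %/ q), rho; split; first by move/(prime_dvdX pg).
by rewrite e1 erho mulrC.
Qed.

Lemma splits_at_exists : exists q h r rho, splits_at q h r rho.
Proof.
have Qp : Q (E p) by apply: PQ; apply/hfrac.1.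
pose b n := `[< exists q : {poly R}, [/\ size q = n, Q (E q) & ~ dvdr g (lead_coef q)] >].
have ex : exists n, b n.
  exists (size p); apply/asboolP; exists p; split=> //; rewrite (monicP mp).
  exact: prime_ndvd1.
case: (ex_minnP ex) => n /asboolP[q [sq Qq lq]] hn.
have hq f : Q (E f) -> ~ dvdr g (lead_coef f) -> (size q <= size f)%N.
  by move=> Qf lf; rewrite sq; apply: hn; apply/asboolP; exists f.
by have [r [h [rho [gr e1]]]] := pseudo_division Qq lq hq Qp; exists q, h, r, rho.
Qed.

(** If no element of R outside (g) were a denominator of [z], some prime contracting into (g) would
    contain all denominators. As g^2 r0 is one of them, this prime contains [g], and [z] would fail
    to be regular there. *)
Lemma regular_denominator z r0 a0 : ~ dvdr g r0 ->
  iota (sA g) ^+ 2 * iota (sA r0) * z = iota a0 ->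
  (forall n, prime_ideal n -> P `<=` n -> (forall b, n (sA b) -> dvdr g b) -> n (sA g) ->
    regular n z) ->
  exists r1 a, ~ dvdr g r1 /\ iota (sA r1) * z = iota a.
Proof.
move=> gr0 hz hreg; apply: contrapT => H.
pose I c := exists a, iota c * z = iota a.
pose T x := exists2 s, ~ dvdr g s & x = sA s.
have [||||n [pn In nT]] := @krull_prime A I T.
- split.
  + by exists 0; rewrite rmorph0 mul0r.
  + by move=> a b [c hc] [c' hc']; exists (c + c'); rewrite !rmorphD mulrDl hc hc'.
  + by move=> b a [c hc]; exists (b * c); rewrite !rmorphM -mulrA hc.
- exists 1; last by rewrite rmorph1.
  by apply: prime_ndvd1.
- move=> _ _ [s hs ->] [s' hs' ->]; exists (s * s'); last by rewrite rmorphM.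
  by case/(prime_dvdM pg).
- by move=> x [a ha] [s hs es]; apply: H; exists s, a; rewrite -es.
have [_ n1 nP] := pn.
have nc b : n (sA b) -> dvdr g b by move=> nb; apply: contrapT => hb; apply: (nT _ nb); exists b.
have ng : n (sA g).
  have : n (sA g * (sA g * sA r0)) by apply: In; exists a0; rewrite -hz !rmorphM mulrA.
  by case/nP => // /nP[|/nc].
have Pn : P `<=` n by move=> x /hfrac.1 Px; apply: In; exists 0; rewrite Px mul0r rmorph0.
have [s [ns hs]] := hreg n pn Pn nc ng.
by apply: ns; apply: In.
Qed.

(** The polynomials r1 D0^k f and g^2 times a remainder modulo [p] represent the same element in
    degree below that of [p], so they coincide; and [g] divides neither [r1] nor [D0]. *)
Lemma square_dvdr z (f : {poly R}) r1 a : (size f < size p)%N -> iota (sA g) ^+ 2 * z = e f ->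
  ~ dvdr g r1 -> iota (sA r1) * z = iota a -> forall i, dvdr (g ^+ 2) f`_i.
Proof.
move=> sf hz gr1 ha i; have [k [f2 hf2]] := eden a.
have p0 := monic_neq0 mp.
have ef : e (f2 %% p) = e f2.
  have := Pdiv.Idomain.divp_eq f2 p; rewrite (monicP mp) expr1n scale1r => /(congr1 e).
  by rewrite [X in _ = X -> _]rmorphD rmorphM /= ep0 mulr0 add0r.
pose t := (r1 * D0 ^+ k) *: f - g ^+ 2 *: (f2 %% p).
have et : e t = 0.
  rewrite /t rmorphB /= !frac_evalZ ef -hf2 -hz -ha (rmorphM sA) !(rmorphXn sA) (rmorphM iota) !(rmorphXn iota).
  by ring.
have t0 : t = 0.
  apply/eqP; apply: contraT => tn; have [c hc] := ekerp et.
  have c0 : c != 0 by apply: contraNneq tn => z0; rewrite hc z0 mul0r.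
  have st : (size t < size p)%N.
    apply: leq_ltn_trans (size_polyD _ _) _; rewrite gtn_max size_polyN.
    rewrite (leq_ltn_trans (size_scale_leq _ _)) //= (leq_ltn_trans (size_scale_leq _ _)) //.
    by rewrite ltn_modp.
  by have := size_le_mull c0 p0; rewrite -hc leqNgt st.
have : r1 * D0 ^+ k * f`_i = (f2 %% p)`_i * g ^+ 2.
  have := congr1 (fun u : {poly R} => u`_i) t0; rewrite /t /= coefB !coefZ coef0 => /eqP.
  by rewrite subr_eq0 => /eqP ->; rewrite mulrC.
have gs : ~ dvdr g (r1 * D0 ^+ k) by case/(prime_dvdM pg) => // /(prime_dvdX pg).
move: (r1 * D0 ^+ k) gs => s gs hs.
have [//|[f1 e1]] : dvdr g s \/ dvdr g f`_i.
  by apply: (prime_dvdM pg); exists ((f2 %% p)`_i * g); rewrite hs; ring.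
have g0 := prime_elt_neq0 pg.
have : dvdr g (s * f1).
  by exists (f2 %% p)`_i; apply: (mulIf g0); rewrite -mulrA -e1 hs; ring.
by case/(prime_dvdM pg) => // -[f3 e3]; exists f3; rewrite e1 e3; ring.
Qed.

(** * Local structure at the primes over [g] *)

Section Splitting.
Variables (q h rho : {poly R}) (r : R).
Hypothesis hs : splits_at q h r rho.

Let Qq : Q (E q). Proof. by case: hs. Qed.
Let gr : ~ dvdr g r. Proof. by case: hs. Qed.
Let hpoly : r *: p = q * h + g *: rho. Proof. by case: hs. Qed.

Lemma frac_eval_qh : e q * e h = - (iota (sA g) * e rho).
Proof.
apply/eqP; rewrite -addr_eq0; apply/eqP.
have := congr1 e hpoly; rewrite -mul_polyC -[g *: _]mul_polyC rmorphD !rmorphM /=.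
by rewrite ep0 mulr0 !frac_evalC => /esym.
Qed.

Lemma discriminant_mod : iota (sA (r * D0)) =
  e (q^`() * w0) * e h + e (h^`() * w0) * e q + iota (sA g) * e (rho^`() * w0).
Proof.
have := congr1 (fun f => e (f^`() * w0)) hpoly; rewrite /= derivD derivM !derivZ.
rewrite -!mul_polyC -mulrA [LHS]rmorphM [LHS]/= ew frac_evalC => h1.
rewrite !rmorphM /= h1.
by rewrite !mulrDl !rmorphD /= !rmorphM /= frac_evalC; ring.
Qed.

Let grD : ~ dvdr g (r * D0). Proof. by move/(prime_dvdM pg) => []. Qed.

(** Differentiating r p = q h + g rho and multiplying by [w0] writes r D0 as a combination of q(y),
    h(y) and g; but r D0 is outside every prime contracting into (g). *)
Lemma comaximal n : prime_ideal n -> P `<=` n -> (forall b, n (sA b) -> dvdr g b) ->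
  n (sA g) -> n (E q) -> ~ n (E h).
Proof.
move=> [[n0 nD nM] _ _] Pn nc ng nq nh; apply: grD; apply: nc.
pose x := E (q^`() * w0) * E h + E (h^`() * w0) * E q + E (rho^`() * w0) * sA g.
rewrite -[sA _](subrK x); apply: (nD); last by apply: (nD); [apply: (nD)|]; apply: nM.
apply: Pn; apply/hfrac.1; rewrite rmorphB discriminant_mod /x !rmorphD !(rmorphM iota) /= -!frac_evalE.
by apply/eqP; rewrite subr_eq0; apply/eqP; congr (_ + _); rewrite mulrC.
Qed.

(** At [Q] both [r1] and h(y) are units, so [u] is locally a multiple of [g]. It is obtained from a
    division by [q], multiplied by h(y) to replace q(y) h(y) by - g rho(y). *)
Lemma uniformizer u : Q u -> exists r1 c, ~ dvdr g r1 /\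
  iota (sA r1 * E h * u) = iota (sA g) * iota c.
Proof.
move=> Qu; have [k [f hf]] := eden u.
have Qf : Q (E f).
  have [[_ _ QM] _ _] := pQ; apply: (@Q_iota (sA D0 ^+ k * u)); last exact: QM.
  by rewrite rmorphM rmorphXn.
have [_ lq hq _ _] := hs; have [r1 [t [rho1 [gr1 e1]]]] := pseudo_division Qq lq hq Qf.
exists (r1 * D0 ^+ k), (E h * E rho1 - E rho * E t); split.
  by case/(prime_dvdM pg) => // /(prime_dvdX pg).
have e2 := congr1 e e1; rewrite -mul_polyC -[g *: _]mul_polyC rmorphD !rmorphM /= !frac_evalC -hf in e2.
rewrite !rmorphM rmorphB !rmorphM !rmorphXn -!frac_evalE mulrAC.
have -> : iota (sA r1) * iota (sA D0) ^+ k * iota u * e h =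
  (iota (sA r1) * (iota (sA D0) ^+ k * iota u)) * e h by rewrite !mulrA.
rewrite e2 mulrDl mulrAC frac_eval_qh; ring.
Qed.

Lemma prime_over_unique n : prime_ideal n -> P `<=` n -> (forall b, n (sA b) -> dvdr g b) ->
  n (sA g) -> n (E q) -> n = Q.
Proof.
move=> pn Pn nc ng nq; have nh := comaximal pn Pn nc ng nq.
have [[n0 nD nM] n1 nP] := pn.
have Qn : Q `<=` n.
  move=> u /uniformizer[r1 [c [gr1 e1]]].
  have : n (sA r1 * E h * u).
    rewrite -[X in n X](subrK (c * sA g)); apply: nD; last exact: nM.
    by apply: Pn; apply/hfrac.1; rewrite rmorphB e1 rmorphM mulrC subrr.
  by case/nP => // /nP[/nc|].
by apply/seteqP; split=> //; apply: Qmax.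
Qed.

Section Form.
Variables (K : finType) (dR : K -> R -> R) (eta : K -> {poly R}).
Hypothesis heta : forall k i, dvdr g (r * (eta k)`_i - ((dR k g)%:P * (h * q^`()))`_i).

Lemma frac_eval_eta k : exists tau, iota (sA r) * e (eta k) =
  iota (sA (dR k g)) * (e h * e q^`()) + iota (sA g) * e tau.
Proof.
have [c hc] := choice (heta k).
set f := (dR k g)%:P * (h * q^`()) in hc *.
pose tau := \poly_(i < maxn (size (eta k)) (size f)) c i.
exists tau; have e1 : r *: eta k = f + g *: tau.
  apply/polyP => i; rewrite coefD !coefZ coef_poly; case: ltnP => hi.
    by apply/eqP; rewrite addrC -subr_eq mulrC [g * _]mulrC -hc mulrC.
  rewrite !nth_default ?mulr0 ?addr0 //; apply: leq_trans hi; [exact: leq_maxr|exact: leq_maxl].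
have := congr1 e e1; rewrite -mul_polyC -[g *: _]mul_polyC rmorphD !rmorphM /= !frac_evalC.
exact.
Qed.

(** The component on dX_k. At [Q], q(y) / g is regular, so r p'(y) and q'(y) h(y) differ by g times
    a regular element, and the component is that of dg / g up to a regular term. At other primes
    over [g], q(y) is a unit and h(y) = - g rho(y) / q(y) cancels the pole. *)
Definition residue_form k : F := e (eta k) / (iota (sA g) * e p^`()).
Local Notation omega := residue_form.

Let sg0 : iota (sA g) != 0.
Proof.
by apply/eqP => /hfrac.1 /sA_inj g0; have := prime_elt_neq0 pg; rewrite g0 eqxx.
Qed.

Lemma deriv_notin n : prime_ideal n -> P `<=` n -> ~ n (sA D0) -> ~ n (E p^`()).
Proof.
move=> [[n0 nD nM] _ _] Pn nD0 np; apply: nD0.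
rewrite -[sA D0](subrK (E w0 * E p^`())); apply: nD; last exact: nM.
by apply: Pn; apply/hfrac.1; rewrite rmorphB rmorphM -ew rmorphM mulrC subrr.
Qed.

Lemma residue_form_regular n k : prime_ideal n -> P `<=` n -> ~ n (sA D0) ->
  ~ n (sA g) \/ ~ n (E q) /\ (forall b, n (sA b) -> dvdr g b) -> regular n (omega k).
Proof.
move=> pn Pn nD0 hn; have np := deriv_notin pn Pn nD0.
have np0 := iota_neq0 Pn np; rewrite -frac_evalE in np0.
case: hn => [ng|[nq nc]].
  exists (sA g * E p^`()); split; first exact: prime_notM.
  exists (E (eta k)); rewrite rmorphM /omega -!frac_evalE mulrC divfK // mulf_neq0 //.
exists (sA r * E q * E p^`()); split.
  by apply: prime_notM => //; apply: prime_notM => // /nc.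
have [tau ht] := frac_eval_eta k.
exists (E q * E tau - sA (dR k g) * E q^`() * E rho).
rewrite rmorphB !rmorphM -!frac_evalE /omega.
apply: (mulIf sg0); have -> : iota (sA r) * e q * e p^`() * (e (eta k) / (iota (sA g) * e p^`())) * iota (sA g)
   = e q * (iota (sA r) * e (eta k)) by field; rewrite np0 sg0.
rewrite ht mulrDr; have -> : e q * (iota (sA (dR k g)) * (e h * e q^`())) =
   iota (sA (dR k g)) * e q^`() * (e q * e h) by ring.
by rewrite frac_eval_qh; ring.
Qed.

Lemma residue_form_pole k : regular Q (omega k - iota (sA (dR k g)) / iota (sA g)).
Proof.
have np := deriv_notin pQ PQ (notQ gD0).
have np0 := iota_neq0 PQ np; rewrite -frac_evalE in np0.
have [tau ht] := frac_eval_eta k.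
have rq : regular Q (e q / iota (sA g)).
  have [r1 [c [gr1 hc]]] := uniformizer Qq.
  apply: (@regular_cancel _ pQ (sA r1 * E h)).
    apply: prime_notM => //; first exact: notQ.
    exact: comaximal.
  rewrite frac_evalE mulrA -[_ * iota (E q)]rmorphM hc mulrAC mulfV // mul1r; exact: regular_iota.
have hp : iota (sA r) * e p^`() = e q^`() * e h + e q * e h^`() + iota (sA g) * e rho^`().
  have := congr1 (fun f => e f^`()) hpoly; rewrite /= derivD derivM !derivZ.
  by rewrite -!mul_polyC !rmorphD !rmorphM /= !frac_evalC.
apply: (@regular_cancel _ pQ (sA r * E p^`())).
  by apply: prime_notM => //; apply: notQ.
have -> : iota (sA r * E p^`()) * (omega k - iota (sA (dR k g)) / iota (sA g)) =
  e tau - iota (sA (dR k g)) * e rho^`() - iota (sA (dR k g)) * e h^`() * (e q / iota (sA g)).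
  apply: (mulIf sg0); rewrite rmorphM -frac_evalE /omega.
  have -> : iota (sA r) * e p^`() * (e (eta k) / (iota (sA g) * e p^`()) -
     iota (sA (dR k g)) / iota (sA g)) * iota (sA g) =
     iota (sA r) * e (eta k) - iota (sA (dR k g)) * (iota (sA r) * e p^`()).
    by field; rewrite np0 sg0.
  by rewrite ht hp; field.
have ri := @regular_iota _ pQ.
apply: regularD => //; first apply: regularD => //; first exact: ri.
  by apply: regularN => //; rewrite -rmorphM; apply: ri.
apply: regularN; apply: regularM => //; rewrite -rmorphM; exact: ri.
Qed.

Section Lie.
Variables (delta : F -> F) (beta : A -> A) (xi : K -> A) (pd : K -> F -> F).
Hypotheses (ddelta : is_der delta) (deltaE : forall a, delta (iota a) = iota (beta a)).
Hypothesis betaQ : forall u, Q u -> Q (beta u).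
Hypotheses (dpd : forall k, is_der (pd k)) (pdE : forall k r, pd k (iota (sA r)) = iota (sA (dR k r))).
Hypothesis pd_regular : forall k a n, prime_ideal n -> P `<=` n -> ~ n (sA D0) ->
  regular n (pd k (iota a)).
Hypothesis dRC : forall k l r, dR k (dR l r) = dR l (dR k r).
Hypothesis delta_sA : forall r, delta (iota (sA r)) = \sum_l iota (sA (dR l r)) * iota (xi l).

(* The components of the Lie derivative along [delta] of the form with
   components [omega k], where [xi l] is the [l]-th component of [delta]. *)
Definition lie k : F := delta (omega k) + \sum_l omega l * pd k (iota (xi l)).

(** Cartan's formula: the Lie derivative of dg / g is the differential of delta(g) / g. *)
Lemma lie_log k : delta (iota (sA (dR k g)) / iota (sA g)) +
  \sum_l iota (sA (dR l g)) / iota (sA g) * pd k (iota (xi l)) =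
  pd k (iota (beta (sA g)) / iota (sA g)).
Proof.
rewrite -deltaE !der_div // pdE !delta_sA (der_sum (dpd k)).
have -> : \sum_i pd k (iota (sA (dR i g)) * iota (xi i)) =
  \sum_i iota (sA (dR i (dR k g))) * iota (xi i) + \sum_i iota (sA (dR i g)) * pd k (iota (xi i)).
  rewrite -big_split; apply: eq_bigr => l _ /=.
  by rewrite (dpd k).2 pdE (dRC k l) addrC.
have -> : \sum_l iota (sA (dR l g)) / iota (sA g) * pd k (iota (xi l)) =
  (\sum_l iota (sA (dR l g)) * pd k (iota (xi l))) / iota (sA g).
  by rewrite mulr_suml; apply: eq_bigr => l _; rewrite mulrAC.
by field.
Qed.

(** Away from [Q] the form itself is regular. At [Q] the form minus dg / g is regular, and so is
    delta(g) / g, because [Q] is stable under [beta] and [g] is a uniformizer. *)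
Lemma lie_regular n k : prime_ideal n -> P `<=` n -> (forall b, n (sA b) -> dvdr g b) ->
  n (sA g) -> regular n (lie k).
Proof.
move=> pn Pn nc ng; have nD0 : ~ n (sA D0) by move/nc.
have dreg z : regular n z -> regular n (delta z).
  by apply: (regular_der pn ddelta) => a; rewrite deltaE; apply: regular_iota.
have pdreg l z : regular n z -> regular n (pd l z).
  by apply: (regular_der pn (dpd l)) => a; apply: pd_regular.
have [nq|nq] := EM (n (E q)); last first.
  have om l : regular n (omega l) by apply: residue_form_regular => //; right.
  apply: regularD => //; first exact: dreg.
  by apply: regular_sum => // l; apply: regularM => //; apply: pd_regular.
have en := prime_over_unique pn Pn nc ng nq; subst n.
pose o l := omega l - iota (sA (dR l g)) / iota (sA g).
have oreg l : regular Q (o l) by apply: residue_form_pole.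
have oE l : omega l = o l + iota (sA (dR l g)) / iota (sA g) by rewrite /o subrK.
have -> : lie k = delta (o k) + \sum_l o l * pd k (iota (xi l)) +
    pd k (iota (beta (sA g)) / iota (sA g)).
  rewrite -lie_log /lie [in LHS]oE ddelta.1.
  under eq_bigr => l _ do rewrite oE mulrDl.
  by rewrite big_split /=; ring.
apply: regularD => //.
  apply: regularD => //; first exact: dreg.
  by apply: regular_sum => // l; apply: regularM => //; apply: pd_regular.
apply: pdreg; have [r1 [c [gr1 hc]]] := uniformizer (betaQ Qg).
apply: (@regular_cancel _ pQ (sA r1 * E h)).
  by apply: prime_notM => //; [exact: notQ|exact: comaximal].
rewrite mulrA -[_ * iota (beta _)]rmorphM hc mulrAC mulfV // mul1r; exact: regular_iota.
Qed.

End Lie.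
End Form.
End Splitting.
End LocalAnalysis.

(** * Lie derivatives and degrees *)

Lemma msize_mderiv d (p : {mpoly CC[d]}) i : (msize p^`M(i) <= (msize p).-1)%N.
Proof.
rewrite (msizeE p^`M(i)); apply/bigmax_leqP_seq => m hm _.
have : (m + U_(i))%MM \in msupp p.
  rewrite mcoeff_msupp; apply: contraTneq hm => e0.
  by rewrite mcoeff_msupp mcoeff_deriv e0 mul0rn eqxx.
by move/msize_mdeg_lt; rewrite mdegD mdeg1 addn1; case: (msize p).
Qed.

Lemma mderiv_all0 d (p : {mpoly CC[d]}) : (forall i, p^`M(i) = 0) -> exists c, p = c%:MP.
Proof.
move=> h; exists p@_0%MM; apply/mpolyP => m; rewrite mcoeffC.
have [->|m0] := eqVneq m 0%MM; first by rewrite mulr1.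
have [i mi] : exists i, m i != 0%N.
  by apply: contrapT => H; move/eqP: m0; apply; apply/mnmP => i; rewrite mnm0E; apply/eqP; apply: contraT => mi; case: H; exists i.
have em : m = (m - U_(i) + U_(i))%MM.
  by rewrite submK //; apply/mnm_lepP => j; rewrite mnm1E; case: eqP => // <-; rewrite lt0n.
have := congr1 (mcoeff (m - U_(i))%MM) (h i).
rewrite mcoeff_deriv mcoeff0 -em -mulr_natr => h0; rewrite mulr0.
apply/eqP; have := @mulf_eq0 CC p@_m ((m - U_(i))%MM i).+1%:R.
by rewrite mulr_natr h0 eqxx Num.Theory.pnatr_eq0 orbF => /esym/eqP ->; rewrite mulr0.
Qed.

Section CoefficientDerivation.
Variables (R : comNzRingType) (D : R -> R).
Hypotheses (DD : forall a b, D (a + b) = D a + D b) (DM : forall a b, D (a * b) = D a * b + a * D b).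

Lemma derivation0 : D 0 = 0.
Proof. by apply: (addrI (D 0)); rewrite -DD !addr0. Qed.

Lemma coef_map_der f j : (map_poly D f)`_j = D f`_j.
Proof. by rewrite coef_map_id0 // derivation0. Qed.

Lemma map_derD f g : map_poly D (f + g) = map_poly D f + map_poly D g.
Proof. by apply/polyP => j; rewrite coefD !coef_map_der coefD DD. Qed.

Lemma map_derM f g : map_poly D (f * g) = f * map_poly D g + map_poly D f * g.
Proof.
have Dsum (I : Type) (s : seq I) (u : I -> R) : D (\sum_(i <- s) u i) = \sum_(i <- s) D (u i).
  by elim: s => [|i s IH]; rewrite ?big_nil ?derivation0 // !big_cons DD IH.
apply/polyP => j; rewrite coefD coef_map_der !coefM Dsum -big_split; apply: eq_bigr => l _ /=.
by rewrite DM !coef_map_der addrC.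
Qed.

Lemma map_derC r : map_poly D r%:P = (D r)%:P.
Proof. by apply/polyP => j; rewrite coef_map_der !coefC; case: eqP => // _; rewrite derivation0. Qed.

Lemma map_derX : map_poly D 'X = 0.
Proof.
have D1 : D 1 = 0 by apply: (addrI (D 1)); have := DM 1 1; rewrite !mul1r mulr1 addr0 => <-.
apply/polyP => j; rewrite coef_map_der coefX coef0; case: eqP => _ //; exact: derivation0.
Qed.

End CoefficientDerivation.

Definition cderiv d (i : 'I_d) : {poly {mpoly CC[d]}} -> {poly {mpoly CC[d]}} := map_poly (mderiv i).

Lemma coef_cderiv d (i : 'I_d) f j : (cderiv i f)`_j = (f`_j)^`M(i).
Proof. exact: (coef_map_der (@mderivD _ _ i)). Qed.

Section WeightedReduction.
Variables (d w : nat).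
Local Notation R := {mpoly CC[d]}.
Local Notation xdeg := (@xdeg d w).

Lemma xdegW k l f : (k <= l)%N -> xdeg k f -> xdeg l f.
Proof. by move=> kl h j; case: (h j) => [h1|]; [left; apply: leq_trans h1 _|right]. Qed.

Lemma xdeg_exists (f : {poly R}) : exists k, xdeg k f.
Proof.
exists (\sum_(j < size f) (msize f`_j + w * j))%N => j.
have [hj|hj] := ltnP j (size f); last by right; rewrite nth_default.
by left; rewrite (bigD1 (Ordinal hj)) //= leqW // leq_addr.
Qed.

Lemma xdegN k f : xdeg k f -> xdeg k (- f).
Proof. by move=> h j; rewrite coefN; case: (h j) => [h1|->]; [left; rewrite msizeN|right; rewrite oppr0]. Qed.

Lemma xdeg_polyC k (r : R) : (msize r <= k.+1)%N -> xdeg k r%:P.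
Proof. by move=> h [|j]; rewrite coefC /=; [left; rewrite muln0 addn0|right]. Qed.

Lemma xdeg_sum k (I : Type) (s : seq I) (f : I -> {poly R}) :
  (forall i, xdeg k (f i)) -> xdeg k (\sum_(i <- s) f i).
Proof.
by move=> h; apply: (big_ind (xdeg k)) => //; [apply: xdeg0|move=> *; apply: xdegD].
Qed.

Lemma xdeg_cderiv k i f : xdeg k f -> xdeg k (cderiv i f).
Proof.
move=> h j; rewrite coef_cderiv; case: (h j) => [h1|->]; last by right; rewrite mderiv0.
left; apply: leq_trans h1; rewrite leq_add2r.
exact: leq_trans (msize_mderiv _ _) (leq_pred _).
Qed.

Lemma xdeg_deriv k f : xdeg k f -> xdeg k f^`().
Proof.
move=> h j; rewrite coef_deriv; case: (h j.+1) => [h1|->]; last by right; rewrite mul0rn.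
left; apply: leq_trans h1; apply: leq_add; last by rewrite leq_mul2l leqnSn orbT.
by rewrite -scaler_nat; apply: leq_trans (msizeZ_le _ _) _.
Qed.

(** By the homogeneity bound on [p], the multiple of [p] that cancels the leading term of [f] has
    weighted degree at most [k], so division preserves the bound. *)
Lemma weighted_reduction e (p f : {poly R}) k : p \is monic -> size p = e.+1 ->
  xdeg (w * e) p -> xdeg k f -> exists f1 : {poly R}, [/\ (size f1 <= e)%N, xdeg k f1 & dvdr p (f - f1)].
Proof.
move=> mp sp wp; elim: {f}(size f) {-2}f (leqnn (size f)) => [|n IH] f hn hf.
  by exists f; split=> //; [apply: leq_trans hn _|rewrite subrr; apply: dvdr0].
have [he|he] := leqP (size f) e.
  by exists f; split=> //; rewrite subrr; apply: dvdr0.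
have sf : (0 < size f)%N by apply: leq_ltn_trans he.
pose m := ((size f).-1 - e)%N; have em : (m + e = (size f).-1)%N by rewrite subnK // -ltnS prednK.
pose t := (lead_coef f)%:P * 'X^m.
have [||f1 [s1 x1 [c hc]]] := IH (f - t * p).
  rewrite -ltnS; apply: leq_trans hn; rewrite -[in leqRHS](prednK sf) ltnS; apply/leq_sizeP => i hi.
  have lt : lead_coef (t * p) = lead_coef f.
    by rewrite /t !lead_coefM lead_coefC lead_coefXn (monicP mp) !mulr1.
  have st : size (t * p) = size f.
    rewrite size_Mmonic //; last by rewrite /t -lead_coef_eq0 lead_coefM lead_coefC lead_coefXn mulr1 lead_coef_eq0 -size_poly_gt0.
    rewrite sp /t size_Mmonic ?monicXn ?polyC_eq0 ?lead_coef_eq0 -?size_poly_gt0 //.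
    rewrite size_polyXn size_polyC lead_coef_eq0 -size_poly_gt0 sf /= addnS /=.
    by rewrite em prednK.
  rewrite coefB; have [hi'|hi'] := ltnP i (size f); last by rewrite !nth_default ?subrr ?st.
  have -> : i = (size f).-1 by apply/eqP; rewrite eqn_leq hi andbT -ltnS prednK.
  by rewrite -{2}st -!lead_coefE lt subrr.
  apply: xdegD => //; apply: xdegN.
  have f0 : lead_coef f != 0 by rewrite lead_coef_eq0 -size_poly_gt0.
  case: (hf (size f).-1) => [h|h]; last by move: f0; rewrite lead_coefE h eqxx.
  rewrite -lead_coefE -em mulnDr in h.
  have kk : (w * m + w * e <= k)%N.
    by rewrite -ltnS; apply: leq_trans h; rewrite -add1n leq_add2r lt0n msize_poly_eq0.
  have -> : k = (k - (w * m + w * e) + w * m + w * e)%N by rewrite -addnA subnK.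
  apply: xdegM => //; apply: xdegM; last by rewrite -[X in _ (w * X)%N _]/(m); apply: xdeg_exp; apply: xdegX.
  by apply: xdeg_polyC; rewrite -(leq_add2r (w * m + w * e)%N) addSn subnK.
exists f1; split=> //; exists (c + t); rewrite mulrDl -hc; ring.
Qed.

End WeightedReduction.

Lemma leibniz_regroup (K : comNzRingType) (a b a' b' z : K) :
  a * (b' * z) + a' * z * b = (a' * b + a * b') * z.
Proof. by ring. Qed.

Section AbstractChainRule.
Variables (A : comAlgType CC) (F : fieldType) (iota : {rmorphism A -> F}).
Variables (R : idomainType) (sA : {rmorphism R -> A}) (y : A) (I : finType) (dR : I -> R -> R).
Hypothesis dRD : forall i a b, dR i (a + b) = dR i a + dR i b.
Hypothesis dRM : forall i a b, dR i (a * b) = dR i a * b + a * dR i b.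
Local Notation e := (frac_eval iota sA y).
Variables (D : F -> F) (x : I -> F).
Hypotheses (dD : is_der D) (DsA : forall r, D (iota (sA r)) = \sum_i iota (sA (dR i r)) * x i).

Lemma chain_rule f : D (e f) = \sum_i e (map_poly (dR i) f) * x i + e f^`() * D (iota y).
Proof.
have eM a b : e (a * b) = e a * e b by exact: rmorphM.
have eD a b : e (a + b) = e a + e b by exact: rmorphD.
have eX : e 'X = iota y by rewrite frac_evalE pevalX.
elim/poly_ind: f => [|f c IH].
  have e0 : e 0 = 0 by exact: rmorph0.
  rewrite e0 (der0 dD) derivC e0 mul0r addr0 big1 // => i _.
  by rewrite -polyC0 (map_derC (dRD i)) (derivation0 (dRD i)) polyC0 e0 mul0r.
rewrite eD eM dD.1 dD.2 IH frac_evalC DsA eX.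
rewrite derivD derivM derivX derivC mulr1 addr0 eD eM eX.
have -> : \sum_i e (map_poly (dR i) (f * 'X + c%:P)) * x i =
   (\sum_i e (map_poly (dR i) f) * x i) * iota y + \sum_i iota (sA (dR i c)) * x i.
  rewrite mulr_suml -big_split; apply: eq_bigr => i _ /=.
  rewrite (map_derD (dRD i)) (map_derM (dRD i) (dRM i)) (map_derX (dRD i) (dRM i)).
  by rewrite mulr0 add0r (map_derC (dRD i)) eD eM frac_evalC eX mulrDl mulrAC.
by ring.
Qed.

End AbstractChainRule.

Section ChainRule.
Variables (A : comAlgType CC) (P : set A) (F : fieldType) (iota : {rmorphism A -> F}).
Variables (d : nat) (X : 'I_d -> A) (y : A).
Local Notation R := {mpoly CC[d]}.
Local Notation sA := (ev (in_alg A) X).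
Local Notation e := (frac_eval iota sA y).

Lemma chain_rule_coef (D : F -> F) : is_der D -> (forall c : CC, D (iota c%:A) = 0) ->
  forall r : R, D (iota (sA r)) = \sum_i iota (sA r^`M(i)) * D (iota (X i)).
Proof.
move=> dD D0 r; pose good r := D (iota (sA r)) = \sum_i iota (sA r^`M(i)) * D (iota (X i)).
have sAM a b : iota (sA (a * b)) = iota (sA a) * iota (sA b) by rewrite !rmorphM.
have gC c : good c%:MP.
  rewrite /good evC D0 big1 // => i _; by rewrite mderivC !rmorph0 mul0r.
have gM a b : good a -> good b -> good (a * b).
  rewrite /good => ha hb; rewrite sAM dD.2 ha hb mulr_sumr mulr_suml -big_split.
  apply: eq_bigr => i _; rewrite mderivM (rmorphD sA) (rmorphD iota) !sAM.
  exact: leibniz_regroup.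
have gD a b : good a -> good b -> good (a + b).
  rewrite /good => ha hb; rewrite !rmorphD dD.1 ha hb -big_split.
  by apply: eq_bigr => i _ /=; rewrite mderivD !rmorphD /= mulrDl.
have gX i : good 'X_i.
  rewrite /good evX (bigD1 i) //= big1 => [|j ji]; last first.
    by rewrite mderivX mnm1E eq_sym (negPf ji) scale0r !rmorph0 mul0r.
  by rewrite mderivX1 !rmorph1 mul1r addr0.
rewrite -/(good r) [r]mpolyE; apply: (big_ind good) => [|//|m _].
  by rewrite -mpolyC0.
rewrite -mul_mpolyC; apply: (gM) => //; rewrite mpolyXE_id.
apply: (big_ind good) => [|//|i _]; first by rewrite -mpolyC1.
elim: (m i) => [|l IH]; first by rewrite expr0 -mpolyC1.
by rewrite exprS; exact: (gM _ _ (gX i) IH).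
Qed.

End ChainRule.

Section PartialDerivatives.
Variables (A : comAlgType CC) (P : set A) (F : fieldType) (iota : {rmorphism A -> F}).
Hypothesis hfrac : is_frac_of_quotient P iota.
Variables (R : idomainType) (sA : {rmorphism R -> A}) (y : A) (I : finType) (dR : I -> R -> R).
Hypothesis dRD : forall i a b, dR i (a + b) = dR i a + dR i b.
Hypothesis dRM : forall i a b, dR i (a * b) = dR i a * b + a * dR i b.
Variables (p w0 : {poly R}) (D0 : R).
Local Notation e := (frac_eval iota sA y).
Local Notation phi := (iota (sA D0)).
Hypotheses (ep0 : e p = 0) (ekerp : forall f, e f = 0 -> dvdr p f).
Hypothesis eden : forall a, exists k f, phi ^+ k * iota a = e f.
Hypotheses (ew : e (p^`() * w0) = phi) (phi0 : phi != 0).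

Let eM a b : e (a * b) = e a * e b. Proof. exact: rmorphM. Qed.
Let eD a b : e (a + b) = e a + e b. Proof. exact: rmorphD. Qed.
Let eN a : e (- a) = - e a. Proof. exact: rmorphN. Qed.
Let eB a b : e (a - b) = e a - e b. Proof. exact: rmorphB. Qed.

Definition poly_denom z := exists k f, phi ^+ k * z = e f.

Lemma poly_denom_eval f : poly_denom (e f).
Proof. by exists 0%N, f; rewrite expr0 mul1r. Qed.

Lemma poly_denomD a b : poly_denom a -> poly_denom b -> poly_denom (a + b).
Proof.
move=> [k [f hf]] [k' [f' hf']]; exists (k + k')%N, (D0 ^+ k' *: f + D0 ^+ k *: f').
by rewrite eD !frac_evalZ -hf -hf' !rmorphXn exprD; ring.
Qed.

Lemma poly_denomM a b : poly_denom a -> poly_denom b -> poly_denom (a * b).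
Proof.
by move=> [k [f hf]] [k' [f' hf']]; exists (k + k')%N, (f * f'); rewrite eM -hf -hf' exprD; ring.
Qed.

Lemma poly_denomN a : poly_denom a -> poly_denom (- a).
Proof. by move=> [k [f hf]]; exists k, (- f); rewrite eN -hf mulrN. Qed.

Lemma poly_denom_div a k : poly_denom (phi ^+ k * a) -> poly_denom a.
Proof. by move=> [k' [f hf]]; exists (k' + k)%N, f; rewrite exprD -mulrA. Qed.

(** The value at y must be t = - p_k(y) / p'(y), where p_k is [p] with differentiated coefficients.
    Since p'(y) w0(y) = D0, only powers of [D0] occur as denominators. *)
Lemma partial_exists k : exists pd : F -> F, [/\ is_der pd,
  forall r, pd (iota (sA r)) = iota (sA (dR k r)) & forall a, poly_denom (pd (iota a))].
Proof.
pose cd := map_poly (dR k).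
have cdD a b : cd (a + b) = cd a + cd b by exact: map_derD (dRD k) _ _.
have cdM a b : cd (a * b) = a * cd b + cd a * b by exact: map_derM (dRD k) (dRM k) _ _.
pose t := - (e (cd p * w0)) / phi.
pose d f := e (cd f) + e f^`() * t.
have ht : phi * t = e (- (cd p * w0)) by rewrite /t mulrC divfK // eN.
have hpsi (z : F) : exists a b : {poly R}, e b != 0 /\ z = e a / e b.
  have [a [b [b0 ->]]] := hfrac.2 z; have [k1 [f1 h1]] := eden a; have [k2 [f2 h2]] := eden b.
  exists (D0 ^+ k2 *: f1), (D0 ^+ k1 *: f2).
  rewrite !frac_evalZ !rmorphXn -h1 -h2.
  have h3 := expf_neq0 k1 phi0; have h4 := expf_neq0 k2 phi0.
  by split; [rewrite !mulf_neq0|field; rewrite b0 h3 h4].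
have [|||pd [dpd hpd]] := der_extend hpsi (d := d).
- by move=> a b; rewrite /d cdD derivD !eD; ring.
- by move=> a b; rewrite /d cdM derivM !eD !eM; ring.
- move=> f /ekerp[c ->]; apply: (mulfI phi0); rewrite /d cdM derivM !eD !eM ep0.
  rewrite !mulr0 addr0 add0r mulrDr [phi * (_ * t)]mulrCA ht eN eM -ew eM; ring.
exists pd; split=> //.
  move=> r; rewrite -(frac_evalC iota sA y) hpd /d derivC /cd (map_derC (dRD k)) frac_evalC.
  by rewrite -polyC0 frac_evalC rmorph0 rmorph0 mul0r addr0.
move=> a; have [j [f hf]] := eden a; apply: (@poly_denom_div _ j).
have h : pd (phi ^+ j * iota a) = pd (e f) by rewrite hf.
rewrite dpd.2 in h; rewrite (canRL (addrK _) h).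
apply: poly_denomD; last first.
  apply: poly_denomN; rewrite -!rmorphXn -(frac_evalC iota sA y) hpd; apply: poly_denomM; last exact: eden.
  apply: poly_denomD; first exact: poly_denom_eval.
  apply: poly_denomM; first exact: poly_denom_eval.
  by apply: (@poly_denom_div _ 1); rewrite expr1 ht; apply: poly_denom_eval.
rewrite hpd; apply: poly_denomD; first exact: poly_denom_eval.
apply: poly_denomM; first exact: poly_denom_eval.
by apply: (@poly_denom_div _ 1); rewrite expr1 ht; apply: poly_denom_eval.
Qed.

Lemma common_denominator (T : finType) (z : T -> F) : (forall t, poly_denom (z t)) ->
  exists k, forall t, exists f, phi ^+ k * z t = e f.
Proof.
move=> h; have [k hk] := choice h; exists (\sum_t k t)%N => t; have [f hf] := hk t.
exists (D0 ^+ (\sum_(s | s != t) k s) *: f).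
by rewrite frac_evalZ -hf !rmorphXn mulrA -exprD (bigD1 t) //= addnC.
Qed.

Section LieFormula.
Variables (g : R) (eta : I -> {poly R}) (delta : F -> F) (xi : I -> A) (pd : I -> F -> F).
Hypotheses (ddelta : is_der delta) (g0 : iota (sA g) != 0).
Hypothesis delta_sA : forall r, delta (iota (sA r)) = \sum_l iota (sA (dR l r)) * iota (xi l).
Variables (K : nat) (px : I -> {poly R}) (py : {poly R}) (pm : I -> I -> {poly R}).
Hypotheses (hpx : forall l, phi ^+ K * iota (xi l) = e (px l)).
Hypothesis hpy : phi ^+ K * delta (iota y) = e py.
Hypothesis hpm : forall k l, phi ^+ K * pd k (iota (xi l)) = e (pm k l).

(** As 1 / p'(y) = w0(y) / D0, the components of the form are N l / (D0 g). This is the numerator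
    over (D0 g)^2 that the quotient rule gives for the Lie derivative, once D0^K has cleared the
    data of the derivation. *)
Definition lie_numerator k : {poly R} := let N l := eta l * w0 in
  (D0 * g)%:P * (\sum_i map_poly (dR i) (N k) * px i + (N k)^`() * py)
  - N k * (\sum_i (dR i (D0 * g))%:P * px i)
  + (D0 * g)%:P * (\sum_l N l * pm k l).

Lemma lie_formula k :
  iota (sA g) ^+ 2 * (phi ^+ (K + 2) * lie iota sA y p g eta delta xi pd k) = e (lie_numerator k).
Proof.
have esum (f : I -> {poly R}) : e (\sum_i f i) = \sum_i e (f i) by exact: rmorph_sum.
pose N l := eta l * w0.
have ep' : e p^`() != 0 by apply: contraNneq phi0 => z; rewrite -ew eM z mul0r.
have ew0 : e w0 = phi / e p^`() by rewrite -ew eM mulrC mulKf.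
have om l : residue_form iota sA y p g eta l = e (N l) / iota (sA (D0 * g)).
  by rewrite /residue_form /N eM ew0 !rmorphM; field; rewrite ep' g0 phi0.
have hDg : iota (sA (D0 * g)) != 0 by rewrite !rmorphM mulf_neq0.
have hN : phi ^+ K * delta (e (N k)) = e (\sum_i map_poly (dR i) (N k) * px i + (N k)^`() * py).
  rewrite (@chain_rule A F iota R sA y I dR dRD dRM delta (iota \o xi) ddelta delta_sA) mulrDr eD esum mulr_sumr eM -hpy mulrCA; congr (_ + _).
  by apply: eq_bigr => i _; rewrite eM -hpx mulrCA.
have hg : phi ^+ K * delta (iota (sA (D0 * g))) = e (\sum_i (dR i (D0 * g))%:P * px i).
  rewrite delta_sA esum mulr_sumr; apply: eq_bigr => i _.
  by rewrite eM frac_evalC -hpx mulrCA.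
have hs : phi ^+ K * (\sum_l e (N l) * pd k (iota (xi l))) = e (\sum_l N l * pm k l).
  by rewrite esum mulr_sumr; apply: eq_bigr => i _; rewrite eM -hpm mulrCA.
rewrite /lie_numerator -/(N k) eD eB !eM frac_evalC -hN -hg -hs /lie om der_div //.
have -> : \sum_l residue_form iota sA y p g eta l * pd k (iota (xi l)) =
  (\sum_l e (N l) * pd k (iota (xi l))) / iota (sA (D0 * g)).
  by rewrite mulr_suml; apply: eq_bigr => l _; rewrite om mulrAC.
move: (\sum_l e (N l) * _) (delta _) (delta _) hDg => s a b; rewrite !rmorphM exprD.
by move=> hDg; field; rewrite g0 phi0.
Qed.

End LieFormula.
End PartialDerivatives.

(** * Bounds on the number of primes *)

Lemma dvdr_msize_eq0 d (g f : {mpoly CC[d]}) : dvdr g f -> (msize f < msize g)%N -> f = 0.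
Proof.
case=> c ->; have [->|c0] := eqVneq c 0; first by rewrite mul0r.
have [->|g0] := eqVneq g 0; first by rewrite mulr0.
rewrite msizeM //; have : (0 < msize c)%N by rewrite lt0n msize_poly_eq0.
by case: (msize c) => // m _; rewrite addSn /= ltnNge leq_addl.
Qed.

Section PoissonForms.
Variables (A : comAlgType CC) (br : A -> A -> A).
Hypotheses (hbr : poisson_bracket br) (haff : complex_affine A).
Variable P : set A.
Hypothesis hP : poisson_prime br P.
Variables (F : fieldType) (iota : {rmorphism A -> F}).
Hypothesis hfrac : is_frac_of_quotient P iota.
Variables (d : nat) (X : 'I_d -> A).
Hypothesis iX : indep_mod P X.
Hypothesis intX : forall a, integralOver (ev (iota \o in_alg A) (iota \o X)) (iota a).
Local Notation R := {mpoly CC[d]}.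
Local Notation sA := (ev (in_alg A) X).
Variables (y : A) (p w0 : {poly R}) (D0 : R) (e0 : nat).
Local Notation e := (frac_eval iota sA y).
Local Notation E := (peval sA y).
Local Notation phi := (iota (sA D0)).
Hypotheses (mp : p \is monic) (sp : size p = e0.+1) (ep0 : e p = 0).
Hypotheses (ekerp : forall f, e f = 0 -> dvdr p f) (D00 : D0 != 0).
Hypothesis eden : forall a, exists k f, phi ^+ k * iota a = e f.
Hypothesis ew : e (p^`() * w0) = phi.
Variables (delta : A -> F -> F) (pd : 'I_d -> F -> F).
Hypotheses (ddelta : forall b, is_der (delta b)) (deltaE : forall b a, delta b (iota a) = iota (br a b)).
Hypotheses (dpd : forall k, is_der (pd k)) (pdE : forall k r, pd k (iota (sA r)) = iota (sA r^`M(k))).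
Hypothesis pd_denom : forall k a, poly_denom iota sA y D0 (pd k (iota a)).
Variable w : nat.
Hypothesis wp : forall i, (msize p`_i <= (w * (e0 - i)).+1)%N.

Let pP : prime_ideal P := hP.1.

Let phi0 : phi != 0.
Proof. by apply/eqP => /hfrac.1 /iX z; move: D00; rewrite z eqxx. Qed.

Let sA_inj r : P (sA r) -> r = 0 := @iX r.

Let delta_sA b r : delta b (iota (sA r)) = \sum_l iota (sA r^`M(l)) * iota (br (X l) b).
Proof.
rewrite (chain_rule_coef (iota := iota) X (ddelta b)); last first.
  by move=> c; rewrite deltaE (brCl hbr) rmorph0.
by apply: eq_bigr => l _; rewrite deltaE.
Qed.

Let pd_regular k a n : prime_ideal n -> P `<=` n -> ~ n (sA D0) -> regular iota n (pd k (iota a)).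
Proof.
move=> pn Pn nD; have [j [f hf]] := pd_denom k a.
exists (sA D0 ^+ j); split; last by exists (E f); rewrite rmorphXn.
by elim: j {hf} => [|j IH]; [rewrite expr0; case: pn|rewrite exprS; apply: prime_notM].
Qed.

Local Notation gradient := (fun (k : 'I_d) (r : R) => r^`M(k)).

Definition residue_data Q g q h rho r (eta : 'I_d -> {poly R}) :=
  [/\ [/\ adjacent P Q, prime_elt g, Q (sA g), (forall b, Q (sA b) -> dvdr g b) & ~ dvdr g D0],
      splits_at sA y p Q g q h r rho,
      (forall k i, dvdr g (r * (eta k)`_i - ((g^`M(k))%:P * (h * q^`()))`_i))
    & forall k, (size (eta k) <= e0)%N /\
        forall i, (msize (eta k)`_i <= ((msize g).-2 + w * (e0.-1 - i)).+1)%N].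

Lemma residue_data_exists Q : adjacent P Q -> ~ Q (sA D0) ->
  exists g q h rho r eta, residue_data Q g q h rho r eta.
Proof.
move=> hadj nD; have [_ pQ [PQ _] _] := hadj.
have [g [pg Qg]] := adjacent_prime_generator hfrac iX intX hadj.
have Qc b : Q (sA b) -> dvdr g b by apply: (contraction_principal hfrac iX intX hadj pg Qg).
have gD : ~ dvdr g D0.
  by case=> c ec; apply: nD; rewrite ec rmorphM; case: pQ => [[_ _ QM] _ _]; apply: QM.
have [q [h [r [rho hs]]]] := splits_at_exists hfrac mp ep0 pQ PQ pg Qg.
have hrel i : dvdr g (r * p`_i - (q * h)`_i).
  case: hs => _ _ _ _ hpol; exists rho`_i.
  have := congr1 (fun f : {poly R} => f`_i) hpol; rewrite /= coefZ coefD coefZ => ->.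
  by rewrite addrC addKr mulrC.
have gr : ~ dvdr g r by case: hs.
have [eta heta] := choice (fun k => gradient_interpolation k mp sp wp pg gr hrel).
exists g, q, h, rho, r, eta; split=> //.
  by move=> k; case: (heta k).
by move=> k; case: (heta k).
Qed.

(** As [n] contracts into (g), its transcendence degree is at least d - 1, that of [Q]; a strict
    inclusion would lower it. *)
Lemma contraction_maximal Q g n : adjacent P Q -> prime_elt g -> prime_ideal n ->
  (forall b, n (sA b) -> dvdr g b) -> Q `<=` n -> n `<=` Q.
Proof.
move=> hadj pg pn nc Qn; have [_ pQ _ _] := hadj.
have tP := trd_noether hfrac iX intX.
have [m tQ] := trd_exists haff pQ; have [m' tn] := trd_exists haff pn.
have em := trd_adjacent haff hadj tP tQ.
have h1 := trd_contraction pg nc tn.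
apply: contrapT => nQ; have := trd_lt pQ pn (conj Qn nQ) tQ tn.
by move: h1; rewrite em ltnS => h1 h2; have := leq_ltn_trans h1 h2; rewrite ltnn.
Qed.

Local Notation form g eta := (residue_form iota sA y p g eta).

Lemma form_regular_elsewhere Q g q h rho r eta n k : residue_data Q g q h rho r eta ->
  adjacent P n -> ~ n (sA D0) -> n <> Q -> regular iota n (form g eta k).
Proof.
move=> [[hadj pg Qg Qc gD] hs heta _] hn nD nQ; have [_ pQ [PQ _] _] := hadj.
have [_ pn [Pn _] _] := hn.
apply: (residue_form_regular hfrac ep0 sA_inj ew pg hs heta k pn Pn nD).
have [ng|ng] := EM (n (sA g)); last by left.
right; have nc b : n (sA b) -> dvdr g b by apply: (contraction_principal hfrac iX intX hn pg ng).
split=> // nq; apply: nQ.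
apply: (prime_over_unique hfrac ep0 eden ew pQ PQ pg Qg gD _ hs pn Pn nc ng nq).
by move=> n' pn' nc' Qn'; apply: (contraction_maximal hadj pg).
Qed.

(** Without a pole, [g] would divide all its partial derivatives; these have smaller degree, so they
    vanish and [g] is constant. *)
Lemma form_pole Q g q h rho r eta : residue_data Q g q h rho r eta ->
  exists k, ~ regular iota Q (form g eta k).
Proof.
move=> [[hadj pg Qg Qc gD] hs heta _]; have [_ pQ [PQ _] _] := hadj.
apply: contrapT => H.
have hreg k : regular iota Q (form g eta k).
  by apply: contrapT => hk; apply: H; exists k.
have g0 := prime_elt_neq0 pg.
have g00 : iota (sA g) != 0 by apply/eqP => /hfrac.1 /iX z; rewrite z eqxx in g0.
have dg k : dvdr g g^`M(k).
  have := residue_form_pole hfrac ep0 sA_inj eden ew pQ PQ pg Qg Qc gD hs heta k.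
  move/regularN/(regularD pQ (hreg k)); rewrite opprB addrC subrK => -[s [ns [a ha]]].
  apply: Qc; have [[Q0 QD QM] _ QP] := pQ.
  have : Q (s * sA g^`M(k)).
    rewrite -[s * _](subrK (a * sA g)); apply: (QD); last exact: QM.
    apply: PQ; apply/hfrac.1; rewrite rmorphB !rmorphM -ha.
    by rewrite -mulrA divfK // subrr.
  by case/QP.
have d0 k : g^`M(k) = 0.
  apply: dvdr_msize_eq0 (dg k) _; apply: leq_ltn_trans (msize_mderiv g k) _.
  by rewrite prednK // lt0n msize_poly_eq0.
have [c ec] := mderiv_all0 d0; have := prime_msize_gt1 pg.
by rewrite ec msizeC; case: eqP.
Qed.

Let xdeg_p : xdeg w (w * e0) p.
Proof.
move=> i; have [hi|hi] := leqP i e0; last by right; rewrite nth_default // sp.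
left; apply: leq_trans (leq_add (wp i) (leqnn _)) _.
by rewrite addSn -mulnDr subnK.
Qed.

Lemma size_square_quotient (g t : R) c : g != 0 ->
  (msize (t * g ^+ 2) <= (2 * (msize g).-1 + c).+1)%N -> (msize t <= c.+1)%N.
Proof.
move=> g0; have [->|t0] := eqVneq t 0; first by rewrite msize0.
rewrite exprS expr1 !msizeM ?mulf_neq0 //.
have : (0 < msize g)%N by rewrite lt0n msize_poly_eq0.
have : (0 < msize t)%N by rewrite lt0n msize_poly_eq0.
by move: (msize g) (msize t) => a b; lia.
Qed.

(** The degree of [g] enters each term exactly twice, through D0 g and through [eta]; all the rest
    comes from [p], [w0], [D0] and the derivation. *)
Lemma lie_degree (g : R) (eta : 'I_d -> {poly R}) (px : 'I_d -> {poly R}) py pm c0 cw cD k :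
  (forall k, (size (eta k) <= e0)%N /\
     forall i, (msize (eta k)`_i <= ((msize g).-2 + w * (e0.-1 - i)).+1)%N) ->
  (forall l, xdeg w c0 (px l)) -> xdeg w c0 py -> (forall k l, xdeg w c0 (pm k l)) ->
  xdeg w cw w0 -> (msize D0 <= cD.+1)%N ->
  xdeg w (2 * (msize g).-1 + (w * e0.-1 + cw + cD + c0))
    (lie_numerator gradient w0 D0 g eta px py pm k).
Proof.
move=> heta hpx hpy hpm hw hD.
set n := (msize g).-1; have hg : (msize g <= n.+1)%N by rewrite /n; case: (msize g).
pose nN := (n + w * e0.-1 + cw)%N.
have xeta l : xdeg w (n + w * e0.-1) (eta l).
  move=> i; have [hi|hi] := ltnP i (size (eta l)); last by right; rewrite nth_default.
  left; have [s1 h1] := heta l; apply: leq_trans (leq_add (h1 i) (leqnn _)) _.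
  have hi' : (i <= e0.-1)%N by rewrite -ltnS; apply: leq_trans (leq_trans hi s1) (leqSpred _).
  rewrite addSn -addnA -mulnDr subnK // ltnS leq_add2r /n.
  exact: leq_pred.
have xN l : xdeg w nN (eta l * w0) by apply: xdegM.
have xDg : (msize (D0 * g) <= (cD + n).+1)%N by apply: msizeM_bound.
have eqc : (2 * n + (w * e0.-1 + cw + cD + c0) = (cD + n) + (nN + c0))%N by rewrite /nN; lia.
have eqc2 : (2 * n + (w * e0.-1 + cw + cD + c0) = nN + ((cD + n) + c0))%N by rewrite /nN; lia.
rewrite /lie_numerator; apply: xdegD; first apply: xdegD.
- rewrite eqc; apply: xdegM; first exact: xdeg_polyC.
  apply: xdegD; last by apply: xdegM => //; apply: xdeg_deriv.
  by apply: xdeg_sum => l; apply: xdegM => //; apply: xdeg_cderiv.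
- rewrite eqc2; apply: xdegN; apply: xdegM => //; apply: xdeg_sum => l.
  apply: xdegM => //; apply: xdeg_polyC.
  exact: leq_trans (msize_mderiv _ _) (leq_trans (leq_pred _) xDg).
rewrite eqc; apply: xdegM; first exact: xdeg_polyC.
by apply: xdeg_sum => l; apply: xdegM.
Qed.

Local Notation lie_form b g eta := (lie iota sA y p g eta (delta b) (fun l => br (X l) b) pd).

(** The numerator is reduced modulo [p] without raising its weighted degree. Regularity over (g)
    makes the reduced numerator divisible by g^2, and cancelling g^2 removes the dependence of the
    degree on [Q]. *)
Lemma lie_bound b : exists K c, forall Q g q h rho r eta k, poisson_prime br Q ->
  residue_data Q g q h rho r eta -> exists f : {poly R},
  [/\ (size f <= e0)%N, (forall i, (msize f`_i <= c.+1)%N)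
    & phi ^+ K * lie_form b g eta k = e f].
Proof.
pose T := ('I_d + 'I_d * 'I_d + unit)%type.
pose z (t : T) : F := match t with
  | inl (inl l) => iota (br (X l) b)
  | inl (inr (k, l)) => pd k (iota (br (X l) b))
  | inr _ => delta b (iota y) end.
have [|K hK] := @common_denominator A F iota R sA y D0 T z.
  by move=> [[l|[k l]]|[]] /=; rewrite ?deltaE; [exact: eden|exact: pd_denom|exact: eden].
have [f hf] := choice hK; have [cf hcf] := choice (fun t => xdeg_exists w (f t)).
pose c0 := (\sum_t cf t)%N.
have xf t : xdeg w c0 (f t) by apply: xdegW (hcf t); rewrite /c0 (bigD1 t) //= leq_addr.
have [cw hw] := xdeg_exists w w0.
exists (K + 2)%N, (w * e0.-1 + cw + msize D0 + c0)%N => Q g q h rho r eta k pQP data.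
have [[hadj pg Qg Qc gD] hs heta seta] := data; have [_ pQ [PQ _] _] := hadj.
have g0 := prime_elt_neq0 pg.
have g00 : iota (sA g) != 0 by apply/eqP => /hfrac.1 /iX zz; move: g0; rewrite zz eqxx.
pose px l := f (inl (inl l)); pose pm k l := f (inl (inr (k, l))); pose py := f (inr tt).
have form_eq := @lie_formula A F iota R sA y _ gradient (fun i => @mderivD _ _ i) (fun i => @mderivM _ _ i)
  p w0 D0 ew phi0 g eta (delta b) (fun l => br (X l) b) pd (ddelta b) g00 (delta_sA b) K px py pm
  (fun l => hf (inl (inl l))) (hf (inr tt)) (fun k l => hf (inl (inr (k, l)))) k.
have hdeg := @lie_degree g eta px py pm c0 cw (msize D0) k seta
  (fun l => xf _) (xf _) (fun k l => xf _) hw (leqnSn _).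
have [f1 [s1 x1 [u hu]]] := weighted_reduction mp sp xdeg_p hdeg.
set Z := phi ^+ (K + 2) * _ in form_eq *.
have ef1 : iota (sA g) ^+ 2 * Z = e f1.
  rewrite form_eq -[lie_numerator _ _ _ _ _ _ _ _ _](subrK f1) hu.
  have eM a a' : e (a * a') = e a * e a' by exact: rmorphM.
  have eD a a' : e (a + a') = e a + e a' by exact: rmorphD.
  by rewrite eD eM ep0 mulr0 add0r.
have nd1 := prime_ndvd1 pg.
have [||r1 [a [gr1 ha]]] := @regular_denominator A P F iota hfrac R sA g pg Z 1 (E f1) nd1.
- by rewrite !rmorph1 mulr1 ef1.
- move=> n pn Pn nc ng; apply: regularM => //.
    by rewrite -!rmorphXn; apply: regular_iota.
  apply: (lie_regular hfrac ep0 sA_inj eden ew pQ PQ pg Qg Qc gD _ hs heta (ddelta b) (deltaE b)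
    _ dpd pdE pd_regular _ (delta_sA b)) => //.
  - by move=> n' pn' nc' Qn'; apply: (contraction_maximal hadj pg).
  - by move=> t Qt; case: pQP => _ [_]; apply.
  - by move=> i j t; rewrite mderiv_comm.
have sf1 : (size f1 < size p)%N by rewrite sp.
have hsq := square_dvdr mp ep0 ekerp eden pg gD sf1 ef1 gr1 ha.
have [t ht] := choice hsq.
exists (\poly_(i < e0) t i); split; first exact: size_poly.
  move=> i; rewrite coef_poly; case: ltnP => _; last by rewrite msize0.
  apply: (size_square_quotient g0); rewrite -ht; case: (x1 i) => [h1|->]; last by rewrite msize0.
  by apply: leq_trans h1; rewrite leq_addr.
have -> : Z = e f1 / iota (sA g) ^+ 2 by rewrite -ef1 mulrC mulKf // expf_neq0.
have -> : f1 = g ^+ 2 *: \poly_(i < e0) t i.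
  apply/polyP => i; rewrite coefZ coef_poly; case: ltnP => hi; first by rewrite ht mulrC.
  by rewrite mulr0 nth_default // (leq_trans s1).
by rewrite frac_evalZ !rmorphXn mulrAC mulfV ?mul1r // expf_neq0.
Qed.

(** Replaces all Hamiltonian derivations by finitely many, as the dimension count requires. *)
Lemma delta_generated m (z : 'I_m -> A) t : (forall a, exists f, a = ev (in_alg A) z f) ->
  (forall j, delta (z j) t = 0) -> forall b, delta b t = 0.
Proof.
move=> hz h; have hf := hfrac.2.
have dD b b' u : delta (b + b') u = delta b u + delta b' u.
  apply: (der_ext hf (D2 := fun u => delta b u + delta b' u)) => //.
    by apply: is_der_add; apply: ddelta.
  by move=> a; rewrite !deltaE (brDr hbr) rmorphD.
have dM b b' u : delta (b * b') u = iota b * delta b' u + iota b' * delta b u.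
  apply: (der_ext hf (D2 := fun u => iota b * delta b' u + iota b' * delta b u)) => //.
    by apply: is_der_add; apply: is_der_scale; apply: ddelta.
  by move=> a; rewrite !deltaE (brMr hbr) rmorphD !rmorphM [iota b' * _]mulrC.
have dC c u : delta c%:A u = 0.
  apply: (der_ext hf (D2 := fun=> 0)) => //; first exact: is_der0.
  by move=> a; rewrite deltaE (br_anti hbr) (brCl hbr) oppr0 rmorph0.
pose good b := delta b t = 0.
have gD b b' : good b -> good b' -> good (b + b') by rewrite /good dD => -> ->; rewrite addr0.
have gM b b' : good b -> good b' -> good (b * b') by rewrite /good dM => -> ->; rewrite !mulr0 addr0.
have gC c : good c%:A by exact: dC.
move=> b; have [f ->] := hz b; rewrite -/(good _) [f]mpolyE rmorph_sum.
apply: (big_ind good) => // [|mm _]; first by have := gC 0; rewrite scale0r.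
rewrite -mul_mpolyC rmorphM /= evC; apply: (gM); first exact: gC.
rewrite mpolyXE_id rmorph_prod; apply: (big_ind good) => // [|i _].
  by have := gC 1; rewrite scale1r.
rewrite rmorphXn /= evX; elim: (mm i) => [|l IH].
  by rewrite expr0; have := gC 1; rewrite scale1r.
by rewrite exprS; apply: (gM) => //; apply: h.
Qed.

Definition good_prime Q := [/\ adjacent P Q, poisson_prime br Q & ~ Q (sA D0)].

Definition lie_of (om : 'I_d -> F) b k := delta b (om k) + \sum_l om l * pd k (iota (br (X l) b)).

Lemma lie_of_sum (I : finType) (a : I -> CC) (om : I -> 'I_d -> F) b k :
  lie_of (fun k => \sum_i iota (a i)%:A * om i k) b k =
  \sum_i iota (a i)%:A * lie_of (om i) b k.
Proof.
rewrite /lie_of (der_sum (ddelta b)).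
under [in RHS]eq_bigr => i _ do rewrite mulrDr mulr_sumr.
rewrite big_split /= exchange_big /=; congr (_ + _).
  apply: eq_bigr => i _; rewrite (ddelta b).2 deltaE (brCl hbr) rmorph0 mul0r addr0 //.
apply: eq_bigr => l _; rewrite mulr_suml; apply: eq_bigr => i _.
by rewrite mulrA.
Qed.

Lemma good_form m (z : 'I_m -> A) : exists c (K : 'I_m -> nat), forall Q, good_prime Q ->
  exists om : 'I_d -> F, [/\ (forall j k, exists f : {poly R}, [/\ (size f <= e0)%N,
        (forall i, (msize f`_i <= c.+1)%N) & phi ^+ K j * lie_of om (z j) k = e f]),
    (forall n k, adjacent P n -> ~ n (sA D0) -> n <> Q -> regular iota n (om k))
    & exists k, ~ regular iota Q (om k)].
Proof.
have [K hK] := choice (fun j => lie_bound (z j)); have [c hc] := choice hK.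
exists (\sum_j c j)%N, K => Q [hadj pQ nD].
have [g [q [h [rho [r [eta data]]]]]] := residue_data_exists hadj nD.
exists (form g eta); split.
- move=> j k; have [f [s1 s2 s3]] := hc j Q g q h rho r eta k pQ data; exists f; split=> //.
  by move=> i; apply: leq_trans (s2 i) _; rewrite ltnS (bigD1 j) //= leq_addr.
- move=> n k hn nn nQ; exact: form_regular_elsewhere data hn nn nQ.
exact: form_pole data.
Qed.

(** The primes are arranged in d + 1 groups of [M]. Each group yields one complex combination
    annihilated by the Lie derivatives; the d + 1 resulting vectors of F^d are dependent over [F],
    and the descent to constant coefficients contradicts the poles. *)
Lemma good_primes_bounded : (forall z, (forall b, delta b z = 0) -> exists l : CC, z = iota l%:A) ->
  exists M, ~ exists Qs : 'I_d.+1 * 'I_M -> set A, injective Qs /\ forall t, good_prime (Qs t).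
Proof.
move=> hconst; have [m [z hz]] := affine_generators haff.
have [c [K hom]] := good_form z.
(* Indexes all coefficients of the Lie derivatives of one form: generator, component, power of y,
   monomial of degree at most [c]. A group of one form more is dependent. *)
pose J := ('I_m * 'I_d * ('I_e0 * 'X_{1..d < c.+1}))%type.
exists #|{: J}|.+1 => -[Qs [Qinj Qgood]]; set M := #|{: J}|.+1 in Qs Qinj Qgood.
have [om homega] := choice (fun t => hom _ (Qgood t)).
have [f hf] := @choice ('I_d.+1 * 'I_M * 'I_m * 'I_d) {poly R}
  (fun x f => [/\ (size f <= e0)%N, (forall i, (msize f`_i <= c.+1)%N)
     & phi ^+ K x.1.2 * lie_of (om x.1.1) (z x.1.2) x.2 = e f])
  (fun x => let: And3 h _ _ := homega x.1.1 in h x.1.2 x.2).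
pose W (s : 'I_d.+1) (i : 'I_M) (x : J) : CC := (f (s, i, x.1.1, x.1.2))`_x.2.1@_x.2.2.
have dep s : exists l : 'I_M -> CC, (exists i, l i != 0) /\ forall x, \sum_i l i * W s i x = 0.
  by apply: linear_dependence; rewrite card_ord.
have [l hl] := choice dep.
pose Om s k := \sum_i iota (l s i)%:A * om (s, i) k.
have horizontal s j k : lie_of (Om s) (z j) k = 0.
  have ph : phi ^+ K j != 0 by rewrite expf_neq0.
  apply: (mulfI ph); rewrite mulr0 lie_of_sum mulr_sumr.
  have -> : \sum_i phi ^+ K j * (iota (l s i)%:A * lie_of (om (s, i)) (z j) k) =
     e (\sum_i (l s i)%:MP *: f (s, i, j, k)).
    have esum (u : 'I_M -> {poly R}) : e (\sum_i u i) = \sum_i e (u i) by exact: rmorph_sum.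
    rewrite esum; apply: eq_bigr => i _; have [_ _ /= h] := hf (s, i, j, k).
    rewrite frac_evalZ -h mulrCA; congr (iota _ * _); exact/esym/evC.
  have -> : \sum_i (l s i)%:MP *: f (s, i, j, k) = 0; last by exact: rmorph0.
  apply/polyP => a; rewrite coef_sum coef0.
  have [ha|ha] := ltnP a e0; last first.
    rewrite big1 // => i _; have [h1 _ _] := hf (s, i, j, k).
    by rewrite coefZ nth_default ?mulr0 // (leq_trans h1).
  apply/mpolyP => mm; rewrite mcoeff0 raddf_sum /=.
  have [hm|hm] := ltnP (mdeg mm) c.+1; last first.
    rewrite big1 // => i _; have [_ h1 _] := hf (s, i, j, k).
    by rewrite coefZ mcoeffCM memN_msupp_eq0 ?mulr0 // msize_mdeg_ge // (leq_trans (h1 a)).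
  have := (hl s).2 (j, k, (Ordinal ha, BMultinom hm)) => h; refine (etrans _ h).
  by apply: eq_bigr => i _; rewrite coefZ mcoeffCM.
(* Each form has a pole along its own prime, where all the others are regular. *)
have indep (a : 'I_d.+1 * 'I_M -> CC) :
    (forall k, \sum_t iota (a t)%:A * om t k = 0) -> forall t, a t = 0.
  move=> ha t; apply/eqP; apply: contraT => at0.
  have [hadj pQ nD] := Qgood t; have [_ pQ1 [PQ _] _] := hadj.
  have [_ _ [k []]] := homega t.
  have := ha k; rewrite (bigD1 t) //= => /eqP; rewrite addr_eq0 => /eqP e1.
  apply: (@regular_cancel _ _ _ _ pQ1 (a t)%:A).
    move=> Qa; have [[_ _ QM] Q1 _] := pQ1; apply: Q1.
    have -> : 1 = ((a t)^-1)%:A * (a t)%:A :> A by rewrite mulr_algl scalerA mulVf // scale1r.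
    exact: QM.
  rewrite e1; apply: regularN; rewrite big_seq_cond; apply: (big_ind (regular iota (Qs t))).
  - by rewrite -(rmorph0 iota); apply: regular_iota.
  - by move=> u v; apply: regularD.
  move=> t' /andP[_ tt']; apply: regularM => //; first exact: regular_iota.
  have [_ h _] := homega t'; apply: h => // eQ.
  by move/eqP: tt'; apply; apply: Qinj.
have zero (cf : 'I_d.+1 -> F) : (forall k, \sum_s cf s * Om s k = 0) -> forall s, cf s = 0.
  apply: (@constants_descent F 'I_m (fun j => delta (z j)) _
    (fun cf => forall k, \sum_s cf s * Om s k = 0)) => //.
  - move=> cf' a h k; transitivity (a * \sum_s cf' s * Om s k); last by rewrite h mulr0.
    by rewrite mulr_sumr; apply: eq_bigr => s _; rewrite mulrA.
  - move=> cf' j h k; have := congr1 (delta (z j)) (h k).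
    rewrite (der0 (ddelta _)) (der_sum (ddelta _)).
    under eq_bigr => s _ do rewrite (ddelta _).2.
    rewrite big_split /=.
    have -> : \sum_i cf' i * delta (z j) (Om i k) = 0.
      (* The Lie derivative annihilates [Om s], so [delta] of its components is a combination of
         these components; applying [delta] to a relation therefore differentiates the coefficients
         alone. *)
      transitivity (- \sum_l0 (\sum_s cf' s * Om s l0) * pd k (iota (br (X l0) (z j)))); last first.
        by rewrite big1 ?oppr0 // => l0 _; rewrite h mul0r.
      under [in RHS]eq_bigr => l0 _ do rewrite mulr_suml.
      rewrite exchange_big /= -sumrN; apply: eq_bigr => s _.
      have /eqP := horizontal s j k; rewrite /lie_of addr_eq0 => /eqP ->.
      by rewrite mulrN mulr_sumr; congr (- _); apply: eq_bigr => l0 _; rewrite mulrA.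
    by rewrite add0r.
  move=> cf' h hd; have hcst s : exists g : CC, cf' s = iota g%:A.
    by apply: hconst; apply: (delta_generated hz).
  have [ga hga] := choice hcst.
  suff hh : forall t, ga t.1 * l t.1 t.2 = 0.
    move=> s; have [i li] := (hl s).1; have := hh (s, i); rewrite /= => /eqP.
    by rewrite mulf_eq0 (negPf li) orbF hga => /eqP ->; rewrite scale0r rmorph0.
  apply: indep => k.
  have := h k; rewrite /Om => hk; refine (etrans _ hk).
  rewrite (eq_bigr (fun t => iota (ga t.1 * l t.1 t.2)%:A * om (t.1, t.2) k)); last by case.
  rewrite -(pair_bigA _ (fun s i => iota (ga s * l s i)%:A * om (s, i) k)).
  apply: eq_bigr => s _; rewrite mulr_sumr; apply: eq_bigr => i _.
  by rewrite hga mulrA -rmorphM -(rmorphM (in_alg A)).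
have [|cf [[s cs] hcf]] := @linear_dependence F 'I_d.+1 'I_d (fun s k => Om s k).
  by rewrite !card_ord.
by move: cs; rewrite (zero cf hcf) eqxx.
Qed.

Lemma adjacent_incomparable Q Q' : adjacent P Q -> adjacent P Q' -> Q `<=` Q' -> Q = Q'.
Proof.
move=> [_ pQ [PQ nQP] _] [_ _ _ h'] QQ'; apply: contrapT => ne; apply: nQP.
apply: h' => //; split=> // Q'Q; apply: ne; exact/seteqP.
Qed.

(* An [R]-relation among elements [u i] lying in all the primes but the
   [i]-th has all its coefficients divisible by [g], hence is trivial. *)
Lemma relation_trivial (I : finType) (Qs : I -> set A) (u : I -> A) g : prime_elt g ->
  (forall i, adjacent P (Qs i) /\ Qs i (sA g)) ->
  (forall i j, i != j -> Qs j (u i)) -> (forall i, ~ Qs i (u i)) ->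
  forall a : I -> R, iota (\sum_i sA (a i) * u i) = 0 -> forall i, a i = 0.
Proof.
move=> pg hQ uj ui.
suff H N (a : I -> R) : (forall i, (msize (a i) <= N)%N) ->
    iota (\sum_i sA (a i) * u i) = 0 -> forall i, a i = 0.
  move=> a; apply: (H (\sum_i msize (a i))%N) => i.
  by rewrite (bigD1 i) //= leq_addr.
elim: N a => [|N IH] a hN ha.
  by move=> i; apply/eqP; rewrite -msize_poly_eq0 -leqn0.
have dv i : dvdr g (a i).
  have [hadj Qg] := hQ i; have [_ pQ [PQ _] _] := hadj; have [[Q0 QD QM] _ QP] := pQ.
  apply: (contraction_principal hfrac iX intX hadj pg Qg).
  have : Qs i (sA (a i) * u i).
    move/hfrac.1/PQ: ha; rewrite (bigD1 i) //= => hs.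
    rewrite -[X in Qs i X](addrK (\sum_(j | j != i) sA (a j) * u j)).
    apply: ideal_sub => //; apply: (big_ind (Qs i)) => // j ji.
    by apply: QM; apply: uj.
  by case/QP => // /ui.
have [b hb] := choice dv.
have g0 := prime_elt_neq0 pg.
have g00 : iota (sA g) != 0 by apply/eqP => /hfrac.1 /iX zz; move: g0; rewrite zz eqxx.
have hb0 : iota (\sum_i sA (b i) * u i) = 0.
  apply: (mulIf g00); rewrite mul0r; refine (etrans _ ha).
  rewrite -rmorphM mulr_suml; congr (iota _).
  by apply: eq_bigr => i _; rewrite hb (rmorphM sA) /= mulrAC.
have sg := prime_msize_gt1 pg.
move=> i; rewrite hb (IH b) ?mul0r // => j.
have [->|b0] := eqVneq (b j) 0; first by rewrite msize0.
have := hN j; rewrite hb msizeM //.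
have : (0 < msize (b j))%N by rewrite lt0n msize_poly_eq0.
by move: (msize (b j)) (msize g) sg => x z; lia.
Qed.

(** A/P has rank [e0] over R, so e0 + 1 elements, each lying in all but one of the primes, would
    satisfy a nontrivial R-relation. *)
Lemma bad_primes_bounded g : prime_elt g -> ~ exists Qs : 'I_e0.+1 -> set A,
  injective Qs /\ forall i, adjacent P (Qs i) /\ Qs i (sA g).
Proof.
move=> pg [Qs [Qinj hQ]].
have sep i j : exists x, i != j -> Qs j x /\ ~ Qs i x.
  have [ij|ij] := eqVneq i j; first by exists 0.
  apply: contrapT => H; move/eqP: ij; apply; apply/esym/Qinj.
  apply: adjacent_incomparable (proj1 (hQ j)) (proj1 (hQ i)) _ => x Qx.
  by apply: contrapT => nx; apply: H; exists x.
have [x hx] := choice (fun ij : 'I_e0.+1 * 'I_e0.+1 => sep ij.1 ij.2).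
pose u i := \prod_(j | j != i) x (i, j).
have uj i j : i != j -> Qs j (u i).
  move=> ij; have [_ [[_ _ QM] _ _] _ _] := proj1 (hQ j).
  rewrite /u (bigD1 j) /=; last by rewrite eq_sym.
  by rewrite mulrC; apply: QM; case: (hx (i, j) ij).
have ui i : ~ Qs i (u i).
  have [_ [_ Q1 QP] _ _] := proj1 (hQ i).
  apply: (big_ind (fun a => ~ Qs i a)) => // [a b na nb /QP[]//|j ji].
  by have [|_ h] := hx (i, j); rewrite //= eq_sym.
have [k hk] := @common_denominator A F iota R sA y D0 _ (fun i => iota (u i)) (fun i => eden (u i)).
have red i : exists f : {poly R}, (size f <= e0)%N /\ phi ^+ k * iota (u i) = e f.
  have [f hf] := hk i; have [c hc] := xdeg_exists w f.
  have [f1 [s1 _ [t ht]]] := weighted_reduction mp sp xdeg_p hc.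
  exists f1; split=> //; rewrite hf -[f](subrK f1) ht.
  have eM a a' : e (a * a') = e a * e a' by exact: rmorphM.
  have eD a a' : e (a + a') = e a + e a' by exact: rmorphD.
  by rewrite eD eM ep0 mulr0 add0r.
have [f hf] := choice red.
pose tf := @FracField.tofrac R.
have tfM a b : tf (a * b) = tf a * tf b by exact: rmorphM.
have [|c [[i0 ci0] hc]] := @linear_dependence _ 'I_e0.+1 'I_e0 (fun i j => tf (f i)`_j).
  by rewrite !card_ord.
have [n hn] := choice (fun i => frac_clear_denom (c i)); have [b hb] := choice hn.
pose a i := n i * \prod_(j | j != i) b j.
have b0 i : b i != 0 by case: (hb i).
have hab i : tf (a i) = tf (\prod_j b j) * c i.
  have [_ h] := hb i; rewrite (bigD1 i) //= /a !tfM -[tf (n i)]h.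
  by rewrite mulrAC.
have ha : iota (\sum_i sA (a i) * u i) = 0.
  suff h0 : phi ^+ k * \sum_i iota (sA (a i) * u i) = 0.
    by rewrite rmorph_sum; apply: (mulfI (expf_neq0 k phi0)); rewrite h0 mulr0.
  rewrite mulr_sumr; have -> : \sum_i phi ^+ k * iota (sA (a i) * u i) = e (\sum_i a i *: f i).
    have esum (v : 'I_e0.+1 -> {poly R}) : e (\sum_i v i) = \sum_i e (v i) by exact: rmorph_sum.
    rewrite esum; apply: eq_bigr => i _; have [_ h] := hf i.
    by rewrite frac_evalZ -h rmorphM mulrCA.
  have -> : \sum_i a i *: f i = 0; last by exact: rmorph0.
  apply/polyP => j; rewrite coef_sum coef0.
  have [hj|hj] := ltnP j e0; last first.
    rewrite big1 // => i _; have [h1 _] := hf i.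
    by rewrite coefZ nth_default ?mulr0 // (leq_trans h1).
  have tf0 (v : R) : tf v = 0 -> v = 0 by move/eqP; rewrite tofrac_eq0 => /eqP.
  have tfsum (v : 'I_e0.+1 -> R) : tf (\sum_i v i) = \sum_i tf (v i) by exact: rmorph_sum.
  apply: tf0; rewrite tfsum; transitivity (tf (\prod_j b j) * \sum_i c i * tf (f i)`_(Ordinal hj)).
    rewrite mulr_sumr; apply: eq_bigr => i _; rewrite coefZ.
    by rewrite tfM hab mulrA.
  by rewrite hc mulr0.
have a0 := relation_trivial pg hQ uj ui ha i0.
have := hab i0; rewrite a0 (_ : tf 0 = 0) => [/esym/eqP|]; last exact: rmorph0.
rewrite mulf_eq0 (negPf ci0) orbF.
rewrite tofrac_eq0; apply/negP; apply/prodf_neq0 => j _; exact: b0.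
Qed.

End PoissonForms.

(** * The equivalence *)

Lemma infinite_injection (T : choiceType) (S : set T) (I : finType) : ~ finite_set S ->
  exists f : I -> T, injective f /\ forall i, S (f i).
Proof.
move=> nS; suff [s [us ss hs]] : exists s : seq T, [/\ uniq s, size s = #|I| & forall x, x \in s -> S x].
  have lt (i : I) : (enum_rank i < size s)%N by rewrite ss; apply: ltn_ord.
  have [x0 _] : exists x0 : T, True.
    by apply: contrapT => H; apply: nS; suff -> : S = set0 by []; apply/seteqP; split=> // x; case: H; exists x.
  exists (fun i : I => nth x0 s (enum_rank i)); split; last by move=> i; apply: hs; apply: mem_nth.
  by move=> i j /eqP; rewrite nth_uniq // => /eqP/ord_inj/enum_rank_inj.
elim: #|I| => [|n [s [us ss hs]]]; first by exists [::].
have [x [Sx xs]] : exists x, S x /\ x \notin s.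
  apply: contrapT => H; apply: nS; apply/finite_seqP; exists s; apply/seteqP; split=> x /=.
    by move=> Sx; apply: contrapT => /negP nx; apply: H; exists x.
  exact: hs.
exists (x :: s); split=> //=; first by rewrite xs.
  by rewrite ss.
by move=> z; rewrite in_cons => /orP[/eqP ->|/hs].
Qed.

Lemma finite_list_union (T : Type) (K : eqType) (L : seq K) (S : K -> set T) :
  (forall l, l \in L -> finite_set (S l)) -> finite_set [set x | exists2 l, l \in L & S l x].
Proof.
elim: L => [|l L IH] h.
  by suff -> : [set x | exists2 l, l \in [::] & S l x] = set0 by []; apply/seteqP; split=> // x [].
have -> : [set x | exists2 l', l' \in l :: L & S l' x] = S l `|` [set x | exists2 l, l \in L & S l x].
  apply/seteqP; split=> x /=.
    by case=> l'; rewrite in_cons => /orP[/eqP ->|hl] Sx; [left|right; exists l'].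
  by case=> [Sx|[l' hl Sx]]; [exists l; rewrite ?mem_head|exists l'; rewrite // in_cons hl orbT].
rewrite finite_setU; split; first by apply: h; rewrite mem_head.
by apply: IH => l' hl; apply: h; rewrite in_cons hl orbT.
Qed.

Lemma prime_factors_list (A : comAlgType CC) d (X : 'I_d -> A) (D : {mpoly CC[d]}) : D != 0 ->
  exists L : seq {mpoly CC[d]}, (forall l, l \in L -> prime_elt l) /\
    forall Q, prime_ideal Q -> Q (ev (in_alg A) X D) -> exists2 l, l \in L & Q (ev (in_alg A) X l).
Proof.
move: D; apply: (ufd_ind (@ufd_mpoly _ d)) => [u uu|g r pg r0 [L [hL hQ]]].
  exists [::]; split=> // Q [[_ _ QM] Q1 _] Qu; case: Q1.
  have := QM (ev (in_alg A) X u^-1) _ Qu.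
  by rewrite -rmorphM mulVr // rmorph1.
exists (g :: L); split=> [l|Q pQ]; first by rewrite in_cons => /orP[/eqP ->|/hL].
have [_ _ QP] := pQ; rewrite rmorphM => /QP[Qg|/(hQ _ pQ)[l hl Ql]].
  by exists g; rewrite ?mem_head.
by exists l; rewrite // in_cons hl orbT.
Qed.

Section Finiteness.
Variables (A : comAlgType CC) (br : A -> A -> A).
Hypotheses (hbr : poisson_bracket br) (haff : complex_affine A).
Variable P : set A.
Hypothesis hP : poisson_prime br P.

Let pP : prime_ideal P := hP.1.

(** Expressed by transcendence degrees, consecutive heights leave no room for a prime in between. *)
Lemma adjacent_of_height n Q : height P n -> prime_ideal Q -> P `<=` Q -> height Q n.+1 ->
  adjacent P Q.
Proof.
move=> hn pQ PQ hQ; have p0 := zero_prime haff; have [t t0] := trd_exists haff p0.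
have sub0 (Q' : set A) : prime_ideal Q' -> [set 0] `<=` Q' by move=> [[h _ _] _ _] x ->.
have htE (Q' : set A) m s : prime_ideal Q' -> trd Q' m -> height Q' s -> s = (t - m)%N /\ (m <= t)%N.
  move=> pQ' tQ' hs; split; first exact: height_uniq hs (height_trd haff pQ' t0 tQ').
  have [h|h] := EM (Q' `<=` [set 0]).
    have e : Q' = [set 0] by apply/seteqP; split=> //; apply: sub0.
    by rewrite e in tQ'; rewrite (trd_uniq t0 tQ').
  exact: ltnW (trd_lt p0 pQ' (conj (sub0 _ pQ') h) t0 tQ').
have [a ta] := trd_exists haff pP; have [b tb] := trd_exists haff pQ.
have [e1 l1] := htE _ _ _ pP ta hn; have [e2 l2] := htE _ _ _ pQ tb hQ.
split=> //.
  split=> // QP; have e : P = Q by apply/seteqP.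
  by rewrite e in hn; have := height_uniq hn hQ => /eqP; rewrite -[n in n == _]addn0 -addn1 eqn_add2l.
move=> Q' pQ' PQ' Q'Q; apply: contrapT => nQ'.
have [c tc] := trd_exists haff pQ'.
have := trd_lt pP pQ' (conj PQ' nQ') ta tc; have := trd_lt pQ' pQ Q'Q tc tb.
by move: e1 e2 l1 l2; lia.
Qed.

Lemma finite_of_rational : poisson_rational br P -> next_height_finite br P.
Proof.
move=> hrat; have [F [iota hfrac]] := frac_of_quotient_exists pP.
have [brF [hbF derR]] := induced_bracket_exists hbr hP.2 hfrac.
have [bD bx _ bM bi] := hbF.
have hconst z : (forall b, brF z (iota b) = 0) -> exists l : CC, z = iota l%:A.
  move=> hz; apply: (algebraic_is_constant (iota := iota)).
  apply: (hrat _ _ _ hfrac hbF) => u.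
  exact: (der_ext hfrac.2 (derR z) (is_der0 F) hz u).
have [d [X [iX intX]]] := noether_quotient haff hfrac.
have [y [p [w0 [D0 [mp rp hp D00 [eden0 ew0]]]]]] := presentation haff hfrac iX intX.
pose sA : {rmorphism {mpoly CC[d]} -> A} := ev (in_alg A) X.
have phiE r : iota (sA r) = ev (iota \o in_alg A) (iota \o X) r by apply: ev_comp.
have eE f : frac_eval iota sA y f = (map_poly (ev (iota \o in_alg A) (iota \o X)) f).[iota y].
  by rewrite horner_iota.
have ep0 : frac_eval iota sA y p = 0 by rewrite eE; apply/eqP.
have ekerp f : frac_eval iota sA y f = 0 -> dvdr p f.
  by rewrite eE => h; apply: hp; apply/eqP.
have eden a : exists k f, iota (sA D0) ^+ k * iota a = frac_eval iota sA y f.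
  by have [k [f h]] := eden0 a; exists k, f; rewrite eE phiE.
have ew : frac_eval iota sA y (p^`() * w0) = iota (sA D0).
  by rewrite eE rmorphM /= hornerM ew0 phiE.
have phi0 : iota (sA D0) != 0 by rewrite phiE (phi_eq0 hfrac iX).
have [pd hpd] := choice (fun k => @partial_exists A P F iota hfrac _ sA y _ (fun k r => r^`M(k))
  (fun i => @mderivD _ _ i) (fun i => @mderivM _ _ i) p w0 D0 ep0 ekerp eden ew phi0 k).
have dpd k : is_der (pd k) by case: (hpd k).
have pdE k r : pd k (iota (sA r)) = iota (sA r^`M(k)) by case: (hpd k) => _ + _; apply.
have pdD k a : poly_denom iota sA y D0 (pd k (iota a)) by case: (hpd k) => _ _; apply.
pose delta b z := brF z (iota b).
have ddelta b : is_der (delta b) by split=> u v; rewrite /delta ?bD ?bM.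
have deltaE b a : delta b (iota a) = iota (br a b) by rewrite /delta bi.
pose e0 := (size p).-1; have sp : size p = e0.+1 by rewrite /e0 prednK // size_poly_gt0 monic_neq0.
(* A crude slope: for i < e0 the size of the i-th coefficient is at most [w], hence at most w (e0 -
   i). *)
pose w := (\sum_(i < e0) msize p`_i)%N.
have wp i : (msize p`_i <= (w * (e0 - i)).+1)%N.
  have [hi|hi] := ltnP i e0.
    apply: leqW; apply: leq_trans (leq_pmulr w _); last by rewrite subn_gt0.
    by rewrite /w (bigD1 (Ordinal hi)) //= leq_addr.
  have [e|ne] := eqVneq i e0; last by rewrite nth_default ?msize0 // sp ltn_neqAle eq_sym ne.
  have -> : p`_i = 1 by rewrite -(monicP mp) lead_coefE e.
  by rewrite msize1.
have p0 := zero_prime haff; have [t t0] := trd_exists haff p0.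
have hn := height_trd haff pP t0 (trd_noether hfrac iX intX).
exists (t - d)%N; split=> //; set S := [set Q | _].
have Sadj Q : S Q -> adjacent P Q.
  by move=> [pQ [PQ hQ]]; apply: adjacent_of_height hn _ PQ hQ; case: pQ.
have [L [hL hLQ]] := prime_factors_list X D00.
have fin_bad : finite_set [set Q | exists2 l, l \in L & adjacent P Q /\ Q (sA l)].
  apply: finite_list_union => l hl; apply: contrapT => /(infinite_injection 'I_e0.+1).
  move=> H; apply: (bad_primes_bounded hfrac iX intX mp sp ep0 D00 eden wp (hL _ hl)); exact: H.
have fin_good : finite_set [set Q | good_prime br P X D0 Q].
  have [M hM] := good_primes_bounded hbr haff hfrac iX intX mp sp ep0 ekerp D00 eden ew
    ddelta deltaE dpd pdE pdD wp hconst.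
  by apply: contrapT => /(infinite_injection ('I_d.+1 * 'I_M)%type).
apply: (sub_finite_set (B := [set Q | exists2 l, l \in L & adjacent P Q /\ Q (sA l)] `|`
  [set Q | good_prime br P X D0 Q])); last by rewrite finite_setU.
move=> Q SQ; have hadj := Sadj Q SQ; have [pQ _] := SQ.
have [QD|QD] := EM (Q (sA D0)); last by right.
by left; have [l hl Ql] := hLQ Q pQ.1 QD; exists l.
Qed.

End Finiteness.

Theorem theorem7p1 (A : comAlgType CC) (br : A -> A -> A)
  (hbr : poisson_bracket br) (haff : complex_affine A)
  (P : set A) (hP : poisson_prime br P) :
  (poisson_rational br P <-> poisson_primitive br P) /\
  (poisson_primitive br P <-> next_height_finite br P).
Proof.
have h1 := primitive_of_rational hbr haff hP; have h2 := rational_of_primitive hbr haff hP.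
have h3 := rational_of_finite hbr haff hP; have h4 := finite_of_rational hbr haff hP.
by split; split; auto.
Qed.
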